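(* Let $n\in\mathbb{Z}$, let $F$ be a finite field of characteristic $p>2$ and let $O$ be a complete discrete valuation ring of characteristic zero with residue field $F$. Let $\overline{\rho}:\pi_n\to\mathrm{SL}_2(F)$ be an absolutely irreducible non-acyclic representation corresponding to a root $\overline{\alpha}$ of $k_n$ in $F$ (i.e. $\operatorname{tr}\overline{\rho}(a)=\operatorname{tr}\overline{\rho}(ab)=\overline{\alpha}$), and suppose that $O$ contains a root $\alpha$ of $k_n$ which is a lift of $\overline{\alpha}$. (1) If $\dfrac{\partial f_n}{\partial y}(\overline{\alpha},\overline{\alpha})\neq0$, so that $\overline{\rho}$ admits a universal deformation $\boldsymbol{\rho}:\pi_n\to\mathrm{SL}_2(O[[x-\alpha]])$ over $O$, then $L_{\boldsymbol{\rho}}\,\dot{=}\,k_n(x)^2$ in $O[[x-\alpha]]$. If $p\nmid 3n-1$, then $\overline{\alpha}$ is always a single root of $k_n$ and $L_{\boldsymbol{\rho}}\,\dot{=}\,(x-\alpha)^2$ holds. If $p\mid 3n-1$ and $\overline{\alpha}$ has multiplicity $m$ (possibly $m>1$), then there are exactly $m$ distinct lifts $\alpha_1=\alpha,\dots,\alpha_m$ of $\overline{\alpha}$ that are roots of $k_n$ in an extension of $O$, and $L_{\boldsymbol{\rho}}\,\dot{=}\,\prod_{1\le i\le m}(x-\alpha_i)^2$ holds. (2) If instead $\dfrac{\partial f_n}{\partial x}(\overline{\alpha},\overline{\alpha})\neq0$, so that $\overline{\rho}$ admits a universal deformation $\boldsymbol{\rho}:\pi_n\to\mathrm{SL}_2(O[[y-\alpha]])$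 over $O$, then $L_{\boldsymbol{\rho}}\,\dot{=}\,k_n(y)^2$ in $O[[y-\alpha]]$, and the formulas obtained from those in (1) by replacing $x$ by $y$ hold. (3) If both $\dfrac{\partial f_n}{\partial x}(\overline{\alpha},\overline{\alpha})\neq0$ and $\dfrac{\partial f_n}{\partial y}(\overline{\alpha},\overline{\alpha})\neq0$, then the $L$-functions in $O[[x-\alpha]]$ and $O[[y-\alpha]]$ coincide (up to units) via $x=y$.
   Context: The group of the twist knot $J(2,2n)$ is $\pi_n=\langle a,b\mid aw^n=w^nb\rangle$, $w=ab^{-1}a^{-1}b$. Polynomials. $\mathcal{S}_m(z)\in\mathbb{Z}[z]$ ($m\in\mathbb{Z}$) is defined by $\mathcal{S}_0=0$, $\mathcal{S}_1=1$, $\mathcal{S}_{m+1}-z\mathcal{S}_m+\mathcal{S}_{m-1}=0$. Put $z=2x^2-x^2y+y^2-2$ and $f_n(x,y)=(y-1)\mathcal{S}_n(z)-\mathcal{S}_{n-1}(z)\in\mathbb{Z}[x,y]$. The polynomials $k_m\in\mathbb{Z}[x]$ ($m\in\mathbb{Z}$) are defined by $k_0=-1$, $k_1=1$, $k_{2m}-(x^2-3x)k_{2m-1}+k_{2m-2}=0$, $k_{2m+1}+xk_{2m}+k_{2m-1}=0$. Representations. A representation over a field is absolutely irreducible if it is irreducible over an algebraic closure; it is acyclic if $H_i(\pi_n,\overline{\rho})=0$ for every $i$, and non-acyclic otherwise. Deformations. A deformation of $\overline{\rho}$ over a complete local $O$-algebra $R$ (with residue field $F$) is a representation $\rho:\pi_n\to\mathrm{SL}_2(R)$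 whose reduction modulo the maximal ideal is $\overline{\rho}$. Two representations over $R$ are strictly equivalent if they are conjugate and their reductions modulo the maximal ideal coincide. A universal deformation over $O$ is a deformation $\boldsymbol{\rho}:\pi_n\to\mathrm{SL}_2(\mathcal{R})$ such that every deformation over any $R$ factors uniquely through $\boldsymbol{\rho}$ up to strict equivalence; it is unique up to $O$-isomorphism and strict equivalence. In (1), with $y_f(x)\in O[[x-\alpha]]$ the element given by Hensel's lemma with $y_f(\alpha)=\alpha$, $f_n(x,y_f(x))=0$, the universal deformation over $O[[x-\alpha]]$ has $\operatorname{tr}\boldsymbol{\rho}(a)=x$, $\operatorname{tr}\boldsymbol{\rho}(ab)=y_f(x)$; in (2), symmetrically, $\operatorname{tr}\boldsymbol{\rho}(ab)=y$, $\operatorname{tr}\boldsymbol{\rho}(a)=x_f(y)\in O[[y-\alpha]]$ with $x_f(\alpha)=\alpha$, $f_n(x_f(y),y)=0$. $L$-function. If $\mathcal{R}$ is a Noetherian UFD and $H_1(\pi_n,\boldsymbol{\rho})$ (local coefficients) is a finitely generated torsion $\mathcal{R}$-module, $L_{\boldsymbol{\rho}}\in\mathcal{R}/\dot{=}$ is the order of $H_1(\pi_n,\boldsymbol{\rho})$, i.e. a generator of the divisorial hull (the intersection of all principal ideals containing it) of its Fitting ideal; $\dot{=}$ denotes equality up to multiplication by units of $\mathcal{R}$. *)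

(* Defs.v *)
From HB Require Import structures.
From mathcomp Require Import all_boot all_order all_algebra ring_quotient.
From mathcomp Require Import zify.
From mathcomp Require Import boolp classical_sets functions cardinality fsbigop.

Set Implicit Arguments.
Unset Strict Implicit.
Unset Printing Implicit Defensive.

Import Order.TTheory GRing.Theory Num.Theory.
Local Open Scope classical_set_scope.
Local Open Scope ring_scope.
Local Open Scope quotient_scope.

(* (false, e) stands for a^{+-1} and (true, e) for b^{+-1}; e = true means    *)
(* the inverse letter.                                                        *)
Notation word := (seq (bool * bool)).

Definition wgen (x : bool) : word := [:: (x, false)].
Definition winv (u : word) : word := [seq (l.1, ~~ l.2) | l <- rev u].
Definition wpow (u : word) (n : int) : word :=
  match n with
  | Posz m => flatten (nseq m u)
  | Negz m => flatten (nseq m.+1 (winv u))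
  end.

Inductive pres_eq (lhs rhs : word) : word -> word -> Prop :=
| pres_refl u : pres_eq lhs rhs u u
| pres_sym u v : pres_eq lhs rhs u v -> pres_eq lhs rhs v u
| pres_trans u v w :
    pres_eq lhs rhs u v -> pres_eq lhs rhs v w -> pres_eq lhs rhs u w
| pres_cat u1 u2 v1 v2 :
    pres_eq lhs rhs u1 v1 -> pres_eq lhs rhs u2 v2 ->
    pres_eq lhs rhs (u1 ++ u2) (v1 ++ v2)
| pres_free x e : pres_eq lhs rhs [:: (x, e); (x, ~~ e)] [::]
| pres_rel : pres_eq lhs rhs lhs rhs.

Section PresentedGroup.
Variables lhs rhs : word.
Local Notation "u ~ v" := (pres_eq lhs rhs u v) (at level 70).

Lemma winvK : involutive winv.
Proof.
by move=> u; rewrite /winv -map_rev revK -map_comp map_id_in // => -[x e] _;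
  rewrite /= negbK.
Qed.

Lemma winv_cat u v : winv (u ++ v) = winv v ++ winv u.
Proof. by rewrite /winv rev_cat map_cat. Qed.

Lemma pres_mulV u : u ++ winv u ~ [::].
Proof.
elim: u => [|[x e] u IH]; first exact: pres_refl.
rewrite -cat1s winv_cat -catA [u ++ _]catA.
apply: pres_trans (pres_free lhs rhs x e).
apply: (@pres_cat _ _ [:: (x, e)] _ [:: (x, e)] [:: (x, ~~ e)]).
  exact: pres_refl.
exact: (@pres_cat _ _ _ [:: (x, ~~ e)] [::]) IH (pres_refl _ _ _).
Qed.

Lemma pres_Vmul u : winv u ++ u ~ [::].
Proof. by rewrite -{2}[u]winvK; exact: pres_mulV. Qed.

Lemma pres_inv u v : u ~ v -> winv u ~ winv v.
Proof.
move=> uv; apply: (@pres_trans _ _ _ (winv u ++ (v ++ winv v))).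
  rewrite -[X in X ~ _]cats0; apply: pres_cat (pres_refl _ _ _) _.
  exact/pres_sym/pres_mulV.
rewrite catA -[X in _ ~ X]cat0s; apply: pres_cat (pres_refl _ _ _).
apply: pres_trans (pres_Vmul u); apply: pres_cat (pres_refl _ _ _) _.
exact: pres_sym.
Qed.

Definition pres_eqb (u v : word) : bool := `[< u ~ v >].

Lemma pres_eqb_equiv : equiv_class_of pres_eqb.
Proof.
split=> [u|u v|v u w].
- exact/asboolP/pres_refl.
- by apply/asboolP/asboolP; exact: pres_sym.
- by move=> /asboolP uv /asboolP vw; apply/asboolP; exact: pres_trans vw.
Qed.

Canonical pres_equiv := EquivRelPack pres_eqb_equiv.
Canonical pres_encModRel := defaultEncModRel pres_eqb.

Definition presented_group : Type := {eq_quot pres_eqb}.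
HB.instance Definition _ := Quotient.on presented_group.
HB.instance Definition _ := Choice.on presented_group.

Definition pres_class (u : word) : presented_group := \pi_presented_group u.

Lemma pres_classP u v : pres_class u = pres_class v <-> u ~ v.
Proof.
rewrite /pres_class; split=> [/eqmodP/asboolP //|uv].
by apply/eqmodP/asboolP.
Qed.

Lemma pres_class_repr (x : presented_group) : pres_class (repr x) = x.
Proof. exact: reprK. Qed.

Definition pres_one : presented_group := pres_class [::].
Definition pres_mul (x y : presented_group) := pres_class (repr x ++ repr y).
Definition pres_invg (x : presented_group) := pres_class (winv (repr x)).

Lemma pres_mulE u v : pres_mul (pres_class u) (pres_class v) = pres_class (u ++ v).
Proof.
by apply/pres_classP/pres_cat; apply/pres_classP; rewrite pres_class_repr.
Qed.

Lemma pres_invE u : pres_invg (pres_class u) = pres_class (winv u).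
Proof. by apply/pres_classP/pres_inv/pres_classP; rewrite pres_class_repr. Qed.

Lemma pres_mulA : associative pres_mul.
Proof.
move=> x y z; rewrite -[x]pres_class_repr -[y]pres_class_repr.
by rewrite -[z]pres_class_repr !pres_mulE catA.
Qed.

Lemma pres_mul1 : left_id pres_one pres_mul.
Proof. by move=> x; rewrite -[x]pres_class_repr pres_mulE. Qed.

Lemma pres_mulr1 : right_id pres_one pres_mul.
Proof. by move=> x; rewrite -[x]pres_class_repr pres_mulE cats0. Qed.

Lemma pres_mulVg : left_inverse pres_one pres_invg pres_mul.
Proof.
move=> x; rewrite -[x]pres_class_repr pres_invE pres_mulE.
exact/pres_classP/pres_Vmul.
Qed.

Lemma pres_mulgV : right_inverse pres_one pres_invg pres_mul.
Proof.
move=> x; rewrite -[x]pres_class_repr pres_invE pres_mulE.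
exact/pres_classP/pres_mulV.
Qed.

HB.instance Definition _ := isGroup.Build presented_group
  pres_mulA pres_mul1 pres_mulr1 pres_mulVg pres_mulgV.

End PresentedGroup.

Definition twist_word : word :=
  wgen false ++ winv (wgen true) ++ winv (wgen false) ++ wgen true.

Definition twist_group (n : int) : groupType :=
  presented_group (wgen false ++ wpow twist_word n)
                  (wpow twist_word n ++ wgen true).

Definition twist_a (n : int) : twist_group n := pres_class _ _ (wgen false).
Definition twist_b (n : int) : twist_group n := pres_class _ _ (wgen true).

Section TwoSided.
Variables (R : comNzRingType) (e : nat -> R).

(* u_{j+1} = e_j u_j - u_{j-1}; as e will only depend on the parity of the    *)
(* index, it is applied to |j|.                                               *)
Fixpoint three_term (u0 u1 : R) (j : nat) : R * R :=
  if j is j'.+1 then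
    let: (x, y) := three_term u0 u1 j' in (y, e j'.+1 * y - x)
  else (u0, u1).

Definition two_sided (u0 u1 : R) (m : int) : R :=
  match m with
  | Posz j => (three_term u0 u1 j).1
  | Negz j => (three_term u0 (e 0%N * u0 - u1) j.+1).1
  end.

Lemma three_term2 u0 u1 j :
  three_term u0 u1 j = ((three_term u0 u1 j).1, (three_term u0 u1 j.+1).1).
Proof. by rewrite /=; case: (three_term u0 u1 j). Qed.

Lemma three_termS u0 u1 j :
  (three_term u0 u1 j.+2).1
    = e j.+1 * (three_term u0 u1 j.+1).1 - (three_term u0 u1 j).1.
Proof. by rewrite /=; case: (three_term u0 u1 j). Qed.

Lemma two_sided0 u0 u1 : two_sided u0 u1 0 = u0. Proof. by []. Qed.
Lemma two_sided1 u0 u1 : two_sided u0 u1 1 = u1. Proof. by []. Qed.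

Lemma two_sidedP u0 u1 (m : int) :
  two_sided u0 u1 (m + 1) - e `|m|%N * two_sided u0 u1 m
    + two_sided u0 u1 (m - 1) = 0.
Proof.
case: m => [[|j]|[|j]].
- by rewrite add0r sub0r /= addrA subrK subrr.
- have -> : Posz j.+1 + 1 = Posz j.+2 by rewrite intS addrC.
  have -> : Posz j.+1 - 1 = Posz j by rewrite intS addrC addKr.
  rewrite -[two_sided _ _ (Posz j.+2)]/((three_term u0 u1 j.+2).1) three_termS /=.
  by case: (three_term u0 u1 j) => x y /=; rewrite addrAC subrK subrr.
- have -> : Negz 0 + 1 = 0 by [].
  have -> : Negz 0 - 1 = Negz 1 by [].
  by rewrite /= addrA subrK subrr.
- have -> : Negz j.+1 + 1 = Negz j by rewrite !NegzE intS opprD addrC addNKr.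
  have -> : Negz j.+1 - 1 = Negz j.+2 by rewrite !NegzE [in RHS]intS opprD addrC.
  set v1 := e 0%N * u0 - u1.
  rewrite -[two_sided _ _ (Negz j.+2)]/((three_term u0 v1 j.+3).1) three_termS.
  rewrite -[two_sided _ _ (Negz j.+1)]/((three_term u0 v1 j.+2).1).
  rewrite -[two_sided _ _ (Negz j)]/((three_term u0 v1 j.+1).1).
  by rewrite addrA subrK subrr.
Qed.

End TwoSided.

Definition S_poly (m : int) : {poly int} := two_sided (fun=> 'X) 0 1 m.

Definition k_poly (m : int) : {poly int} :=
  two_sided (fun j => if odd j then 'X^2 - 3%:R *: 'X else - 'X) (-1) 1 m.

Lemma S_polyP m : S_poly (m + 1) - 'X * S_poly m + S_poly (m - 1) = 0.
Proof. exact: two_sidedP. Qed.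

Lemma k_poly_even (m : int) :
  k_poly (2 * m) - ('X^2 - 3%:R *: 'X) * k_poly (2 * m - 1) + k_poly (2 * m - 2) = 0.
Proof.
have -> : 2 * m - 2 = 2 * m - 1 - 1 by lia.
have := two_sidedP (fun j => if odd j then 'X^2 - 3%:R *: 'X else - 'X)
  (-1 : {poly int}) 1 (2 * m - 1).
have -> : odd `|(2 * m - 1)%R|%N by lia.
by rewrite subrK.
Qed.

Lemma k_poly_odd (m : int) :
  k_poly (2 * m + 1) + 'X * k_poly (2 * m) + k_poly (2 * m - 1) = 0.
Proof.
have := two_sidedP (fun j => if odd j then 'X^2 - 3%:R *: 'X else - 'X)
  (-1 : {poly int}) 1 (2 * m).
rewrite abszM oddM /= mulNr opprK; exact.
Qed.

Definition int_eval (R : nzRingType) (q : {poly int}) (x : R) : R :=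
  (map_poly intr q).[x].

(* Bivariate integral polynomials follow the convention of polyXY: 'X is the  *)
(* variable x, 'Y is the variable y, and q.[x, y] evaluates them in this      *)
(* order.                                                                     *)
Definition int_eval2 (R : comNzRingType) (q : {poly {poly int}}) (x y : R) : R :=
  (map_poly (map_poly intr) q).[x, y].

Definition f_poly (n : int) : {poly {poly int}} :=
  let z := 2%:R * 'X^2 - 'X^2 * 'Y + 'Y ^+ 2 - 2%:R in
  ('Y - 1) * int_eval (S_poly n) z - int_eval (S_poly (n - 1)) z.

Definition dx_poly (q : {poly {poly int}}) : {poly {poly int}} := q^`().
Definition dy_poly (q : {poly {poly int}}) : {poly {poly int}} :=
  map_poly (@deriv int) q.

Record series (R : Type) := Series { scoef : nat -> R }.

Section SeriesRing.
Variable R : comNzRingType.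
Implicit Types f g h : series R.

HB.instance Definition _ := [isNew for @scoef R].
HB.instance Definition _ := [Choice of series R by <:].

Lemma seriesP f g : scoef f =1 scoef g -> f = g.
Proof. by case: f g => [f] [g] /= /funext ->. Qed.

Definition series_zero : series R := Series (fun=> 0).
Definition series_opp f := Series (fun n => - scoef f n).
Definition series_add f g := Series (fun n => scoef f n + scoef g n).
Definition series_one : series R := Series (fun n => (n == 0)%:R).
Definition series_mul f g :=
  Series (fun n => \sum_(i < n.+1) scoef f i * scoef g (n - i)%N).

Lemma series_addA : associative series_add.
Proof. by move=> f g h; apply: seriesP => n; rewrite /= addrA. Qed.
Lemma series_addC : commutative series_add.
Proof. by move=> f g; apply: seriesP => n; rewrite /= addrC. Qed.
Lemma series_add0 : left_id series_zero series_add.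
Proof. by move=> f; apply: seriesP => n; rewrite /= add0r. Qed.
Lemma series_addN : left_inverse series_zero series_opp series_add.
Proof. by move=> f; apply: seriesP => n; rewrite /= addNr. Qed.

HB.instance Definition _ := GRing.isZmodule.Build (series R)
  series_addA series_addC series_add0 series_addN.

Definition series_trunc (n : nat) f : {poly R} := \poly_(i < n.+1) scoef f i.

Lemma series_mul_trunc f g n m : (m <= n)%N ->
  scoef (series_mul f g) m = (series_trunc n f * series_trunc n g)`_m.
Proof.
move=> le_mn; rewrite coefM /=; apply: eq_bigr => i _; rewrite !coef_poly.
have le_im : (i <= m)%N by rewrite -ltnS.
by rewrite !ltnS (leq_trans le_im le_mn) (leq_trans (leq_subr _ _) le_mn).
Qed.

Lemma series_mulC : commutative series_mul.
Proof.
by move=> f g; apply: seriesP => n; rewrite !(series_mul_trunc _ _ (leqnn n)) mulrC.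
Qed.

Lemma series_mulA : associative series_mul.
Proof.
move=> f g h; apply: seriesP => n.
transitivity ((series_trunc n f * (series_trunc n g * series_trunc n h))`_n).
  rewrite /= coefM; apply: eq_bigr => i _; rewrite coef_poly ltn_ord.
  by rewrite -series_mul_trunc ?leq_subr.
rewrite mulrA /= coefM; apply: eq_bigr => i _.
rewrite -series_mul_trunc; last by rewrite -ltnS.
by rewrite coef_poly ltnS leq_subr.
Qed.

Lemma series_mul1 : left_id series_one series_mul.
Proof.
move=> f; apply: seriesP => n; rewrite /= big_ord_recl /= subn0 mul1r.
by rewrite big1 ?addr0 // => i _; rewrite mul0r.
Qed.

Lemma series_mulDl : left_distributive series_mul series_add.
Proof.
move=> f g h; apply: seriesP => n; rewrite /= -big_split /=.
by apply: eq_bigr => i _; rewrite mulrDl.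
Qed.

Lemma series_one_neq0 : series_one != 0.
Proof. by apply/eqP => /(congr1 (fun f => scoef f 0)) /= /eqP; rewrite oner_eq0. Qed.

HB.instance Definition _ := GRing.Zmodule_isComNzRing.Build (series R)
  series_mulA series_mulC series_mul1 series_mulDl series_one_neq0.

Definition series_unit : {pred series R} := fun f => `[< exists g, g * f = 1 >].
Definition series_inv f : series R :=
  if pselect (exists g, g * f = 1) is left ex_g then projT1 (cid ex_g) else f.

Lemma series_mulV : {in series_unit, left_inverse 1 series_inv *%R}.
Proof.
move=> f /asboolP f_unit; rewrite /series_inv.
by case: pselect => // ex_g; case: cid.
Qed.

Lemma series_unitP f g : g * f = 1 -> f \in series_unit.
Proof. by move=> gf1; apply/asboolP; exists g. Qed.

Lemma series_inv_out : {in [predC series_unit], series_inv =1 id}.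
Proof.
move=> f /negP nf; rewrite /series_inv; case: pselect => // f_unit.
by case: nf; apply/asboolP.
Qed.

HB.instance Definition _ := GRing.ComNzRing_hasMulInverse.Build (series R)
  series_mulV series_unitP series_inv_out.

Definition series_scale (c : R) f : series R := Series (fun n => c * scoef f n).

Lemma series_scaleA a b f :
  series_scale a (series_scale b f) = series_scale (a * b) f.
Proof. by apply: seriesP => n; rewrite /= mulrA. Qed.
Lemma series_scale1 : left_id 1 series_scale.
Proof. by move=> f; apply: seriesP => n; rewrite /= mul1r. Qed.
Lemma series_scaleDr : right_distributive series_scale +%R.
Proof. by move=> a f g; apply: seriesP => n; rewrite /= mulrDr. Qed.
Lemma series_scaleDl f : {morph series_scale^~ f : a b / a + b}.
Proof. by move=> a b; apply: seriesP => n; rewrite /= mulrDl. Qed.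

HB.instance Definition _ := GRing.Zmodule_isLmodule.Build R (series R)
  series_scaleA series_scale1 series_scaleDr series_scaleDl.

Lemma series_scaleAl (a : R) f g : a *: (f * g) = (a *: f) * g.
Proof.
apply: seriesP => n; rewrite /= mulr_sumr.
by apply: eq_bigr => i _; rewrite mulrA.
Qed.

HB.instance Definition _ :=
  GRing.Lmodule_isLalgebra.Build R (series R) series_scaleAl.
HB.instance Definition _ := GRing.Lalgebra_isComAlgebra.Build R (series R).

Definition scoef0 f : R := scoef f 0.

Lemma scoef0_is_zmod_morphism : zmod_morphism scoef0.
Proof. by []. Qed.
Lemma scoef0_is_monoid_morphism : monoid_morphism scoef0.
Proof. by split=> // f g; rewrite /scoef0 /= big_ord1. Qed.

HB.instance Definition _ :=
  GRing.isZmodMorphism.Build (series R) R scoef0 scoef0_is_zmod_morphism.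
HB.instance Definition _ :=
  GRing.isMonoidMorphism.Build (series R) R scoef0 scoef0_is_monoid_morphism.

(* The power series in T = t - c are written R[[t - c]], and then             *)
(* t = c + T.                                                                 *)
Definition series_T : series R := Series (fun n => (n == 1)%:R).
Definition series_var (c : R) : series R := c%:A + series_T.

End SeriesRing.

HB.instance Definition _ (R : comUnitRingType) := GRing.Lmodule.on (series R).

Definition series_map (R S : Type) (phi : R -> S) (f : series R) : series S :=
  Series (phi \o scoef f).

Record sl2rep (G : groupType) (R : comNzRingType) := SL2Rep {
  rep_mx :> G -> 'M[R]_2;
  rep_mxM : forall g h : G, rep_mx (g * h)%g = rep_mx g *m rep_mx h;
  rep_det : forall g : G, \det (rep_mx g) = 1
}.

Section MapRep.
Variables (G : groupType) (R S : comNzRingType) (phi : {rmorphism R -> S}).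
Variable rho : sl2rep G R.

Lemma map_rep_mxM (g h : G) :
  map_mx phi (rho (g * h)%g) = map_mx phi (rho g) *m map_mx phi (rho h).
Proof. by rewrite rep_mxM map_mxM. Qed.

Lemma map_rep_det (g : G) : \det (map_mx phi (rho g)) = 1.
Proof. by rewrite det_map_mx rep_det rmorph1. Qed.

Definition map_rep : sl2rep G S := SL2Rep map_rep_mxM map_rep_det.

End MapRep.

Definition irreducible_rep (G : groupType) (K : fieldType) (rho : sl2rep G K) :=
  forall U : 'M[K]_2, (forall g, stablemx U (rho g)) -> U = 0 \/ row_full U.

Definition absolutely_irreducible (G : groupType) (F : fieldType)
    (rho : sl2rep G F) :=
  exists (K : closedFieldType) (iota : {rmorphism F -> K}),
    integralRange iota /\ irreducible_rep (map_rep iota rho).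

Section QuotientModule.
Variables (R : pzRingType) (V : lmodType R) (P : {pred V}).
Hypothesis P_submod : submod_closed P.

Definition submod_pred of submod_closed P : {pred V} := P.
Local Notation B := (submod_pred P_submod).
HB.instance Definition _ := GRing.isSubmodClosed.Build R V B P_submod.

Definition quotmod : Type := Quotient.quot B.
HB.instance Definition _ := GRing.Zmodule.on quotmod.

Definition quotmod_class (v : V) : quotmod := \pi_(Quotient.quot B) v.

Lemma quotmod_classP u v : quotmod_class u = quotmod_class v <-> u - v \in P.
Proof.
rewrite /quotmod_class; split=> [/eqP|uv].
  by rewrite -Quotient.idealrBE.
by apply/eqP; rewrite -Quotient.idealrBE.
Qed.

Lemma quotmod_class_repr (x : quotmod) : quotmod_class (repr x) = x.
Proof. exact: reprK. Qed.

Lemma quotmod_classD u v :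
  quotmod_class (u + v) = quotmod_class u + quotmod_class v.
Proof. exact: Quotient.pi_add. Qed.

Definition quotmod_scale (a : R) (x : quotmod) : quotmod :=
  quotmod_class (a *: repr x).

Lemma quotmod_scaleE a v :
  quotmod_scale a (quotmod_class v) = quotmod_class (a *: v).
Proof.
apply/quotmod_classP; rewrite -scalerBr (@rpredZ _ _ B) //.
by apply/quotmod_classP; rewrite quotmod_class_repr.
Qed.

Lemma quotmod_scaleA a b x :
  quotmod_scale a (quotmod_scale b x) = quotmod_scale (a * b) x.
Proof. by rewrite -[x]quotmod_class_repr !quotmod_scaleE scalerA. Qed.
Lemma quotmod_scale1 : left_id 1 quotmod_scale.
Proof. by move=> x; rewrite -[x]quotmod_class_repr quotmod_scaleE scale1r. Qed.
Lemma quotmod_scaleDr : right_distributive quotmod_scale +%R.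
Proof.
move=> a x y; rewrite -[x]quotmod_class_repr -[y]quotmod_class_repr.
by rewrite -quotmod_classD !quotmod_scaleE scalerDr quotmod_classD.
Qed.
Lemma quotmod_scaleDl x : {morph quotmod_scale^~ x : a b / a + b}.
Proof.
move=> a b; rewrite -[x]quotmod_class_repr !quotmod_scaleE scalerDl.
exact: quotmod_classD.
Qed.

HB.instance Definition _ := GRing.Zmodule_isLmodule.Build R quotmod
  quotmod_scaleA quotmod_scale1 quotmod_scaleDr quotmod_scaleDl.

End QuotientModule.

Section LinearHomology.
Variables (R : pzRingType) (U V W : lmodType R).
Variables (g : {linear U -> V}) (f : {linear V -> W}).

Definition kernel_pred : {pred V} := fun v => f v == 0.

Lemma kernel_submod_closed : submod_closed kernel_pred.
Proof.
split=> [|a u v /eqP fu0 /eqP fv0]; first by rewrite unfold_in linear0.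
by rewrite unfold_in linearP fu0 fv0 scaler0 addr0.
Qed.
HB.instance Definition _ :=
  GRing.isSubmodClosed.Build R V kernel_pred kernel_submod_closed.

Record kernel : Type := Kernel {kernel_val :> V; _ : kernel_pred kernel_val}.
HB.instance Definition _ := [isSub for kernel_val].
HB.instance Definition _ := [Choice of kernel by <:].
HB.instance Definition _ := [SubChoice_isSubLmodule of kernel by <:].

Definition image_pred : {pred kernel} := fun z => `[< exists u, val z = g u >].

Lemma image_submod_closed : submod_closed image_pred.
Proof.
split=> [|a y z /asboolP[u yE] /asboolP[v zE]]; apply/asboolP.
  by exists 0; rewrite linear0.
by exists (a *: u + v); rewrite linearP -yE -zE.
Qed.
Definition linear_homology : lmodType R := quotmod image_submod_closed.

End LinearHomology.

Section GroupHomology.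
Variables (G : groupType) (R : comNzRingType) (rho : sl2rep G R).

(* A k-chain is a finite sum of [g_0|...|g_{k-1}] (x) v, with v in the right  *)
(* module R^2 of row vectors, on which g acts by v |-> v * rho g.             *)
Definition chain_pred k : {pred {ffun 'I_k -> G} -> 'rV[R]_2} :=
  fun c => `[< finite_set [set g | c g <> 0] >].

Lemma chain_submod_closed k : submod_closed (@chain_pred k).
Proof.
split=> [|a c d /asboolP cfin /asboolP dfin]; apply/asboolP.
  by rewrite (_ : [set g | _] = set0) // -subset0 => g /=; exact.
apply: (@sub_finite_set _ _ ([set g | c g <> 0] `|` [set g | d g <> 0])).
  move=> g /=; case: (pselect (c g = 0)) => [c0|]; last by left.
  by move=> cd; right => d0; apply: cd; rewrite fctE /= !fctE c0 d0 scaler0 addr0.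
by rewrite finite_setU.
Qed.
HB.instance Definition _ k := GRing.isSubmodClosed.Build R
  ({ffun 'I_k -> G} -> 'rV[R]_2) (@chain_pred k) (chain_submod_closed k).

Record chain k : Type := Chain {
  chain_val :> {ffun 'I_k -> G} -> 'rV[R]_2;
  _ : chain_pred chain_val
}.
HB.instance Definition _ k := [isSub for @chain_val k].
HB.instance Definition _ k := [Choice of chain k by <:].
HB.instance Definition _ k := [SubChoice_isSubLmodule of chain k by <:].

(* Face 0 drops g_0, face i (0 < i <= k) multiplies g_{i-1} and g_i, and      *)
(* face k+1 drops g_k.                                                        *)
Definition face k (i : 'I_k.+2) (g : {ffun 'I_k.+1 -> G}) : {ffun 'I_k -> G} :=
  [ffun j : 'I_k =>
     let g0 := g (widen_ord (leqnSn k) j) in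
     let g1 := g (lift ord0 j) in
     if (j.+1 < i)%N then g0 else if j.+1 == i then (g0 * g1)%g else g1].

Definition face_coef k (i : 'I_k.+2) (g : {ffun 'I_k.+1 -> G}) (v : 'rV[R]_2) :=
  if i == ord0 then v *m rho (g ord0) else (-1) ^+ i *: v.

Definition boundary_fun k (c : chain k.+1) (h : {ffun 'I_k -> G}) : 'rV[R]_2 :=
  \sum_(i < k.+2) \sum_(g \in [set g | face i g = h]) face_coef i g (c g).

Lemma face_coef_linear k (i : 'I_k.+2) g : linear (face_coef i g).
Proof.
move=> a u v; rewrite /face_coef; case: ifP => _.
  by rewrite mulmxDl scalemxAl.
by rewrite scalerDr !scalerA mulrC.
Qed.

Lemma face_coef0 k (i : 'I_k.+2) g : face_coef i g 0 = 0.
Proof. by rewrite /face_coef mul0mx scaler0 if_same. Qed.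

Lemma chain_finite k (c : chain k) : finite_set [set g | c g <> 0].
Proof. by have /asboolP := valP c. Qed.

Lemma boundary_fin k (c : chain k.+1) : chain_pred (boundary_fun c).
Proof.
apply/asboolP.
pose S := \big[setU/set0]_(i < k.+2) (face i @` [set g | c g <> 0]).
apply: (@sub_finite_set _ _ S); last first.
  rewrite /S; elim/big_rec: _ => [|i A _ fA]; first exact: finite_set0.
  by rewrite finite_setU; split=> //; exact/finite_image/chain_finite.
move=> h /= bh; apply: contrapT => nSh; apply: bh.
rewrite /boundary_fun big1 // => i _; apply: fsbig1 => g /= gh.
have [->|cg] := pselect (c g = 0); first exact: face_coef0.
case: nSh; rewrite /S (bigD1 i) //=; left; by exists g.
Qed.

Definition boundary_pos k (c : chain k.+1) : chain k := Chain (boundary_fin c).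

Definition boundary k : chain k -> chain k.-1 :=
  match k with 0 => fun=> 0 | k'.+1 => @boundary_pos k' end.

Lemma boundary_linear k : linear (@boundary k).
Proof.
case: k => [|k] a c d; first by rewrite /= scaler0 addr0.
apply: val_inj; apply/funext => h.
have -> : val (boundary_pos (a *: c + d)) h = boundary_fun (a *: c + d) h by [].
have -> : val (a *: boundary_pos c + boundary_pos d) h =
  a *: boundary_fun c h + boundary_fun d h by [].
rewrite /boundary_fun scaler_sumr -big_split /=; apply: eq_bigr => i _.
pose A := [set g : {ffun 'I_k.+1 -> G} | c g <> 0] `|` [set g | d g <> 0].
have finA : finite_set A by rewrite finite_setU; split; exact: chain_finite.
have cA g : ~ A g -> c g = 0.
  by move=> nA; apply: contrapT => cg; apply: nA; left.
have dA g : ~ A g -> d g = 0.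
  by move=> nA; apply: contrapT => dg; apply: nA; right.
have restr (e : chain k.+1) : (forall g, ~ A g -> e g = 0) ->
    \sum_(g \in [set g | face i g = h]) face_coef i g (e g) =
    \sum_(g \in [set g | face i g = h] `&` A) face_coef i g (e g).
  move=> e0; apply/esym/fsbig_widen => [g []//|g [gh nA] /=].
  by rewrite e0 ?face_coef0 // => Ag; apply: nA.
have finB : finite_set ([set g | face i g = h] `&` A).
  by apply: sub_finite_set finA => g [].
rewrite (restr c cA) (restr d dA) (restr (a *: c + d)); last first.
  move=> g nA; transitivity (a *: c g + d g); first by [].
  by rewrite (cA _ nA) (dA _ nA) scaler0 addr0.
rewrite !(fsbig_finite _ _ finB) /= scaler_sumr -big_split /=.
by apply: eq_bigr => g _; exact: face_coef_linear.
Qed.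
HB.instance Definition _ k :=
  GRing.isLinear.Build R (chain k) (chain k.-1) _ (@boundary k) (@boundary_linear k).

Definition homology (k : nat) : lmodType R :=
  linear_homology (@boundary k.+1) (@boundary k).

Definition acyclic : Prop := forall (k : nat) (x : homology k), x = 0.

End GroupHomology.

Definition torsion_module (R : comNzRingType) (M : lmodType R) : Prop :=
  forall x : M, exists2 r : R, r != 0 & r *: x = 0.

(* R^l --A--> R^r --> M --> 0 is exact, with row vectors, and the images in M *)
(* of the standard basis vectors are the m j.                                 *)
Definition presentation (R : comNzRingType) (M : lmodType R) (l r : nat)
    (A : 'M[R]_(l, r)) (m : 'I_r -> M) : Prop :=
  (forall x : M, exists c : 'rV[R]_r, x = \sum_j c 0 j *: m j) /\
  (forall c : 'rV[R]_r,
     \sum_j c 0 j *: m j = 0 <-> exists d : 'rV[R]_l, c = d *m A).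

Definition principal_ideal (R : comNzRingType) (c : R) : set R :=
  [set x | exists s, x = s * c].

(* The repeated rows that s may select contribute zero minors.                *)
Definition minors_ideal (R : comNzRingType) (l r : nat) (A : 'M[R]_(l, r)) :
    set R :=
  [set x | exists b : {ffun 'I_r -> 'I_l} -> R,
     x = \sum_s b s * \det (rowsub s A)].

Definition is_fitting_ideal (R : comNzRingType) (M : lmodType R) (I : set R) :
    Prop :=
  exists (l r : nat) (A : 'M[R]_(l, r)) (m : 'I_r -> M),
    presentation A m /\ I = minors_ideal A.

Definition divisorial_hull (R : comNzRingType) (I : set R) : set R :=
  \bigcap_(c in [set c | I `<=` principal_ideal c]) principal_ideal c.

Definition is_order (R : comNzRingType) (M : lmodType R) (d : R) : Prop :=
  exists2 I, is_fitting_ideal M I & divisorial_hull I = principal_ideal d.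

(* L_rho =. d. Finite generation of H_1 is part of is_order.                  *)
Definition is_L_function (G : groupType) (R : comNzRingType)
    (rho : sl2rep G R) (d : R) : Prop :=
  torsion_module (homology rho 1) /\ is_order (homology rho 1) d.

Definition eq_up_to_unit (R : unitRingType) (c d : R) : Prop :=
  exists2 u, u \is a GRing.unit & c = u * d.

Definition ideal_pow (R : comNzRingType) (I : set R) (k : nat) : set R :=
  [set r | exists (m : nat) (c : 'I_m -> R) (x : 'I_m -> 'I_k -> R),
     (forall i j, I (x i j)) /\ r = \sum_i c i * \prod_j x i j].

Definition adically_complete (R : comNzRingType) (I : set R) : Prop :=
  (forall r, (forall k, ideal_pow I k r) -> r = 0) /\
  (forall u : nat -> R, (forall k, ideal_pow I k (u k.+1 - u k)) ->
     exists l, forall k, ideal_pow I k (u k - l)).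

(* The kernel of res is the set of all non-units, so R is local, res is its   *)
(* reduction modulo the maximal ideal and F is its residue field.             *)
Definition is_complete_local (R : comUnitRingType) (F : fieldType)
    (res : {rmorphism R -> F}) : Prop :=
  [/\ forall x, exists r, res r = x,
      forall r, (r \is a GRing.unit) = (res r != 0)
    & adically_complete [set r | res r = 0]].

Definition is_discrete_valuation (O : idomainType) : Prop :=
  exists w : O, [/\ w != 0, w \isn't a GRing.unit
    & forall r, r != 0 ->
        exists (u : O) (k : nat), u \is a GRing.unit /\ r = u * w ^+ k].

Definition is_cdvr0 (O : idomainType) (F : fieldType)
    (res : {rmorphism O -> F}) : Prop :=
  [/\ [pchar O] =i pred0, is_discrete_valuation O & is_complete_local res].

Definition is_cdvr0_extension (O O' : idomainType) (F F' : fieldType)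
    (res : {rmorphism O -> F}) (res' : {rmorphism O' -> F'})
    (iota : {rmorphism O -> O'}) (kappa : {rmorphism F -> F'}) : Prop :=
  [/\ is_cdvr0 res', injective iota
    & forall c, res' (iota c) = kappa (res c)].

Section Deformations.
Variables (G : groupType) (O : comUnitRingType) (F : fieldType).
Variables (resO : {rmorphism O -> F}) (rhobar : sl2rep G F).

Definition is_complete_local_algebra (R : comUnitAlgType O)
    (res : {rmorphism R -> F}) : Prop :=
  is_complete_local res /\ forall c : O, res c%:A = resO c.

Definition is_deformation (R : comUnitAlgType O) (res : {rmorphism R -> F})
    (rho : sl2rep G R) : Prop :=
  forall g, map_rep res rho g = rhobar g.

Definition strictly_equivalent (R : comUnitAlgType O)
    (res : {rmorphism R -> F}) (rho1 rho2 : sl2rep G R) : Prop :=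
  (exists2 P : 'M[R]_2, P \in unitmx
     & forall g, rho2 g = P *m rho1 g *m invmx P) /\
  (forall g, map_rep res rho1 g = map_rep res rho2 g).

(* psi induces the deformation rho' from rho, in the category of complete     *)
(* local O-algebras with residue field F.                                     *)
Definition deformation_factors (R R' : comUnitAlgType O)
    (res : {rmorphism R -> F}) (res' : {rmorphism R' -> F})
    (rho : sl2rep G R) (rho' : sl2rep G R') (psi : {lrmorphism R -> R'}) : Prop :=
  (forall r, res' (psi r) = res r) /\
  strictly_equivalent res' (map_rep psi rho) rho'.

Definition is_universal_deformation (R : comUnitAlgType O)
    (res : {rmorphism R -> F}) (rho : sl2rep G R) : Prop :=
  [/\ is_complete_local_algebra res, is_deformation res rho
    & forall (R' : comUnitAlgType O) (res' : {rmorphism R' -> F})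
        (rho' : sl2rep G R'),
        is_complete_local_algebra res' -> is_deformation res' rho' ->
        exists psi : {lrmorphism R -> R'},
          deformation_factors res res' rho rho' psi /\
          forall psi' : {lrmorphism R -> R'},
            deformation_factors res res' rho rho' psi' -> psi' =1 psi].

End Deformations.

Section TwistDeformations.
Variables (n : int) (O : idomainType) (F : fieldType).
Variables (resO : {rmorphism O -> F}) (alpha : O).
Local Notation t := (series_var alpha).

Definition is_yf (y : series O) : Prop :=
  scoef0 y = alpha /\ int_eval2 (f_poly n) t y = 0.

Definition is_xf (x : series O) : Prop :=
  scoef0 x = alpha /\ int_eval2 (f_poly n) x t = 0.

Variable rhobar : sl2rep (twist_group n) F.
Local Notation universal :=
  (is_universal_deformation resO rhobar (resO \o @scoef0 O)).

(* The trace conditions single out one of the universal deformations over     *)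
(* O[[t - alpha]], which differ by the automorphisms of this O-algebra.       *)
Definition universal_in_x (rho : sl2rep (twist_group n) (series O)) : Prop :=
  [/\ universal rho, \tr (rho (twist_a n)) = t
    & is_yf (\tr (rho (twist_a n * twist_b n)%g))].

Definition universal_in_y (rho : sl2rep (twist_group n) (series O)) : Prop :=
  [/\ universal rho, \tr (rho (twist_a n * twist_b n)%g) = t
    & is_xf (\tr (rho (twist_a n)))].

End TwistDeformations.

Definition lifts_of_root (n : int) (O' : idomainType) (F F' : fieldType)
    (res' : {rmorphism O' -> F'}) (kappa : {rmorphism F -> F'}) (abar : F) :
    set O' :=
  [set b | int_eval (k_poly n) b = 0 /\ res' b = kappa abar].

(* alpha_1 = alpha, ..., alpha_m are iota alpha :: s, and the identity        *)
(* L_rho =. prod_i (t - alpha_i)^2 of elements of O[[t - alpha]] is checked   *)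
(* in O'[[t - alpha]].                                                        *)
Definition L_function_formulas (n : int) (p : nat) (F : finFieldType)
    (O : idomainType) (resO : {rmorphism O -> F}) (abar : F) (alpha : O)
    (rho : sl2rep (twist_group n) (series O)) : Prop :=
  let t := series_var alpha in
  let m := mup abar (map_poly intr (k_poly n)) in
  [/\ is_L_function rho (int_eval (k_poly n) t ^+ 2),
      ~~ (p%:Z %| 3 * n - 1)%Z ->
        m = 1%N /\ is_L_function rho ((t - alpha%:A) ^+ 2)
    & (p%:Z %| 3 * n - 1)%Z ->
        (exists (O' : idomainType) (F' : finFieldType)
            (resO' : {rmorphism O' -> F'}) (iota : {rmorphism O -> O'})
            (kappa : {rmorphism F -> F'}) (s : seq O'),
          let alphas := iota alpha :: s in
          let t' := series_var (iota alpha) in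
          [/\ is_cdvr0_extension resO resO' iota kappa,
              uniq alphas /\ size alphas = m,
              forall b, b \in alphas <-> lifts_of_root n resO' kappa abar b
            & exists2 d : series O, is_L_function rho d
                & series_map iota d = \prod_(b <- alphas) (t' - b%:A) ^+ 2]) /\
        (forall (O' : idomainType) (F' : finFieldType)
            (resO' : {rmorphism O' -> F'}) (iota : {rmorphism O -> O'})
            (kappa : {rmorphism F -> F'}) (s : seq O'),
          is_cdvr0_extension resO resO' iota kappa -> uniq s ->
          (forall b, b \in s -> lifts_of_root n resO' kappa abar b) ->
          (size s <= m)%N)].

(* Main.v *)
(* Let A, B be the images of a, b under an SL_2-representation, with
   x = tr A = tr B, y = tr(AB), and let W be the image of w. By Cayley-Hamilton
   A W^n - W^n B = f_n(x, y) (A - B); absolute irreducibility of the reduction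
   means that 1, A, B, AB is a basis of the 2x2 matrices, so that the traces
   (x, y) determine a deformation up to strict equivalence, and every pair
   (x, y) with f_n(x, y) = 0 lifting (abar, abar) is realised. The universal ring
   is thus the completed local ring of the curve f_n = 0, which Hensel's lemma
   identifies with O[[x - alpha]] or O[[y - alpha]].
   If A - 1 is invertible, H_1 is presented by the 2x2 matrix
   D = (A - 1) d(w^n)/db - W^n (Fox calculus), and on the curve f_n = 0 the
   determinant of D is a unit times (y - x)^2. Since f_n(x, x) = - k_n(x) l_n(x)
   with l_n a unit where k_n vanishes, y - x is a unit times k_n, hence
   L = k_n^2. At a root of k_n the derivative of k_n divides 2 (3n - 1), so the
   roots in characteristic zero are simple; the factorisation over an extension
   of O follows from Weierstrass preparation. The extension is the integral
   closure of O in a splitting field L; it is a valuation ring because z or 1/z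
   is integral for every z in L: if O[z] does not contain 1/w, then by
   completeness the powers of z reduce to finitely many of them. *)

From HB Require Import structures.
Require Import Defs.
From mathcomp Require Import all_boot all_order all_algebra.
From mathcomp Require Import perm polyXY fraction vector falgebra fieldext zify ring.
From mathcomp Require Import boolp classical_sets functions cardinality fsbigop.

Set Implicit Arguments.
Unset Strict Implicit.
Unset Printing Implicit Defensive.

Import Order.TTheory GRing.Theory Num.Theory.
Local Open Scope ring_scope.

(** * Chebyshev recurrences and the polynomials f_n and k_n *)

(** The number 3n - 1 and the splitting of f_n(x, x) have one source: on the diagonal z = c^3 - 3c
    with c = 1 - x, so for c = q + 1/q the recurrence in n runs in powers of q^3 and f_n(x, x) = -
    S_{3n-1}(c), which half-angle formulas factor. They also give x(x - 2) S_n(z) = 1 at a root of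
    k_n. Units come from this equation, from 2 being invertible, and from det(AB - BA) = 2 - z,
    which irreducibility keeps away from 0; they cancel the extra factors in the closed identity for
    det D. Two features of the statement shape the proof. Universality is tested on arbitrary
    complete local O-algebras, perhaps with zero divisors and not Noetherian, so deformations are
    compared by explicit matrices, unit entries and powers of ideals. H_1 is defined by the bar
    complex, so its presentation is established by hand: the Fox derivative, well defined modulo the
    rows of D, detects boundaries. Orders are defined through some presentation, so Fitting ideals
    must be shown independent of it. *)

Lemma int_ind2 (P : int -> Prop) :
  P 0 -> P 1 -> (forall m, P m -> P (m + 1) -> P (m + 2)) ->
  (forall m, P (m + 1) -> P (m + 2) -> P m) -> forall m, P m.
Proof.
move=> P0 P1 Pup Pdn.
have pos (j : nat) : P j%:Z /\ P (j%:Z + 1).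
  elim: j => [|j [IH1 IH2]]; first by split.
  have -> : j.+1%:Z = j%:Z + 1 by lia.
  split=> //; have -> : j%:Z + 1 + 1 = j%:Z + 2 by lia.
  exact: Pup.
have neg (j : nat) : P (- j%:Z) /\ P (- j%:Z + 1).
  elim: j => [|j [IH1 IH2]]; first by split.
  have e1 : - j.+1%:Z + 1 = - j%:Z by lia.
  rewrite e1; split=> //; apply: Pdn; rewrite ?e1 //.
  by have -> : - j.+1%:Z + 2 = - j%:Z + 1 by lia.
case=> j; first exact: (pos j).1.
by rewrite NegzE; exact: (neg j.+1).1.
Qed.

Section Chebyshev.
Variables (R : comNzRingType) (c : R).

Definition cheb (m : int) : R := two_sided (fun=> c) 0 1 m.

Lemma chebS (m : int) : cheb (m + 2) = c * cheb (m + 1) - cheb m.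
Proof.
have := two_sidedP (fun=> c) 0 1 (m + 1).
have -> : m + 1 + 1 = m + 2 by lia.
rewrite addrK -/(cheb _) -/(cheb _) -/(cheb m) => H.
by rewrite -[LHS]subr0 -[in LHS]H; ring.
Qed.

Lemma cheb0 : cheb 0 = 0. Proof. by []. Qed.
Lemma cheb1 : cheb 1 = 1. Proof. by []. Qed.

Lemma chebP (m : int) : cheb m = c * cheb (m + 1) - cheb (m + 2).
Proof. by rewrite chebS; ring. Qed.

Lemma chebB1 (m : int) : cheb (m - 1) = c * cheb m - cheb (m + 1).
Proof.
rewrite chebP; have -> : m - 1 + 1 = m by lia.
by have -> : m - 1 + 2 = m + 1 by lia.
Qed.

(** Closed formulas for Chebyshev values are proved below by recognising both sides as solutions of
    one recurrence with equal values at 0 and 1. *)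
Lemma recurrence_unique (u v : int -> R) :
  (forall m, u (m + 2) = c * u (m + 1) - u m) ->
  (forall m, v (m + 2) = c * v (m + 1) - v m) ->
  u 0 = v 0 -> u 1 = v 1 -> u =1 v.
Proof.
move=> uP vP uv0 uv1; apply: int_ind2 => // m.
  by rewrite uP vP => -> ->.
move=> e1 e2; have := vP m; have := uP m; rewrite e1 e2 => -> /eqP.
by rewrite (can_eq (addKr _)) eqr_opp => /eqP.
Qed.

(** The left side is the norm form of t^2 - ct + 1 at consecutive values, which a step of the
    recurrence, in either direction, leaves invariant. *)
Lemma cheb_norm (m : int) :
  cheb (m + 1) ^+ 2 - c * cheb (m + 1) * cheb m + cheb m ^+ 2 = 1.
Proof.
elim/int_ind2: m => [||m|m]; rewrite ?add0r ?cheb0 ?cheb1; first by ring.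
- by rewrite [cheb (1 + 1)](chebS 0) add0r cheb1 cheb0; ring.
- move=> _ <-.
  have -> : m + 2 + 1 = m + 1 + 2 by lia.
  rewrite [cheb (m + 1 + 2)]chebS; have -> : m + 1 + 1 = m + 2 by lia.
  by ring.
- move=> <- _; rewrite [cheb m]chebP.
  have -> : m + 1 + 1 = m + 2 by lia.
  by ring.
Qed.

Lemma cheb_add (a b : int) : cheb (a + b) = cheb a * cheb (b + 1) - cheb (a - 1) * cheb b.
Proof.
move: b; apply: recurrence_unique => [b|b||].
- have -> : a + (b + 2) = a + b + 2 by lia.
  by rewrite chebS; have -> : a + b + 1 = a + (b + 1) by lia.
- have -> : b + 2 + 1 = b + 1 + 2 by lia.
  rewrite !chebS; have -> : b + 1 + 1 = b + 2 by lia.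
  by rewrite chebS; ring.
- by rewrite addr0 add0r cheb0 cheb1; ring.
- rewrite [cheb (1 + 1)](chebS 0) add0r cheb1 cheb0 chebB1. ring.
Qed.

End Chebyshev.

(** With c = q + 1/q the value S_m(c) is (q^m - q^(-m))/(q - 1/q); then c^3 - 3c = q^3 + q^(-3) and
    c^2 - 1 = (q^3 - q^(-3))/(q - 1/q). *)
Lemma cheb_mul3 (R : comNzRingType) (c : R) (n : int) :
  (c ^+ 2 - 1) * cheb (c ^+ 3 - 3%:R * c) n = cheb c (3 * n).
Proof.
move: n; apply: (recurrence_unique (c := c ^+ 3 - 3%:R * c)) => [m|m||].
- by rewrite chebS; ring.
- have e (i : int) : cheb c (3 * m + (i + 2)) = c * cheb c (3 * m + (i + 1)) - cheb c (3 * m + i).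
    have -> : 3 * m + (i + 2) = 3 * m + i + 2 by lia.
    by rewrite chebS; have -> : 3 * m + i + 1 = 3 * m + (i + 1) by lia.
  have -> : 3 * (m + 2) = 3 * m + (4 + 2) by lia.
  have -> : 3 * (m + 1) = 3 * m + (1 + 2) by lia.
  rewrite (e 4) (e 3) (e 2) (e 1) (e 0) (addr0 (3 * m)).
  by ring.
- by rewrite cheb0 mulr0.
- have e3 : cheb c 3 = c * cheb c 2 - cheb c 1 := chebS c 1.
  have e2 : cheb c 2 = c * cheb c 1 - cheb c 0 := chebS c 0.
  have -> : 3 * 1 = 3 :> int by [].
  by rewrite e3 e2 !cheb1 cheb0; ring.
Qed.

Lemma rmorph_two_sided (R S : comNzRingType) (phi : {rmorphism R -> S}) e u0 u1 m :
  phi (two_sided e u0 u1 m) = two_sided (phi \o e) (phi u0) (phi u1) m.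
Proof.
have tt u v j : three_term (phi \o e) (phi u) (phi v) j =
    (phi (three_term e u v j).1, phi (three_term e u v j).2).
  elim: j => [//|j IH] /=; rewrite IH /=.
  by case: (three_term e u v j) => a b /=; rewrite rmorphB rmorphM.
case: m => j; first by rewrite /two_sided tt.
by rewrite /two_sided [(phi \o e) 0%N]/= -rmorphM -rmorphB tt.
Qed.

Lemma eq_two_sided (R : comNzRingType) (e e' : nat -> R) u0 u1 :
  e =1 e' -> two_sided e u0 u1 =1 two_sided e' u0 u1.
Proof. by move=> /funext ->. Qed.

Lemma rmorph_cheb (R S : comNzRingType) (phi : {rmorphism R -> S}) c m :
  phi (cheb c m) = cheb (phi c) m.
Proof. by rewrite /cheb rmorph_two_sided rmorph0 rmorph1. Qed.

Section Evaluation.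
Variable R : comNzRingType.

Definition int_morph (x : R) : {poly int} -> R :=
  horner_eval x \o map_poly intr.
HB.instance Definition _ x := GRing.RMorphism.on (int_morph x).

Lemma int_evalE q (x : R) : int_eval q x = int_morph x q.
Proof. by []. Qed.

Definition int_morph2 (x y : R) : {poly {poly int}} -> R :=
  horner_eval y \o (horner_eval x%:P \o map_poly (map_poly intr)).
HB.instance Definition _ x y := GRing.RMorphism.on (int_morph2 x y).

Lemma int_eval2E q (x y : R) : int_eval2 q x y = int_morph2 x y q.
Proof. by []. Qed.

Lemma int_morphX x : (int_morph x : {rmorphism {poly int} -> R}) 'X = x.
Proof. by rewrite /= /int_morph /= /horner_eval map_polyX hornerX. Qed.

Lemma int_morph2X x y :
  (int_morph2 x y : {rmorphism {poly {poly int}} -> R}) 'X = x.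
Proof.
by rewrite /= /int_morph2 /= /horner_eval map_polyX hornerX hornerC.
Qed.

Lemma int_morph2Y x y :
  (int_morph2 x y : {rmorphism {poly {poly int}} -> R}) 'Y = y.
Proof.
by rewrite /= /int_morph2 /= /horner_eval map_polyC /= hornerC map_polyX hornerX.
Qed.

Lemma int_eval_S m (x : R) : int_eval (S_poly m) x = cheb x m.
Proof.
rewrite int_evalE /S_poly rmorph_two_sided rmorph0 rmorph1.
by apply: eq_two_sided => j; rewrite [LHS]/comp int_morphX.
Qed.

Definition zed (x y : R) : R := 2%:R * x ^+ 2 - x ^+ 2 * y + y ^+ 2 - 2%:R.

Definition fval n (x y : R) : R :=
  (y - 1) * cheb (zed x y) n - cheb (zed x y) (n - 1).

Definition kval n (x : R) : R :=
  two_sided (fun j => if odd j then x ^+ 2 - 3%:R * x else - x) (-1) 1 n.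

Lemma int_eval_k n (x : R) : int_eval (k_poly n) x = kval n x.
Proof.
rewrite int_evalE /k_poly rmorph_two_sided rmorphN rmorph1.
apply: eq_two_sided => j; rewrite [LHS]/comp; case: odd.
  rewrite rmorphB rmorphXn int_morphX -mul_polyC rmorphM int_morphX.
  by rewrite polyC_natr rmorph_nat.
by rewrite rmorphN int_morphX.
Qed.

End Evaluation.

Lemma int_eval2_f n (R : comNzRingType) (x y : R) :
  int_eval2 (f_poly n) x y = fval n x y.
Proof.
rewrite int_eval2E /f_poly /fval !int_eval_S.
rewrite rmorphB rmorphM rmorphB rmorph1 int_morph2Y !rmorph_cheb.
rewrite !(rmorphB, rmorphD, rmorphM, rmorphXn, rmorph_nat).
by rewrite int_morph2X int_morph2Y rmorph1.
Qed.

Lemma rmorph_fval n (R S : comNzRingType) (phi : {rmorphism R -> S}) x y :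
  phi (fval n x y) = fval n (phi x) (phi y).
Proof.
rewrite /fval rmorphB rmorphM rmorphB rmorph1 !rmorph_cheb /zed.
by rewrite !(rmorphB, rmorphD, rmorphM, rmorphXn, rmorph1).
Qed.

Lemma rmorph_kval n (R S : comNzRingType) (phi : {rmorphism R -> S}) x :
  phi (kval n x) = kval n (phi x).
Proof.
rewrite /kval rmorph_two_sided rmorphN rmorph1; apply: eq_two_sided => j.
rewrite [LHS]/comp; case: odd; last by rewrite rmorphN.
by rewrite rmorphB rmorphXn rmorphM rmorph_nat.
Qed.

(** * Restriction to the diagonal y = x *)

Section Diagonal.
Variables (R : comNzRingType) (x : R).
Local Notation c := (1 - x).
Local Notation s := (cheb (1 - x)).

(** Two steps of the recurrence for k amount to three Chebyshev steps at c = 1 - x: the product of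
    the two coefficients minus 2 is -x (x^2 - 3x) - 2 = c^3 - 3c. *)
Lemma kvalE (j : int) :
  kval (2 * j) x = s (3 * j) + s (3 * j - 1) /\ kval (2 * j + 1) x = s (3 * j + 1).
Proof.
pose e i := if odd i then x ^+ 2 - 3%:R * x else - x.
have kP (m : int) : kval m x = e `|(m - 1)%R|%N * kval (m - 1) x - kval (m - 2) x.
  have := two_sidedP e (-1) 1 (m - 1).
  rewrite subrK; have -> : m - 1 - 1 = m - 2 by lia.
  by move=> H; rewrite -[LHS]subr0 -[in LHS]H /kval; ring.
have kev (i : int) : kval (2 * i) x =
    (x ^+ 2 - 3%:R * x) * kval (2 * i - 1) x - kval (2 * i - 2) x.
  by rewrite kP /e; have -> : odd `|(2 * i - 1)%R|%N by lia.
have kod (i : int) : kval (2 * i + 1) x = - x * kval (2 * i) x - kval (2 * i - 1) x.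
  rewrite kP /e addrK; have -> : odd `|(2 * i)%R|%N = false by lia.
  by have -> : 2 * i + 1 - 2 = 2 * i - 1 by lia.
have sP (m : int) : s m = c * s (m - 1) - s (m - 2).
  have := chebS c (m - 2); rewrite subrK => ->.
  by have -> : m - 2 + 1 = m - 1 by lia.
have pos (i : nat) : kval (2 * i%:Z) x = s (3 * i%:Z) + s (3 * i%:Z - 1) /\
    kval (2 * i%:Z + 1) x = s (3 * i%:Z + 1).
  elim: i => [|i [IH1 IH2]].
    split=> //; change (-1 = 0 + s (0 - 1)).
    by rewrite chebB1 cheb0 cheb1; ring.
  have e1 : kval (2 * i.+1%:Z) x = s (3 * i.+1%:Z) + s (3 * i.+1%:Z - 1).
    rewrite kev; have -> : 2 * i.+1%:Z - 1 = 2 * i%:Z + 1 by lia.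
    have -> : 2 * i.+1%:Z - 2 = 2 * i%:Z by lia.
    rewrite IH1 IH2.
    have -> : 3 * i.+1%:Z = 3 * i%:Z + 1 + 2 by lia.
    have -> : 3 * i%:Z + 1 + 2 - 1 = 3 * i%:Z + 2 by lia.
    rewrite chebS; have -> : 3 * i%:Z + 1 + 1 = 3 * i%:Z + 2 by lia.
    by rewrite chebS chebB1; ring.
  split=> //; rewrite kod e1.
  have -> : 2 * i.+1%:Z - 1 = 2 * i%:Z + 1 by lia.
  rewrite IH2 [RHS]sP addrK; have -> : 3 * i.+1%:Z + 1 - 2 = 3 * i.+1%:Z - 1 by lia.
  have -> : 3 * i%:Z + 1 = 3 * i.+1%:Z - 2 by lia.
  by rewrite [s (3 * i.+1%:Z)]sP; ring.
have neg (i : nat) : kval (2 * - i%:Z) x = s (3 * - i%:Z) + s (3 * - i%:Z - 1) /\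
    kval (2 * - i%:Z + 1) x = s (3 * - i%:Z + 1).
  elim: i => [|i [IH1 IH2]]; first exact: pos 0%N.
  set a := - i.+1%:Z.
  have ae : - i%:Z = a + 1 by rewrite /a; lia.
  rewrite ae in IH1 IH2.
  have o1 : kval (2 * a + 1) x = s (3 * a + 1).
    have := kod (a + 1); rewrite IH1 IH2.
    have -> : 2 * (a + 1) - 1 = 2 * a + 1 by lia.
    have -> : 3 * (a + 1) + 1 = 3 * a + 2 + 2 by lia.
    have -> : 3 * (a + 1) = 3 * a + 1 + 2 by lia.
    have -> : 3 * a + 1 + 2 - 1 = 3 * a + 2 by lia.
    rewrite chebS; have -> : 3 * a + 2 + 1 = 3 * a + 1 + 2 by lia.
    rewrite chebS; have -> : 3 * a + 1 + 1 = 3 * a + 2 by lia.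
    (* The recurrence is solved for its lowest term: [H] enters through an added zero, after which
       [ring] cancels. *)
    move=> H; rewrite -[LHS]addr0 -[in LHS](subrr ((c) * (c * s (3 * a + 2) - s (3 * a + 1)) - s (3 * a + 2))).
    by rewrite {1}H; ring.
  split=> //; have := kev (a + 1); rewrite IH1.
  have -> : 2 * (a + 1) - 1 = 2 * a + 1 by lia.
  have -> : 2 * (a + 1) - 2 = 2 * a by lia.
  rewrite o1.
  have -> : 3 * (a + 1) = 3 * a + 1 + 2 by lia.
  have -> : 3 * a + 1 + 2 - 1 = 3 * a + 2 by lia.
  rewrite chebS; have -> : 3 * a + 1 + 1 = 3 * a + 2 by lia.
  rewrite chebS chebB1; set u := s _; set v := s _ => H.
  rewrite -[LHS]addr0 -[in LHS](subrr (c * (c * u - v) - u + (c * u - v))).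
  by rewrite {1}H; ring.
by case: j => i; [exact: pos | rewrite NegzE; exact: neg].
Qed.

(* The complementary factor of f_n(x, x) = - k_n(x) l_n(x). *)
Definition lval (n : int) : R :=
  if odd `|n|%N then s (3 * (n %/ 2)%Z + 2) - s (3 * (n %/ 2)%Z)
  else s (3 * (n %/ 2)%Z) - s (3 * (n %/ 2)%Z - 1).

Lemma int_parity (n : int) :
  (odd `|n|%N = false /\ n = 2 * (n %/ 2)%Z) \/
  (odd `|n|%N = true /\ n = 2 * (n %/ 2)%Z + 1).
Proof.
have := modz_ge0 n (isT : (2 : int) != 0).
have := ltz_pmod n (isT : 0 < (2 : int)).
move: (n %/ 2)%Z (n %% 2)%Z (divz_eq n 2) => q r nE r2 r0.
by case E: (odd `|n|%N); [right | left]; split=> //; lia.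
Qed.

(** At y = x the parameter z is c^3 - 3c with c = 1 - x, so both sides solve the recurrence in n
    with this parameter. *)
Lemma fval_diag n : fval n x x = - s (3 * n - 1).
Proof.
move: n; apply: (recurrence_unique (c := zed x x)) => [m|m||].
- rewrite /fval chebS; have -> : m + 2 - 1 = m - 1 + 2 by lia.
  rewrite chebS; have -> : m - 1 + 1 = m by lia.
  have -> : m + 1 - 1 = m by lia.
  ring.
- have e (i : int) : s (3 * m + (i + 2)) = c * s (3 * m + (i + 1)) - s (3 * m + i).
    have -> : 3 * m + (i + 2) = 3 * m + i + 2 by lia.
    by rewrite chebS; have -> : 3 * m + i + 1 = 3 * m + (i + 1) by lia.
  have -> : 3 * (m + 2) - 1 = 3 * m + (3 + 2) by lia.
  have -> : 3 * (m + 1) - 1 = 3 * m + (0 + 2) by lia.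
  rewrite (e 3) (e 2) (e 1) (e 0) (addr0 (3 * m)) chebB1.
  have -> : 3 * m + (0 + 1) = 3 * m + 1 by lia.
  by rewrite /zed; ring.
- by rewrite /fval !chebB1 !cheb0 !add0r !cheb1; ring.
- have e2 : s 2 = c * s 1 - s 0 := chebS c 0.
  have -> : 3 * 1 - 1 = 2 :> int by [].
  by rewrite /fval e2 !cheb1 !cheb0; ring.
Qed.

(** Half-angle splitting: S_{2a-1} = (S_a + S_{a-1})(S_a - S_{a-1}) and S_{2a} = S_a (S_{a+1} -
    S_{a-1}), with a = 3j for n = 2j and a = 3j + 1 for n = 2j + 1. *)
Lemma fval_diag_factor n : fval n x x = - (kval n x * lval n).
Proof.
rewrite fval_diag; congr (- _); rewrite /lval.
case: (int_parity n) => -[-> nE]; rewrite {1 2}nE; set j := (n %/ 2)%Z.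
  rewrite (kvalE j).1; have -> : 3 * (2 * j) - 1 = 3 * j + (3 * j - 1) by lia.
  by rewrite cheb_add subrK; ring.
rewrite (kvalE j).2.
have -> : 3 * (2 * j + 1) - 1 = 3 * j + 1 + (3 * j + 1) by lia.
rewrite cheb_add; have -> : 3 * j + 1 + 1 = 3 * j + 2 by lia.
by rewrite addrK; ring.
Qed.

(** As x(x - 2) = c^2 - 1, the left side is S_{3n}(c). Since S_{3n-1}(c) = 0, its square is 1 by the
    norm identity; that k_n is the vanishing factor selects the sign, which would be -1 at a root of
    l_n. *)
Lemma kval_root_S n : kval n x = 0 -> x * (x - 2%:R) * cheb (zed x x) n = 1.
Proof.
have zE : zed x x = c ^+ 3 - 3%:R * c by rewrite /zed; ring.
have -> : x * (x - 2%:R) = c ^+ 2 - 1 by ring.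
rewrite zE cheb_mul3.
case: (int_parity n) => -[_ nE]; rewrite nE; set j := (n %/ 2)%Z.
  rewrite (kvalE j).1 => /eqP; rewrite addr_eq0 => /eqP k0.
  have -> : 3 * (2 * j) = 3 * j + (3 * j) by lia.
  have := cheb_norm c (3 * j - 1); rewrite subrK => H; rewrite -[RHS]H.
  rewrite cheb_add; have -> : s (3 * j + 1) = c * s (3 * j) - s (3 * j - 1).
    by rewrite chebB1; ring.
  by rewrite k0; ring.
rewrite (kvalE j).2 => k0.
have -> : 3 * (2 * j + 1) = 3 * j + 1 + (3 * j + 1 + 1) by lia.
have := cheb_norm c (3 * j); rewrite k0 => H; rewrite -[RHS]H.
rewrite cheb_add k0 addrK.
have -> : 3 * j + 1 + 1 = 3 * j + 2 by lia.
by rewrite chebS k0; ring.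
Qed.

(** With k_n = 0 the norm identity makes a multiple of one square equal to 1, while l_n becomes
    twice the base of that square up to sign. So l_n is invertible wherever 2 is. *)
Lemma kval_lval_coprime n : kval n x = 0 -> exists u, u * lval n = 4%:R.
Proof.
rewrite /lval; case: (int_parity n) => -[-> nE]; rewrite {1}nE; set j := (n %/ 2)%Z.
  rewrite (kvalE j).1 => /eqP; rewrite addr_eq0 => /eqP k0.
  have := cheb_norm c (3 * j - 1); rewrite subrK k0 => H.
  exists (- 2%:R * s (3 * j - 1) * (2%:R + c)).
  rewrite -[RHS]mulr1 -[X in _ = _ * X]H; ring.
rewrite (kvalE j).2 => k0.
have := cheb_norm c (3 * j); rewrite k0 => H.
rewrite chebS k0; exists (- 2%:R * s (3 * j)).
by rewrite -[RHS]mulr1 -[X in _ = _ * X]H; ring.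
Qed.

End Diagonal.

Lemma chebN (R : comNzRingType) (c : R) (m : int) : cheb c (- m) = - cheb c m.
Proof.
suff H : (fun m => cheb c (- m)) =1 (fun m => - cheb c m) by exact: H.
apply: (recurrence_unique (c := c)) => [i|i||]; rewrite ?oppr0 ?cheb0 ?oppr0 //.
- rewrite [cheb c (- (i + 2))]chebP.
  have -> : - (i + 2) + 1 = - (i + 1) by lia.
  by have -> : - (i + 2) + 2 = - i by lia.
- by rewrite chebS; ring.
- by rewrite -[- (1 : int)]add0r chebB1 cheb0 add0r cheb1 mulr0 add0r.
Qed.

Definition kpol (R : comNzRingType) (n : int) : {poly R} := kval n 'X.

Lemma map_k_poly (R : comNzRingType) n : map_poly intr (k_poly n) = kpol R n.
Proof.
rewrite /k_poly rmorph_two_sided rmorphN rmorph1; apply: eq_two_sided => j.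
rewrite [LHS]/comp; case: odd; last by rewrite rmorphN /= map_polyX.
rewrite rmorphB rmorphXn -mul_polyC rmorphM /= map_polyX map_polyC /=.
by rewrite polyC_natr.
Qed.

Lemma map_kpol (R S : comNzRingType) (phi : {rmorphism R -> S}) n :
  map_poly phi (kpol R n) = kpol S n.
Proof. by rewrite /kpol rmorph_kval /= map_polyX. Qed.

Lemma horner_kpol (R : comNzRingType) n (x : R) : (kpol R n).[x] = kval n x.
Proof. by rewrite -map_k_poly -int_eval_k. Qed.

(** * Derivative and leading coefficient of k_n *)

Section SimpleRoots.
Variable R : comNzRingType.
Local Notation C := (1 - 'X : {poly R}).

(** As functions of c: (c^2 - 4) S_m' = m (2 S_{m+1} - c S_m) - c S_m, where the bracket is q^m +
    q^(-m) for c = q + 1/q. The sign comes from C' = -1. *)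
Lemma cheb_deriv (m : int) :
  (C ^+ 2 - 4%:R) * (cheb C m)^`() =
  - (m%:~R * (2%:R * cheb C (m + 1) - C * cheb C m) - C * cheb C m).
Proof.
have dC : C^`() = -1 by rewrite derivB derivX -polyC1 derivC sub0r.
elim/int_ind2: m => [||m IH0 IH1|m IH1 IH0].
- by rewrite !cheb0 mulr0 deriv0; ring.
- rewrite [cheb C (1 + 1)](chebS C 0) !add0r !cheb1 cheb0.
  by rewrite -polyC1 derivC polyC1; ring.
- have -> : m + 2 + 1 = m + 1 + 2 by lia.
  rewrite [cheb C (m + 1 + 2)]chebS.
  have e : m + 1 + 1 = m + 2 by lia.
  rewrite e; rewrite e in IH1.
  have dE : (cheb C (m + 2))^`() =
      - cheb C (m + 1) + C * (cheb C (m + 1))^`() - (cheb C m)^`().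
    by rewrite chebS derivB derivM dC mulN1r.
  rewrite dE chebS.
  transitivity (- (C ^+ 2 - 4%:R) * cheb C (m + 1)
     + C * ((C ^+ 2 - 4%:R) * (cheb C (m + 1))^`())
     - (C ^+ 2 - 4%:R) * (cheb C m)^`()); first by ring.
  by rewrite IH0 IH1 chebS; ring.
- have e : m + 1 + 1 = m + 2 by lia.
  have e' : m + 2 + 1 = m + 1 + 2 by lia.
  rewrite e in IH1; rewrite e' [cheb C (m + 1 + 2)]chebS e in IH0.
  have dE : (cheb C m)^`() =
      - cheb C (m + 1) + C * (cheb C (m + 1))^`() - (cheb C (m + 2))^`().
    by rewrite chebP derivB derivM dC mulN1r.
  rewrite dE.
  transitivity (- (C ^+ 2 - 4%:R) * cheb C (m + 1)
     + C * ((C ^+ 2 - 4%:R) * (cheb C (m + 1))^`())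
     - (C ^+ 2 - 4%:R) * (cheb C (m + 2))^`()); first by ring.
  by rewrite IH0 IH1 [cheb C m]chebP; ring.
Qed.

(** Differentiate S_N(1 - X) = k_n l_n at a root of k_n: only k_n' l_n survives, [cheb_deriv] leaves
    the term - 2 N S_{N+1}, and S_{N+1}^2 = 1 because S_N = 0. *)
Lemma kval_deriv_root n (x : R) : kval n x = 0 ->
  exists u, u * (kpol R n)^`().[x] = 2%:R * (3 * n - 1)%:~R.
Proof.
move=> k0; set N := 3 * n - 1.
have SE : cheb C N = kpol R n * lval 'X n.
  by have := fval_diag_factor ('X : {poly R}) n; rewrite fval_diag => /oppr_inj.
have ev m : (cheb C m).[x] = cheb (1 - x) m.
  have := rmorph_cheb (horner_eval x : {rmorphism {poly R} -> R}) C m.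
  by rewrite /= /horner_eval !hornerE.
have S0 : cheb (1 - x) N = 0 by rewrite -ev SE hornerM horner_kpol k0 mul0r.
have := congr1 (horner^~ x) (cheb_deriv N).
rewrite -[4%:R](polyC_natr R 4) -[2%:R](polyC_natr R 2) {1}SE derivM !hornerE horner_kpol k0 mul0r addr0 !ev S0 => H.
have := cheb_norm (1 - x) N; rewrite S0 mulr0 subr0 expr0n addr0 => H1.
have Nx : ((N%:~R : {poly R}).[x]) = N%:~R.
  by rewrite -(rmorph_int (@polyC R)) hornerC.
exists (- ((1 - x) ^+ 2 - 4%:R) * (lval 'X n).[x] * cheb (1 - x) (N + 1)).
transitivity (2%:R * N%:~R * cheb (1 - x) (N + 1) ^+ 2); last by rewrite H1 mulr1.
transitivity (- cheb (1 - x) (N + 1) * (((1 - x) ^+ 2 - 4%:R) * ((kpol R n)^`().[x] * (lval 'X n).[x]))); first by ring.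

by rewrite H Nx; ring.
Qed.

Lemma lead_cheb (j : nat) :
  size (cheb C j.+1%:Z) = j.+1 /\ lead_coef (cheb C j.+1%:Z) = (-1) ^+ j.
Proof.
have sC : size C = 2%N by rewrite -opprB size_polyN size_XsubC.
have lC : lead_coef C = -1 by rewrite -opprB lead_coefN lead_coefXsubC.
elim/ltn_ind: j => -[|[|j]] IH.
- by rewrite cheb1 size_poly1 lead_coef1.
- have -> : cheb C 2 = C * cheb C 1 - cheb C 0 := chebS C 0.
  by rewrite cheb1 cheb0 mulr1 subr0 sC lC.
have [s0 l0] := IH j (ltnW (ltnSn _)); have [s1 l1] := IH j.+1 (ltnSn _).
have -> : j.+3%:Z = j.+1%:Z + 2 by lia.
rewrite chebS; have -> : j.+1%:Z + 1 = j.+2%:Z by lia.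
have lm : lead_coef C * lead_coef (cheb C j.+2) = (-1) ^+ j.+2.
  by rewrite lC l1 -exprS.
have nz : lead_coef C * lead_coef (cheb C j.+2) != 0 by rewrite lm signr_eq0.
have sz : size (C * cheb C j.+2) = j.+3 by rewrite size_proper_mul // sC s1.
have lt : (size (- cheb C j.+1)%R < size (C * cheb C j.+2)%R)%N.
  by rewrite size_polyN s0 sz ltnS leqnSn.
by rewrite size_polyDl // lead_coefDl // sz lead_coef_proper_mul.
Qed.

(** Being a sign over every ring, the leading coefficient keeps k_n nonzero over a residue field and
    makes it monic up to sign over O, as needed for adjoining its roots integrally. *)
Lemma lead_kpol n : exists e, lead_coef (kpol R n) = (-1) ^+ e.
Proof.
have sumE (j : nat) : exists e, lead_coef (cheb C j.+1%:Z + cheb C j%:Z) = (-1) ^+ e.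
  have [s1 l1] := lead_cheb j; exists j; rewrite lead_coefDl //.
  case: j s1 {l1} => [|j] ->; first by rewrite cheb0 size_poly0.
  by rewrite (lead_cheb j).1.
rewrite /kpol; case: (int_parity n) => -[_ ->]; move: (n %/ 2)%Z => j.
  rewrite (kvalE _ j).1.
  case: j => [[|j]|j].
  - rewrite -[3 * 0]/(0 : int) sub0r chebN cheb1 cheb0 add0r.
    by exists 1%N; rewrite lead_coefN lead_coef1.
  - have -> : 3 * j.+1%:Z = (3 * j + 2)%N.+1%:Z by lia.
    have -> : (3 * j + 2)%N.+1%:Z - 1 = (3 * j + 2)%N%:Z by lia.
    exact: sumE.
  - have -> : 3 * Negz j = - (3 * j + 3)%N%:Z by lia.
    have -> : - (3 * j + 3)%N%:Z - 1 = - (3 * j + 3)%N.+1%:Z by lia.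
    rewrite !chebN -opprD addrC lead_coefN.
    by have [e ->] := sumE (3 * j + 3)%N; exists e.+1; rewrite exprS mulN1r.
rewrite (kvalE _ j).2; case: j => j.
  have -> : 3 * Posz j + 1 = (3 * j)%N.+1%:Z by lia.
  by exists (3 * j)%N; rewrite (lead_cheb _).2.
have -> : 3 * Negz j + 1 = - (3 * j + 1)%N.+1%:Z by lia.
by rewrite chebN lead_coefN (lead_cheb _).2; exists (3 * j + 1)%N.+1; rewrite exprS mulN1r.
Qed.

End SimpleRoots.

Section Partials.
Variable R : comNzRingType.

(** The slices f_n(x, -) and f_n(-, y) as one-variable polynomials, to which Hensel's lemma
    applies. *)
Definition fpolY n (x : R) : {poly R} :=
  (map_poly (map_poly intr) (f_poly n)).[x%:P].
Definition fpolX n (y : R) : {poly R} :=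
  map_poly (horner_eval y) (map_poly (map_poly intr) (f_poly n)).

Lemma horner_fpolY n x y : (fpolY n x).[y] = fval n x y.
Proof. by rewrite -int_eval2_f. Qed.

Lemma horner_mapC (u : {poly {poly R}}) (x y : R) :
  (map_poly (horner_eval y) u).[x] = u.[x, y].
Proof.
rewrite -[RHS]/(horner_eval y u.[x%:P]) -horner_map /=.
by rewrite /horner_eval hornerC.
Qed.

Lemma horner_fpolX n x y : (fpolX n y).[x] = fval n x y.
Proof. by rewrite -int_eval2_f /int_eval2 -horner_mapC. Qed.

Lemma deriv_fpolY n (x y : R) :
  (fpolY n x)^`().[y] = int_eval2 (dy_poly (f_poly n)) x y.
Proof.
(* The outer variable carries x, so the y-derivative acts on coefficients and commutes with
   substituting a constant for that variable. *)
have dh (u : {poly {poly R}}) : (u.[x%:P])^`() = (map_poly (@deriv R) u).[x%:P].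
  elim/poly_ind: u => [|u c IH]; first by rewrite map_polyC /= deriv0 !horner0 deriv0.
  rewrite !raddfD /= map_polyC /= !hornerE derivD derivM derivC mulr0 addr0 IH.
  congr (_ + _); suff -> : map_poly (@deriv R) (u * 'X) = map_poly (@deriv R) u * 'X.
    by rewrite hornerMX.
  by apply/polyP => i; rewrite coef_map !coefMX coef_map /=; case: eqP; rewrite ?deriv0.
rewrite /fpolY dh /int_eval2 /dy_poly -!map_poly_comp; congr (_.[_, _]).
by apply: eq_map_poly => p /=; rewrite deriv_map.
Qed.

Lemma deriv_fpolX n (x y : R) :
  (fpolX n y)^`().[x] = int_eval2 (dx_poly (f_poly n)) x y.
Proof. by rewrite /fpolX !deriv_map horner_mapC. Qed.

End Partials.

Lemma map_fpolY n (R S : comNzRingType) (phi : {rmorphism R -> S}) x :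
  map_poly phi (fpolY n x) = fpolY n (phi x).
Proof.
rewrite /fpolY -horner_map /= map_polyC /= -map_poly_comp; congr (_.[_]).
apply: eq_map_poly => p /=; rewrite -map_poly_comp; apply: eq_map_poly => i /=.
exact: rmorph_int.
Qed.

Lemma map_fpolX n (R S : comNzRingType) (phi : {rmorphism R -> S}) y :
  map_poly phi (fpolX n y) = fpolX n (phi y).
Proof.
rewrite /fpolX -!map_poly_comp; apply: eq_map_poly => p /=.
rewrite /horner_eval -horner_map -map_poly_comp; congr (_.[_]).
by apply: eq_map_poly => i /=; exact: rmorph_int.
Qed.

Lemma rmorph_int_eval2 (R S : comNzRingType) (phi : {rmorphism R -> S}) q x y :
  phi (int_eval2 q x y) = int_eval2 q (phi x) (phi y).
Proof.
rewrite /int_eval2 -horner_map -horner_map /= map_polyC -map_poly_comp.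
congr (_.[_].[_]); apply: eq_map_poly => p /=.
by rewrite -map_poly_comp; apply: eq_map_poly => i /=; exact: rmorph_int.
Qed.

(** * Hensel's lemma *)

Section IdealPowers.
Variables (R : comNzRingType) (I : set R).
Local Notation "I ^[ k ]" := (ideal_pow I k) (at level 2, format "I ^[ k ]").

Lemma ideal_pow0 r : I^[0] r.
Proof.
exists 1%N, (fun=> r), (fun _ _ => 0); split; first by move=> _ [].
by rewrite big_ord1 big_ord0 mulr1.
Qed.

Lemma ideal_pow_zero k : I^[k] 0.
Proof.
by exists 0%N, (fun=> 0), (fun _ _ => 0); split; [case | rewrite big_ord0].
Qed.

Lemma ideal_powD k r s : I^[k] r -> I^[k] s -> I^[k] (r + s).
Proof.
move=> [m [c [x [xI ->]]]] [m' [c' [x' [x'I ->]]]].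
exists (m + m')%N,
  (fun i : 'I_(m + m') => match fintype.split i with inl a => c a | inr b => c' b end),
  (fun i : 'I_(m + m') => match fintype.split i with inl a => x a | inr b => x' b end).
split=> [i j|]; first by case: fintype.split.
rewrite big_split_ord /=; congr (_ + _); apply: eq_bigr => i _.
  by rewrite -[lshift _ _]/(fintype.unsplit (inl _)) unsplitK.
by rewrite -[rshift _ _]/(fintype.unsplit (inr _)) unsplitK.
Qed.

Lemma ideal_powMl k a r : I^[k] r -> I^[k] (a * r).
Proof.
move=> [m [c [x [xI ->]]]]; exists m, (fun i => a * c i), x; split=> //.
by rewrite mulr_sumr; apply: eq_bigr => i _; rewrite mulrA.
Qed.

Lemma ideal_powN k r : I^[k] r -> I^[k] (- r).
Proof. by move=> rI; rewrite -mulN1r; exact: ideal_powMl. Qed.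

Lemma ideal_powB k r s : I^[k] r -> I^[k] s -> I^[k] (r - s).
Proof. by move=> rI sI; apply: ideal_powD => //; exact: ideal_powN. Qed.

Lemma ideal_pow_sum k m (f : 'I_m -> R) :
  (forall i, I^[k] (f i)) -> I^[k] (\sum_i f i).
Proof.
by move=> fI; elim/big_ind: _ => //; [exact: ideal_pow_zero | exact: ideal_powD].
Qed.

Lemma ideal_powS k a r : I a -> I^[k] r -> I^[k.+1] (a * r).
Proof.
move=> aI [m [c [x [xI ->]]]].
exists m, c, (fun i j => oapp (x i) a (unlift ord0 j)); split=> [i j|].
  by case: (unlift ord0 j) => [j'|] /=.
rewrite mulr_sumr; apply: eq_bigr => i _.
rewrite big_ord_recl unlift_none /= mulrCA; congr (_ * (_ * _)).
by apply: eq_bigr => j _; rewrite liftK.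
Qed.

Lemma ideal_powX k a : I a -> I^[k] (a ^+ k).
Proof.
move=> aI; elim: k => [|k IH]; first exact: ideal_pow0.
by rewrite exprS; exact: ideal_powS.
Qed.

Lemma ideal_pow_leS k r : I^[k.+1] r -> I^[k] r.
Proof.
move=> [m [c [x [xI ->]]]]; apply: ideal_pow_sum => i.
rewrite big_ord_recl mulrA; exists 1%N, (fun=> c i * x i ord0),
  (fun _ j => x i (lift ord0 j)); split=> //.
by rewrite big_ord1.
Qed.

Lemma ideal_pow_le k l r : (k <= l)%N -> I^[l] r -> I^[k] r.
Proof.
move=> /subnK <-; elim: (l - k)%N => // j IH /ideal_pow_leS; exact: IH.
Qed.

Lemma ideal_powM k l r s : I^[k] r -> I^[l] s -> I^[(k + l)%N] (r * s).
Proof.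
move=> [m [c [x [xI ->]]]] sI; rewrite mulr_suml; apply: ideal_pow_sum => i.
rewrite -mulrA; apply: ideal_powMl.
elim: k x xI => [|k IH] x xI; first by rewrite big_ord0 mul1r.
rewrite big_ord_recl -mulrA; apply: ideal_powS => //.
exact: (IH (fun i j => x i (lift ord0 j))).
Qed.

Lemma ideal_pow_principal w : I w -> (forall r, I r -> exists c, r = c * w) ->
  forall k r, I^[k] r <-> exists c, r = c * w ^+ k.
Proof.
move=> Iw wI k r; split=> [[m [c [x [xI ->]]]]|[c ->]]; last first.
  by apply/ideal_powMl/ideal_powX.
apply: (big_ind (fun a => exists d, a = d * w ^+ k)) => [|a b [c1 ->] [c2 ->]|i _].
- by exists 0; rewrite mul0r.
- by exists (c1 + c2); rewrite mulrDl.
have /choice [d dE] : forall j, exists d, x i j = d * w by move=> j; exact/wI/xI.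
exists (c i * \prod_j d j); under eq_bigr => j _ do rewrite dE.
by rewrite big_split /= prodr_const card_ord mulrA.
Qed.

Lemma ideal_pow_horner k (p : {poly R}) a b :
  I^[k] (a - b) -> I^[k] (p.[a] - p.[b]).
Proof.
move=> abI; elim/poly_ind: p => [|p c IH].
  by rewrite !horner0 subrr; exact: ideal_pow_zero.
rewrite !hornerE.
have -> : p.[a] * a + c - (p.[b] * b + c) = a * (p.[a] - p.[b]) + p.[b] * (a - b).
  by ring.
by apply: ideal_powD; exact: ideal_powMl.
Qed.

End IdealPowers.

Lemma horner_taylor2 (R : comNzRingType) (p : {poly R}) a h :
  exists q, p.[a + h] = p.[a] + p^`().[a] * h + h ^+ 2 * q.
Proof.
elim/poly_ind: p => [|p c [q IH]].
  by exists 0; rewrite deriv0 !horner0; ring.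
exists (p^`().[a] + q * (a + h)); rewrite derivD derivM derivX derivC !hornerE IH.
by ring.
Qed.

Section Local.
Variables (R : comUnitRingType) (F : fieldType) (res : {rmorphism R -> F}).
Hypothesis unitE : forall r, (r \is a GRing.unit) = (res r != 0).

(** The factor is p'(a) + (b - a) q, with the residue of p'(a). It serves both the uniqueness in
    Hensel's lemma and the comparison of y - x with f_n(x, x). *)
Lemma horner_diff_unit (p : {poly R}) a b : res a = res b -> res p^`().[a] != 0 ->
  exists2 u, u \is a GRing.unit & p.[b] - p.[a] = u * (b - a).
Proof.
move=> ab pa; have [q] := horner_taylor2 p a (b - a).
rewrite addrC subrK => ->; exists (p^`().[a] + (b - a) * q); last by ring.
by rewrite unitE rmorphD rmorphM rmorphB ab subrr mul0r addr0.
Qed.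

Lemma hensel_unique (p : {poly R}) a b :
  res a = res b -> res p^`().[a] != 0 -> p.[a] = 0 -> p.[b] = 0 -> a = b.
Proof.
move=> ab pa a0 b0; have [u uU] := horner_diff_unit ab pa.
rewrite a0 b0 subr0 => /esym/eqP.
by rewrite -(mulr0 u) (can_eq (mulKr uU)) subr_eq0 => /eqP.
Qed.

End Local.

Section CompleteLocal.
Variables (R : comUnitRingType) (F : fieldType) (res : {rmorphism R -> F}).
Hypothesis Rcl : is_complete_local res.
Local Notation I := [set r | res r = 0]%classic.

Lemma ideal_pow1_res k r : ideal_pow I k.+1 r -> res r = 0.
Proof.
move=> [m [c [x [xI ->]]]]; rewrite rmorph_sum big1 // => i _.
by rewrite rmorphM big_ord_recl rmorphM [res (x i ord0)](xI i ord0) mul0r mulr0.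
Qed.

Lemma ideal_pow1E r : res r = 0 -> ideal_pow I 1 r.
Proof. by move=> r0; rewrite -[r]expr1; exact: ideal_powX. Qed.

Lemma hensel (p : {poly R}) a : res p.[a] = 0 -> res p^`().[a] != 0 ->
  exists2 r, p.[r] = 0 & res r = res a.
Proof.
move=> pa0 dp; have [_ unitE [Isep Icpl]] := Rcl.
have dU : p^`().[a] \is a GRing.unit by rewrite unitE.
(* Newton iteration with the slope frozen at [a]: it gains only one power of the ideal per step, but
   a single inverse is used. *)
pose u := fix u k := if k is k'.+1 then u k' - p.[u k'] / p^`().[a] else a.
have uP k : res (u k) = res a /\ ideal_pow I k.+1 p.[u k].
  elim: k => [|k [IHr IHp]]; first by split=> //; exact: ideal_pow1E.
  set h := - (p.[u k] / p^`().[a]).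
  have hI : ideal_pow I k.+1 h.
    by apply: ideal_powN; rewrite mulrC; exact: ideal_powMl.
  have uE : u k.+1 = u k + h by [].
  have Ph : p.[u k] = - h * p^`().[a] by rewrite opprK divrK.
  split; first by rewrite uE rmorphD (ideal_pow1_res hI) addr0.
  have [q] := horner_taylor2 p (u k) h; rewrite uE => ->.
  (* Substituting p(u_k) = - h p'(a) leaves h (p'(u_k) - p'(a)), whose second factor has residue 0,
     and a quadratic remainder. *)
  have -> : p.[u k] + p^`().[u k] * h + h ^+ 2 * q =
      h * (p^`().[u k] - p^`().[a]) + q * (h * h).
    by rewrite Ph; ring.
  apply: ideal_powD.
    rewrite -addn1; apply: ideal_powM => //; apply: ideal_pow1E.
    by rewrite rmorphB -!horner_map /= IHr subrr.
  apply: ideal_powMl; apply: (ideal_pow_le (l := (k.+1 + k.+1)%N)).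
    by rewrite addSn ltnS leq_addl.
  exact: ideal_powM.
have [l lP] : exists l, forall k, ideal_pow I k (u k - l).
  apply: Icpl => k; rewrite /= addrAC subrr add0r.
  apply: ideal_powN; rewrite mulrC; apply/ideal_powMl/ideal_pow_leS.
  by have [] := uP k.
exists l; last first.
  have := ideal_pow1_res (lP 1%N); rewrite rmorphB (uP 1%N).1 => /eqP.
  by rewrite subr_eq0 => /eqP.
apply: Isep => k; rewrite -(subrK p.[u k] p.[l]); apply: ideal_powD.
  by rewrite -opprB; apply/ideal_powN/ideal_pow_horner.
by apply: ideal_pow_leS; have [] := uP k.
Qed.

End CompleteLocal.

(** * Fox calculus for words in two matrices *)

Section Matrix2.
Variable R : comNzRingType.
Implicit Types A B : 'M[R]_2.

Definition mx2 (a b c d : R) : 'M[R]_2 :=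
  \matrix_(i < 2, j < 2)
    if i == 0 then if j == 0 then a else b else if j == 0 then c else d.

Lemma mx2E A : A = mx2 (A 0 0) (A 0 1) (A 1 0) (A 1 1).
Proof.
apply/matrixP => i j; rewrite mxE.
by case: i => -[|[|//]] /= ?; case: j => -[|[|//]] /= ?;
  congr (A _ _); apply: val_inj.
Qed.

Lemma mx2_eq A B :
  A 0 0 = B 0 0 -> A 0 1 = B 0 1 -> A 1 0 = B 1 0 -> A 1 1 = B 1 1 -> A = B.
Proof. by rewrite [A]mx2E [B]mx2E !mxE /= => -> -> -> ->. Qed.

Lemma mx2M a b c d a' b' c' d' :
  mx2 a b c d *m mx2 a' b' c' d' =
  mx2 (a * a' + b * c') (a * b' + b * d') (c * a' + d * c') (c * b' + d * d').
Proof.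
by apply: mx2_eq; rewrite !mxE !big_ord_recl big_ord0 !mxE /= addr0.
Qed.

Lemma mx2D a b c d a' b' c' d' :
  mx2 a b c d + mx2 a' b' c' d' = mx2 (a + a') (b + b') (c + c') (d + d').
Proof. by apply: mx2_eq; rewrite !mxE. Qed.

Lemma mx2N a b c d : - mx2 a b c d = mx2 (- a) (- b) (- c) (- d).
Proof. by apply: mx2_eq; rewrite !mxE. Qed.

Lemma mx2Z k a b c d : k *: mx2 a b c d = mx2 (k * a) (k * b) (k * c) (k * d).
Proof. by apply: mx2_eq; rewrite !mxE. Qed.

Lemma mx2_scalar k : k%:M = mx2 k 0 0 k.
Proof. by apply: mx2_eq; rewrite !mxE. Qed.

Lemma det_mx2 a b c d : \det (mx2 a b c d) = a * d - b * c.
Proof.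
rewrite (expand_det_row _ 0) !big_ord_recl big_ord0 /cofactor !det_mx11 !mxE /=.
by ring.
Qed.

Lemma tr_mx2 a b c d : \tr (mx2 a b c d) = a + d.
Proof. by rewrite /mxtrace !big_ord_recl big_ord0 !mxE /= addr0. Qed.

Lemma adj_mx2 a b c d : \adj (mx2 a b c d) = mx2 d (- b) (- c) a.
Proof.
by apply: mx2_eq; rewrite !mxE /cofactor !det_mx11 !mxE /= ?expr0 ?expr1;
  rewrite ?expr2; ring.
Qed.

Definition mx2S := (mx2M, mx2D, mx2N, mx2Z, mx2_scalar, adj_mx2).

Lemma cayley_hamilton2 A : A *m A = \tr A *: A - (\det A)%:M.
Proof. by rewrite [A]mx2E tr_mx2 det_mx2 !mx2S; congr mx2; ring. Qed.

Lemma det_adj2 A : \det (\adj A) = \det A.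
Proof. by rewrite [A]mx2E !mx2S !det_mx2; ring. Qed.

Lemma tr_adj2 A : \tr (\adj A) = \tr A.
Proof. by rewrite [A]mx2E !mx2S !tr_mx2 addrC. Qed.

Lemma mul_mx_adj1 A : \det A = 1 -> A *m \adj A = 1%:M.
Proof. by move=> dA; rewrite mul_mx_adj dA. Qed.

Lemma mul_adj_mx1 A : \det A = 1 -> \adj A *m A = 1%:M.
Proof. by move=> dA; rewrite mul_adj_mx dA. Qed.

End Matrix2.

Section Words.
Variables (R : comNzRingType) (A B : 'M[R]_2).
Hypotheses (dA : \det A = 1) (dB : \det B = 1).

Definition gen_mx (x : bool) : 'M[R]_2 := if x then B else A.
(** For determinant 1 the adjugate is the inverse, so words are evaluated over any commutative ring
    without [invmx]. *)
Definition letter_mx (l : bool * bool) : 'M[R]_2 :=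
  if l.2 then \adj (gen_mx l.1) else gen_mx l.1.
Definition word_mx (u : word) : 'M[R]_2 :=
  foldr (fun l M => letter_mx l *m M) 1%:M u.

(* The Fox derivative with respect to b. *)
Definition fox_letter (l : bool * bool) : 'M[R]_2 :=
  if l.1 then if l.2 then - \adj B else 1%:M else 0.
Fixpoint fox (u : word) : 'M[R]_2 :=
  if u is l :: u' then fox_letter l + letter_mx l *m fox u' else 0.

Lemma det_gen_mx x : \det (gen_mx x) = 1.
Proof. by case: x. Qed.

Lemma det_letter_mx l : \det (letter_mx l) = 1.
Proof. by rewrite /letter_mx; case: l.2; rewrite ?det_adj2 det_gen_mx. Qed.

Lemma word_mx_cat u v : word_mx (u ++ v) = word_mx u *m word_mx v.
Proof. by elim: u => [|l u IH] /=; rewrite ?mul1mx // IH mulmxA. Qed.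

Lemma fox_cat u v : fox (u ++ v) = fox u + word_mx u *m fox v.
Proof.
elim: u => [|l u IH] /=; first by rewrite mul1mx add0r.
by rewrite IH mulmxDr addrA mulmxA.
Qed.

Lemma det_word_mx u : \det (word_mx u) = 1.
Proof. by elim: u => [|l u IH] /=; rewrite ?det1 // det_mulmx IH det_letter_mx mulr1. Qed.

Lemma letter_mxV x e : letter_mx (x, e) *m letter_mx (x, ~~ e) = 1%:M.
Proof.
by rewrite /letter_mx; case: e => /=; [apply: mul_adj_mx1 | apply: mul_mx_adj1];
  exact: det_gen_mx.
Qed.

Lemma fox_free x e : fox [:: (x, e); (x, ~~ e)] = 0.
Proof.
rewrite /= /fox_letter /letter_mx /=; case: x e => -[] /=; rewrite !(mulmx0, addr0) //.
  by rewrite mulmx1 addNr.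
by rewrite mulmxN mul_mx_adj1 // subrr.
Qed.

Lemma adj_uniq2 (M N : 'M[R]_2) : \det M = 1 -> N *m M = 1%:M -> N = \adj M.
Proof. by move=> dM NM; rewrite -[N]mulmx1 -(mul_mx_adj1 dM) mulmxA NM mul1mx. Qed.

Lemma winv_cons l u : winv (l :: u) = winv u ++ [:: (l.1, ~~ l.2)].
Proof. by rewrite /winv rev_cons map_rcons cats1. Qed.

Lemma word_mx_winv u : word_mx (winv u) = \adj (word_mx u).
Proof.
apply: adj_uniq2; first exact: det_word_mx.
elim: u => [|[x e] u IH] /=; first by rewrite mulmx1.
rewrite winv_cons word_mx_cat /= mulmx1 -mulmxA (mulmxA (letter_mx _)).
by rewrite -{2}[e]negbK letter_mxV mul1mx.
Qed.

Lemma fox_winv u : fox (winv u) = - (word_mx (winv u) *m fox u).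
Proof.
apply/eqP; rewrite -addr_eq0 -fox_cat; apply/eqP.
elim: u => [|[x e] u IH] //.
rewrite winv_cons -catA fox_cat -[_ ++ _ :: u]/([:: (x, ~~ e); (x, e)] ++ u).
rewrite fox_cat -{2 4}[e]negbK fox_free add0r /= mulmx1 letter_mxV mul1mx.
by rewrite -fox_cat.
Qed.

Section Powers.
Variable u : word.
Local Notation W := (word_mx u).
Local Notation t := (\tr W).
Let wp (n : int) := cheb t n *: W - (cheb t (n - 1))%:M.

Let wpS n : W *m wp n = wp (n + 1).
Proof.
rewrite /wp mulmxBr -scalemxAr cayley_hamilton2 det_word_mx mul_mx_scalar addrK.
by rewrite chebB1; apply/matrixP => i j; rewrite !mxE; ring.
Qed.

Let wpV n : \adj W *m wp (n + 1) = wp n.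
Proof. by rewrite -wpS mulmxA mul_adj_mx1 ?mul1mx // det_word_mx. Qed.

(** By Cayley-Hamilton W^2 = tW - 1, so all powers lie in the span of W and 1; multiplication by the
    adjugate gives the step for negative exponents. *)
Lemma word_mx_wpow n :
  word_mx (wpow u n) = cheb t n *: W - (cheb t (n - 1))%:M.
Proof.
rewrite -/(wp n).
have wp0 : wp 0 = 1%:M.
  rewrite /wp chebB1 cheb0 scale0r add0r cheb1.
  by apply/matrixP => i j; rewrite !mxE; ring.
case: n => j; rewrite /wpow; first elim: j => [|j IH] //=.
  by rewrite word_mx_cat IH wpS; congr wp; lia.
rewrite NegzE; move: (j.+1) => {}j; elim: j => [|j IH] //=.
rewrite word_mx_cat IH word_mx_winv -(wpV (- j.+1%:Z)).
by congr (_ *m wp _); lia.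
Qed.

(** The derivative of u^n is (1 + W + ... + W^(n-1)) times that of u, and the factor W - 1
    telescopes the sum. Negative powers follow from the inverse word, as W - 1 = - W (W^(-1) -
    1). *)
Lemma fox_wpow n :
  (W - 1%:M) *m fox (wpow u n) = (word_mx (wpow u n) - 1%:M) *m fox u.
Proof.
have pos v (j : nat) : (word_mx v - 1%:M) *m fox (flatten (nseq j v)) =
    (word_mx (flatten (nseq j v)) - 1%:M) *m fox v.
  elim: j => [|j IH] /=; first by rewrite mulmx0 subrr mul0mx.
  set V := word_mx v in IH *.
  have cV : (V - 1%:M) *m V = V *m (V - 1%:M) by rewrite mulmxBr mulmxBl mul1mx mulmx1.
  rewrite fox_cat word_mx_cat mulmxDr mulmxA cV -mulmxA IH mulmxA -mulmxDl.
  by congr (_ *m _); rewrite mulmxBr mulmx1 addrC subrKA.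
case: n => j; first exact: pos.
rewrite /wpow; move: (j.+1) => {}j.
have WV : W *m word_mx (winv u) = 1%:M.
  by rewrite word_mx_winv mul_mx_adj1 // det_word_mx.
have cW : W *m word_mx (flatten (nseq j (winv u))) =
    word_mx (flatten (nseq j (winv u))) *m W.
  elim: j => [|j IH] /=; first by rewrite mul1mx mulmx1.
  rewrite word_mx_cat mulmxA WV -mulmxA -IH mulmxA word_mx_winv.
  by rewrite mul_adj_mx1 // det_word_mx.
have -> : W - 1%:M = - (W *m (word_mx (winv u) - 1%:M)).
  by rewrite mulmxBr WV mulmx1 opprB.
rewrite mulNmx -mulmxA pos fox_winv !mulmxN opprK !mulmxA mulmxBr cW mulmx1.
by congr (_ *m _); rewrite mulmxBl -mulmxA WV mulmx1.
Qed.

End Powers.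

End Words.

Section TwistRelation.
Variables (R : comNzRingType) (A B : 'M[R]_2).
Hypotheses (dA : \det A = 1) (dB : \det B = 1) (tAB : \tr A = \tr B).
Local Notation W := (A *m \adj B *m \adj A *m B).

Lemma twist_word_mx : word_mx A B twist_word = W.
Proof. by rewrite /= /letter_mx /= mulmx1 !mulmxA. Qed.

Lemma tr_commutator2 : \tr W = zed (\tr A) (\tr (A *m B)).
Proof.
move: dA dB tAB; rewrite /zed [A]mx2E [B]mx2E !mx2S !tr_mx2 !det_mx2.
move: (A 0 0) (A 0 1) (A 1 0) (A 1 1) (B 0 0) (B 0 1) (B 1 0) (B 1 1).
move=> a b c d e f g h dA' dB' tAB'.
(* The trace eliminates h, and the two determinants become rewriting rules for bc and fg, modulo
   which [ring] decides the identity. *)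
have hE : h = a + d - e by rewrite tAB'; ring.
have bc : b * c = a * d - 1 by rewrite -dA'; ring.
have fg : f * g = e * (a + d - e) - 1 by rewrite -hE -dB'; ring.
by rewrite hE; ring: bc fg.
Qed.

(** The case n = 1, where f_1 = y - 1; [relator_mxB] extends it by linearity, W^n being a
    combination of W and 1. *)
Lemma twist_relator_step :
  A *m W - W *m B = (\tr (A *m B) - 1) *: (A - B).
Proof.
move: dA dB tAB; rewrite [A]mx2E [B]mx2E !mx2S !tr_mx2 !det_mx2.
move: (A 0 0) (A 0 1) (A 1 0) (A 1 1) (B 0 0) (B 0 1) (B 1 0) (B 1 1).
move=> a b c d e f g h dA' dB' tAB'.
have hE : h = a + d - e by rewrite tAB'; ring.
have bc : b * c = a * d - 1 by rewrite -dA'; ring.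
have fg : f * g = e * (a + d - e) - 1 by rewrite -hE -dB'; ring.
by rewrite hE; congr mx2; ring: bc fg.
Qed.

End TwistRelation.

(** Expands the mixed term in the determinant of a difference into four traces that do not involve
    p, q, k, l. *)
Lemma tr_mx2_expand (R : comNzRingType) (N W X V : 'M[R]_2) (p q k l : R) :
  \tr (N *m (p *: W - (- q)%:M) *m X *m (k *: (V - l%:M))) =
  k * (p * (\tr (N *m W *m X *m V) - l * \tr (N *m W *m X))
     + q * (\tr (N *m X *m V) - l * \tr (N *m X))).
Proof.
have -> : p *: W - (- q)%:M = p *: W + q%:M.
  by apply/matrixP => i j; rewrite !mxE; ring.
rewrite -scalemxAr mxtraceZ; congr (_ * _).
rewrite mulmxBr mulmxDr !mulmxDl !mul_mx_scalar -!scalemxAr -!scalemxAl.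
by rewrite ?scalerDr !(raddfB, raddfD) /= !mxtraceZ; ring.
Qed.

Section FoxDeterminant.
Variables (R : comNzRingType) (A B : 'M[R]_2) (n : int).
Hypotheses (dA : \det A = 1) (dB : \det B = 1) (tAB : \tr A = \tr B).
Local Notation x := (\tr A).
Local Notation y := (\tr (A *m B)).
Local Notation z := (zed x y).
Local Notation W := (A *m \adj B *m \adj A *m B).
Local Notation S := (cheb z n).

Definition relator_lhs : word := wgen false ++ wpow twist_word n.
Definition relator_rhs : word := wpow twist_word n ++ wgen true.

(** The matrix D, obtained by differentiating the two sides of a w^n = w^n b separately;
    [relator_foxE] gives its closed form. *)
Definition relator_fox : 'M[R]_2 := fox A B relator_lhs - fox A B relator_rhs.

Lemma twist_word_pow :
  word_mx A B (wpow twist_word n) = S *: W - (cheb z (n - 1))%:M.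
Proof. by rewrite word_mx_wpow // twist_word_mx tr_commutator2. Qed.

Lemma relator_mxB :
  word_mx A B relator_lhs - word_mx A B relator_rhs = fval n x y *: (A - B).
Proof.
rewrite !word_mx_cat twist_word_pow /= !mulmx1 /letter_mx /=.
rewrite mulmxBr mulmxBl -scalemxAl -scalemxAr mul_mx_scalar mul_scalar_mx.
have -> : S *: (A *m W) - cheb z (n - 1) *: A - (S *: (W *m B) - cheb z (n - 1) *: B)
   = S *: (A *m W - W *m B) - cheb z (n - 1) *: (A - B).
  by apply/matrixP => i j; rewrite !mxE; ring.
rewrite twist_relator_step //; apply/matrixP => i j.
by rewrite /fval !mxE; ring.
Qed.

Lemma adj_mx2_sub (M N : 'M[R]_2) : \adj (M - N) = \adj M - \adj N.
Proof. by rewrite [M]mx2E [N]mx2E !mx2S; congr mx2; ring. Qed.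

Lemma adj_mx2_scale k (M : 'M[R]_2) : \adj (k *: M) = k *: \adj M.
Proof. by rewrite [M]mx2E !mx2S; congr mx2; ring. Qed.

Lemma adj_mx2_scalar (k : R) : \adj (k%:M : 'M[R]_2) = k%:M.
Proof. by rewrite !mx2S; congr mx2; ring. Qed.

Lemma det_mx2_sub (M N : 'M[R]_2) :
  \det (M - N) = \det M + \det N - \tr (M *m \adj N).
Proof. by rewrite [M]mx2E [N]mx2E !mx2S !det_mx2 tr_mx2; ring. Qed.

Lemma det_mx2_affine p q (M : 'M[R]_2) :
  \det (p *: M - q%:M) = p ^+ 2 * \det M - p * q * \tr M + q ^+ 2.
Proof. by rewrite [M]mx2E !mx2S !det_mx2 tr_mx2; ring. Qed.

Lemma det_commutator : \det W = 1.
Proof. by rewrite !det_mulmx !det_adj2 dA dB !mulr1. Qed.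

(** The Fox derivative of w with respect to b, namely a b^(-1) (a^(-1) - 1). *)
Let X0 := A *m \adj B *m (\adj A - 1%:M).

(** Transfers a trace identity to generic entries, whose only relations are the two determinants and
    the equality of traces. Traces of words in A and B are polynomials in x and y; each use verifies
    such a polynomial. *)
Let tr_prep (P : 'M[R]_2 -> 'M[R]_2 -> R) (Q : R -> R -> R) :
  (forall a b c d e f g h, b * c = a * d - 1 -> f * g = e * h - 1 -> h = a + d - e ->
    P (mx2 a b c d) (mx2 e f g h) = Q (a + d) (a * e + b * g + (c * f + d * h))) ->
  P A B = Q x y.
Proof.
move=> H; move: dA dB tAB; rewrite [A]mx2E [B]mx2E mx2M !tr_mx2 !det_mx2.
move: (A 0 0) (A 0 1) (A 1 0) (A 1 1) (B 0 0) (B 0 1) (B 1 0) (B 1 1).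
move=> a b c d e f g h dA' dB' tAB'; apply: H.
- by rewrite -dA'; ring.
- by rewrite -dB'; ring.
- by rewrite tAB'; ring.
Qed.

(** [tr00] to [tr11] are the traces of (A - 1) W^i X0 W^(-j) for i, j in {0, 1}, as they enter
    [tr_mx2_expand]. *)
Let tr00 : \tr ((A - 1%:M) *m X0) = - x ^+ 3 + 2 * x ^+ 2 + x * y - 2 * y.
Proof.
rewrite /X0; apply: (@tr_prep (fun A B => \tr ((A - 1%:M) *m (A *m \adj B *m (\adj A - 1%:M))))
  (fun u v => - u ^+ 3 + 2 * u ^+ 2 + u * v - 2 * v)) => a b c d e f g h bc fg hE.
rewrite !mx2S tr_mx2 hE; rewrite hE in fg; ring: bc fg.
Qed.

Let tr01 : \tr ((A - 1%:M) *m X0 *m \adj W) =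
  - x ^+ 3 * y + x ^+ 3 + x ^+ 2 * y ^+ 2 - 2 * x ^+ 2 * y + 2 * x ^+ 2
  + x * y ^+ 2 + x * y - 4 * x - y ^+ 3 + 2 * y.
Proof.
rewrite /X0; apply: (@tr_prep (fun A B => \tr ((A - 1%:M) *m (A *m \adj B *m (\adj A - 1%:M)) *m \adj (A *m \adj B *m \adj A *m B)))
  (fun u v => - u ^+ 3 * v + u ^+ 3 + u ^+ 2 * v ^+ 2 - 2 * u ^+ 2 * v + 2 * u ^+ 2
  + u * v ^+ 2 + u * v - 4 * u - v ^+ 3 + 2 * v)) => a b c d e f g h bc fg hE.
rewrite !mx2S tr_mx2 hE; rewrite hE in fg; ring: bc fg.
Qed.

Let tr10 : \tr ((A - 1%:M) *m W *m X0) =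
  x ^+ 5 * y - 2 * x ^+ 5 - 2 * x ^+ 4 * y + 4 * x ^+ 4 - 2 * x ^+ 3 * y ^+ 2
  + 2 * x ^+ 3 * y + 3 * x ^+ 3 + 4 * x ^+ 2 * y ^+ 2 - 4 * x ^+ 2 * y
  - 6 * x ^+ 2 + x * y ^+ 3 - 3 * x * y - 2 * y ^+ 3 + 6 * y.
Proof.
rewrite /X0; apply: (@tr_prep (fun A B => \tr ((A - 1%:M) *m (A *m \adj B *m \adj A *m B) *m (A *m \adj B *m (\adj A - 1%:M))))
  (fun u v => u ^+ 5 * v - 2 * u ^+ 5 - 2 * u ^+ 4 * v + 4 * u ^+ 4 - 2 * u ^+ 3 * v ^+ 2
  + 2 * u ^+ 3 * v + 3 * u ^+ 3 + 4 * u ^+ 2 * v ^+ 2 - 4 * u ^+ 2 * v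
  - 6 * u ^+ 2 + u * v ^+ 3 - 3 * u * v - 2 * v ^+ 3 + 6 * v)) => a b c d e f g h bc fg hE.
rewrite !mx2S tr_mx2 hE; rewrite hE in fg; ring: bc fg.
Qed.

Let tr11 : \tr ((A - 1%:M) *m W *m X0 *m \adj W) =
  x ^+ 5 * y ^+ 2 - 3 * x ^+ 5 * y + 2 * x ^+ 5 - x ^+ 4 * y ^+ 3
  + 4 * x ^+ 4 * y ^+ 2 - 5 * x ^+ 4 * y + 2 * x ^+ 4 - 2 * x ^+ 3 * y ^+ 3
  + 2 * x ^+ 3 * y ^+ 2 + 7 * x ^+ 3 * y - 7 * x ^+ 3 + 2 * x ^+ 2 * y ^+ 4
  - 4 * x ^+ 2 * y ^+ 3 - 4 * x ^+ 2 * y ^+ 2 + 10 * x ^+ 2 * y - 2 * x ^+ 2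
  + x * y ^+ 4 + x * y ^+ 3 - 5 * x * y ^+ 2 - 3 * x * y + 4 * x
  - y ^+ 5 + 5 * y ^+ 3 - 6 * y.
Proof.
rewrite /X0; apply: (@tr_prep (fun A B => \tr ((A - 1%:M) *m (A *m \adj B *m \adj A *m B) *m (A *m \adj B *m (\adj A - 1%:M)) *m \adj (A *m \adj B *m \adj A *m B)))
  (fun u v => u ^+ 5 * v ^+ 2 - 3 * u ^+ 5 * v + 2 * u ^+ 5 - u ^+ 4 * v ^+ 3
  + 4 * u ^+ 4 * v ^+ 2 - 5 * u ^+ 4 * v + 2 * u ^+ 4 - 2 * u ^+ 3 * v ^+ 3
  + 2 * u ^+ 3 * v ^+ 2 + 7 * u ^+ 3 * v - 7 * u ^+ 3 + 2 * u ^+ 2 * v ^+ 4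
  - 4 * u ^+ 2 * v ^+ 3 - 4 * u ^+ 2 * v ^+ 2 + 10 * u ^+ 2 * v - 2 * u ^+ 2
  + u * v ^+ 4 + u * v ^+ 3 - 5 * u * v ^+ 2 - 3 * u * v + 4 * u
  - v ^+ 5 + 5 * v ^+ 3 - 6 * v)) => a b c d e f g h bc fg hE.
rewrite !mx2S tr_mx2 hE; rewrite hE in fg; ring: bc fg.
Qed.

Lemma relator_foxE : relator_fox =
  (A - 1%:M) *m fox A B (wpow twist_word n) - word_mx A B (wpow twist_word n).
Proof.
rewrite /relator_fox !fox_cat /= /letter_mx /fox_letter /= !mulmx0 !addr0 add0r.
by rewrite !mulmx1 mulmxBl mul1mx opprD addrA.
Qed.

Hypothesis fxy : fval n x y = 0.

Let S1 : cheb z (n - 1) = (y - 1) * S.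
Proof. by move/eqP: fxy; rewrite subr_eq0 => /eqP. Qed.

(** On the curve S_{n-1}(z) = (y - 1) S_n(z), so the norm identity reads (1 - (y - 1) z + (y - 1)^2)
    S_n(z)^2 = 1, and the coefficient factors. *)
Lemma cheb_sqr_norm : (2 - y) * (y ^+ 2 - x ^+ 2 * y + x ^+ 2) * S ^+ 2 = 1.
Proof.
have := cheb_norm z (n - 1); rewrite subrK S1 => H.
by rewrite -[RHS]H /zed; ring.
Qed.

(** Chosen so that adj(W - 1) (W^n - 1) = p W + q on the curve, with adj(W - 1) = (z - 1) - W. *)
Let p := (y - 2) * S + 1.
Let q := S - (z - 1) * ((y - 1) * S + 1).

(** [fox_wpow] controls the derivative of w^n only after multiplication by W - 1; applying adj(W -
    1) turns this factor into the scalar det(W - 1) = 2 - z. *)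
Let fox_scaled : (2 - z) *: relator_fox =
  (A - 1%:M) *m (p *: W - (- q)%:M) *m X0 - ((2 - z) * S) *: (W - (y - 1)%:M).
Proof.
have dW := det_commutator; have tW := tr_commutator2 dA dB tAB.
have dW1 : \det (W - 1%:M) = 2 - z.
  by have := det_mx2_affine 1 1 W; rewrite scale1r dW tW => ->; ring.
have WW : W *m W = z *: W - 1%:M by rewrite cayley_hamilton2 dW tW.
have aW : \adj (W - 1%:M) = (z - 1)%:M - W.
  rewrite adj_mx2_sub adj_mx2_scalar.
  have -> : \adj W = z%:M - W; last by apply/matrixP => i j; rewrite !mxE; ring.
  apply/esym/adj_uniq2 => //; rewrite mulmxBl WW mul_scalar_mx.
  by apply/matrixP => i j; rewrite !mxE; ring.
have key : \adj (W - 1%:M) *m (word_mx A B (wpow twist_word n) - 1%:M) =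
    p *: W - (- q)%:M.
  rewrite aW twist_word_pow S1 mulmxBl mul_scalar_mx !mulmxBr -scalemxAr WW.
  rewrite !mul_mx_scalar; apply/matrixP => i j; rewrite /p /q !mxE; ring.
have fW : fox A B twist_word = X0.
  rewrite /= /fox_letter /letter_mx /X0 /= !(mulmx0, addr0, add0r, mulmx1).
  by rewrite -mulmxA; congr (_ *m _); rewrite mulmxBr mulmx1 addrC.
rewrite relator_foxE scalerBr twist_word_pow S1; congr (_ - _); last first.
  by apply/matrixP => i j; rewrite !mxE; ring.
rewrite scalemxAr -(mulmxA (A - 1%:M)); congr (_ *m _).
rewrite -key -(mulmxA (\adj (W - 1%:M))) -fW.
have := fox_wpow dA dB twist_word n; rewrite twist_word_mx => <-.
rewrite mulmxA mul_adj_mx dW1.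
by rewrite mul_scalar_mx.
Qed.

(** The determinant of the difference in [fox_scaled] is quadratic in S = S_n(z), and
    [cheb_sqr_norm] determines S^2. The prefactor, linear in S, is chosen so that modulo this
    relation the product collapses to a multiple of S (y - x)^2. *)
Lemma det_relator_fox :
  (2 - y) * ((x - 2) * (y ^+ 2 - x ^+ 2 * y + x ^+ 2) * S + (y + x - x ^+ 2))
    * ((2 - z) ^+ 2 * \det relator_fox) =
  2 * (x - 2) * S * (y - x) ^+ 2 * (2 - z) ^+ 2.
Proof.
have dW := det_commutator; have tW := tr_commutator2 dA dB tAB.
rewrite -detZ fox_scaled det_mx2_sub detZ adj_mx2_scale adj_mx2_sub adj_mx2_scalar.
have dA1 : \det (A - 1%:M) = 2 - x.
  by have := det_mx2_affine 1 1 A; rewrite scale1r dA => ->; ring.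
have dX0 : \det X0 = 2 - x.
  rewrite /X0 !det_mulmx det_adj2 dA dB !mul1r.
  have := det_mx2_affine 1 1 (\adj A); rewrite scale1r det_adj2 dA tr_adj2 => ->; ring.
have dWy : \det (W - (y - 1)%:M) = 1 - (y - 1) * z + (y - 1) ^+ 2.
  by have := det_mx2_affine 1 (y - 1) W; rewrite scale1r dW tW => ->; ring.
rewrite tr_mx2_expand tr00 tr01 tr10 tr11 2!det_mulmx dA1 dX0 det_mx2_affine dW tW dWy.
rewrite /p /q; move: S cheb_sqr_norm => T e0; apply/eqP; rewrite -subr_eq0; apply/eqP.
(* [E0] and [E1] are the constant and linear coefficients in S of (2 - z)^2 det D, and [g0], [g1]
   those of the difference of the two sides. That difference is a cubic divisible by 1 - (2 - y)(y^2
   - x^2 y + x^2) S^2, so its cofactor is g0 + g1 S. *)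
pose E0 := - (z - 2) * (x - 2) ^+ 2.
pose E1 := (z - 2) * (- 2 * (x - 2) * (z - 2) - 2 * (x - 2) ^+ 2 * (y - 2)).
pose g0 := (2 - y) * (y + x - x ^+ 2) * E0.
pose g1 := (2 - y) * ((x - 2) * (y ^+ 2 - x ^+ 2 * y + x ^+ 2) * E0 + (y + x - x ^+ 2) * E1)
  - 2 * (x - 2) * (y - x) ^+ 2 * (zed x y - 2) ^+ 2.
transitivity ((g0 + g1 * T) * (1 - (2 - y) * (y ^+ 2 - x ^+ 2 * y + x ^+ 2) * T ^+ 2)).
  by rewrite /g0 /g1 /E0 /E1 /zed; ring.
by rewrite e0 subrr mulr0.
Qed.

End FoxDeterminant.

(** * The first homology of the twist group *)

Section PairRepresentation.
Variables (n : int) (R : comNzRingType) (A B : 'M[R]_2).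
Hypotheses (dA : \det A = 1) (dB : \det B = 1).
Local Notation lhs := (relator_lhs n).
Local Notation rhs := (relator_rhs n).
Hypothesis AB : word_mx A B lhs = word_mx A B rhs.

Lemma word_mx_pres_eq u v : pres_eq lhs rhs u v -> word_mx A B u = word_mx A B v.
Proof.
elim=> {u v} [//|u v _ -> //|u v w _ -> _ -> //|u1 u2 v1 v2 _ e1 _ e2|x e|].
- by rewrite !word_mx_cat e1 e2.
- by rewrite /= mulmx1 letter_mxV.
- exact: AB.
Qed.

Lemma pres_eq_repr u : pres_eq lhs rhs (repr (pres_class lhs rhs u)) u.
Proof. by apply/pres_classP; rewrite pres_class_repr. Qed.

Lemma pair_rep_mxM (g h : twist_group n) :
  word_mx A B (repr (g * h)%g) = word_mx A B (repr g) *m word_mx A B (repr h).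
Proof. by rewrite -word_mx_cat; exact/word_mx_pres_eq/pres_eq_repr. Qed.

Definition pair_rep : sl2rep (twist_group n) R :=
  SL2Rep pair_rep_mxM (fun g => det_word_mx dA dB (repr g)).

Lemma pair_rep_class u : pair_rep (pres_class _ _ u) = word_mx A B u.
Proof. exact/word_mx_pres_eq/pres_eq_repr. Qed.

Lemma pair_rep_a : pair_rep (twist_a n) = A.
Proof. by rewrite pair_rep_class /= mulmx1. Qed.

Lemma pair_rep_b : pair_rep (twist_b n) = B.
Proof. by rewrite pair_rep_class /= mulmx1. Qed.

(** Free cancellation contributes 0 and the defining relation contributes D itself. So the Fox
    derivative becomes a function on the group modulo left multiples of D. *)
Lemma fox_pres_eq u v : pres_eq lhs rhs u v ->
  exists X, fox A B u - fox A B v = X *m relator_fox A B n.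
Proof.
elim=> {u v} [u|u v _ [X e]|u v w _ [X e] _ [Y f]|u1 u2 v1 v2 e1 [X f1] e2 [Y f2]|x e|].
- by exists 0; rewrite subrr mul0mx.
- by exists (- X); rewrite mulNmx -e opprB.
- by exists (X + Y); rewrite mulmxDl -e -f addrA subrK.
- exists (X + word_mx A B u1 *m Y); rewrite mulmxDl -mulmxA -f1 -f2 !fox_cat.
  rewrite (word_mx_pres_eq e1) mulmxBr.
  by apply/matrixP => i j; rewrite !mxE; ring.
- by exists 0; rewrite mul0mx fox_free // subr0.
- by exists 1%:M; rewrite mul1mx.
Qed.

End PairRepresentation.

Section RepWords.
Variables (n : int) (R : comNzRingType) (rho : sl2rep (twist_group n) R).
Local Notation A := (rho (twist_a n)).
Local Notation B := (rho (twist_b n)).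
Local Notation cl := (pres_class (relator_lhs n) (relator_rhs n)).

Lemma rep1 : rho 1%g = 1%:M.
Proof.
have := rep_mxM rho 1%g 1%g; rewrite mulg1 => e.
rewrite -[LHS]mul1mx -(mul_adj_mx1 (rep_det rho 1%g)) -mulmxA -e.
by rewrite mul_adj_mx1 // rep_det.
Qed.

Lemma pres_class_cat u v : cl (u ++ v) = (cl u * cl v)%g :> twist_group n.
Proof. by rewrite -[RHS]/(pres_mul _ _) pres_mulE. Qed.

Lemma rep_class u : rho (cl u) = word_mx A B u.
Proof.
elim: u => [|l u IH]; first exact: rep1.
rewrite -cat1s pres_class_cat rep_mxM IH word_mx_cat; congr (_ *m _).
rewrite /= mulmx1 /letter_mx; case: l => -[] [] //=;
  apply: adj_uniq2; rewrite ?rep_det // -rep_mxM -pres_class_cat -rep1;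
  congr (rho _); apply/pres_classP; exact: (pres_free _ _ _ true).
Qed.

Lemma rep_relation :
  word_mx A B (relator_lhs n) = word_mx A B (relator_rhs n).
Proof. by rewrite -!rep_class; congr (rho _); apply/pres_classP/pres_rel. Qed.

(** The relation says that w^n conjugates b into a. *)
Lemma rep_tr_ab : \tr A = \tr B.
Proof.
set P := word_mx A B (wpow twist_word n).
have dP : \det P = 1 by apply: det_word_mx; exact: rep_det.
have e : A *m P = P *m B.
  by have := rep_relation; rewrite !word_mx_cat /= !mulmx1.
have -> : A = P *m B *m \adj P by rewrite -e -mulmxA mul_mx_adj1 // mulmx1.
by rewrite -mulmxA mxtrace_mulC -mulmxA mul_adj_mx1 // mulmx1.
Qed.

End RepWords.

(** * Bar chains with a single term *)

Section Chains.
Variables (G : groupType) (R : comNzRingType) (rho : sl2rep G R).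
Local Open Scope classical_set_scope.

Definition sing_fun k (g : {ffun 'I_k -> G}) (v : 'rV[R]_2) :
    {ffun 'I_k -> G} -> 'rV[R]_2 :=
  fun h => if h == g then v else 0.

Lemma sing_fin k (g : {ffun 'I_k -> G}) v : chain_pred (sing_fun g v).
Proof.
apply/asboolP; apply: (@sub_finite_set _ _ [set g]); last exact: finite_set1.
by move=> h; rewrite /= /sing_fun; case: eqP.
Qed.

Definition sing k g v : chain G R k := Chain (@sing_fin k g v).

Lemma chainP k (c d : chain G R k) : (forall g, c g = d g) -> c = d.
Proof. by move=> cd; apply/val_inj/funext. Qed.

Lemma chain_addE k (c d : chain G R k) g : (c + d) g = c g + d g.
Proof. by []. Qed.
Lemma chain_oppE k (c : chain G R k) g : (- c) g = - c g.
Proof. by []. Qed.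
Lemma chain_sumE k (I : Type) (r : seq I) (f : I -> chain G R k) g :
  (\sum_(i <- r) f i) g = \sum_(i <- r) f i g.
Proof.
by elim: r => [|i r IH]; rewrite ?big_nil ?big_cons //= -IH.
Qed.

Lemma sing_linear k g : linear (@sing k g).
Proof.
move=> a u v; apply: chainP => h.
change (sing_fun g (a *: u + v) h = a *: sing_fun g u h + sing_fun g v h).
by rewrite /sing_fun; case: ifP => // _; rewrite scaler0 addr0.
Qed.
HB.instance Definition _ k g := GRing.isLinear.Build R 'rV[R]_2 (chain G R k) _
  (@sing k g) (@sing_linear k g).

Lemma chain_ind k (P : chain G R k -> Prop) :
  P 0 -> (forall c d, P c -> P d -> P (c + d)) -> (forall g v, P (sing g v)) ->
  forall c, P c.
Proof.
move=> P0 PD Ps c; have /finite_seqP [s sE] := chain_finite c.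
have {sE} : forall g, g \notin s -> c g = 0.
  move=> g gs; apply: contrapT => cg.
  have : [set g | c g <> 0] g by [].
  by rewrite sE /=; apply/negP.
elim: s c => [|g s IH] c cs.
  by have -> : c = 0 by apply: chainP => g; rewrite cs.
rewrite -(subrK (sing g (c g)) c); apply: PD => //; apply: IH => h hs.
rewrite chain_addE chain_oppE /= /sing_fun; case: eqP => [->|/eqP hg].
  by rewrite subrr.
by rewrite subr0 cs // inE negb_or hg.
Qed.

Lemma boundary_sing k (g : {ffun 'I_k.+1 -> G}) v :
  boundary rho (sing g v) = \sum_(i < k.+2) sing (face i g) (face_coef rho i g v).
Proof.
apply: chainP => h; rewrite chain_sumE.
change (boundary_fun rho (sing g v) h =
  \sum_(i < k.+2) sing_fun (face i g) (face_coef rho i g v) h).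
rewrite /boundary_fun; apply: eq_bigr => i _; rewrite /sing_fun.
case: eqP => [->|hg].
  rewrite -(fsbig_widen [set g]) ?fsbig_set1 /= /sing_fun ?eqxx //.
    by move=> g' /= ->.
  by move=> g' /= [_]; case: eqP => // _ _; rewrite face_coef0.
apply: fsbig1 => g' /= g'h; rewrite /sing_fun; case: eqP => [e|_]; last exact: face_coef0.
by case: hg; rewrite -g'h e.
Qed.

Definition bar1 (g : G) : {ffun 'I_1 -> G} := [ffun=> g].
Definition bar2 (g h : G) : {ffun 'I_2 -> G} := [ffun i => if i == 0 then g else h].
Local Notation s1 g v := (sing (bar1 g) v).

Lemma boundary2_sing g h v :
  boundary rho (sing (bar2 g h) v) = s1 h (v *m rho g) - s1 (g * h)%g v + s1 g v.
Proof.
rewrite boundary_sing !big_ord_recl big_ord0 addr0 addrA.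
have f0 : face ord0 (bar2 g h) = bar1 h.
  by apply/ffunP => j; rewrite (ord1 j) !ffunE.
have f1 : face (lift ord0 ord0) (bar2 g h) = bar1 (g * h)%g.
  by apply/ffunP => j; rewrite (ord1 j) !ffunE.
have f2 : face (lift ord0 (lift ord0 ord0)) (bar2 g h) = bar1 g.
  by apply/ffunP => j; rewrite (ord1 j) !ffunE.
rewrite f0 f1 f2 /face_coef /= ffunE /= expr1 scaleN1r linearN /=.
by rewrite -signr_odd /= expr0 scale1r.
Qed.

Lemma boundary1_sing g v :
  boundary rho (s1 g v) = sing [ffun=> g] (v *m rho g - v).
Proof.
rewrite boundary_sing !big_ord_recl big_ord0 addr0.
have fE i : face i (bar1 g) = [ffun=> g] by apply/ffunP => -[].
by rewrite !fE /face_coef /= ffunE expr1 scaleN1r -linearD.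
Qed.

Lemma sing_inj k g v : (sing g v : chain G R k) = 0 -> v = 0.
Proof.
move=> e; have : (sing g v : chain G R k) g = (0 : chain G R k) g by rewrite e.
by rewrite /= /sing_fun eqxx.
Qed.

Lemma bar1_eq (g : {ffun 'I_1 -> G}) : g = bar1 (g ord0).
Proof. by apply/ffunP => j; rewrite ffunE (ord1 j). Qed.

Lemma bar2_eq (g : {ffun 'I_2 -> G}) : g = bar2 (g ord0) (g (lift ord0 ord0)).
Proof.
apply/ffunP => j; rewrite ffunE; case: eqP => [-> //|j0].
congr (g _); apply: val_inj; case: j j0 => -[|[|//]] //= ? [].
exact: val_inj.
Qed.

End Chains.

(** * Fox calculus in the bar complex *)

Section TwistHomology.
Variables (n : int) (R : comUnitRingType) (rho : sl2rep (twist_group n) R).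
Local Notation A := (rho (twist_a n)).
Local Notation B := (rho (twist_b n)).
Local Notation cl := (pres_class (relator_lhs n) (relator_rhs n)).
Local Notation D := (relator_fox A B n).
Local Notation s1 g v := (sing (bar1 (g : twist_group n)) v).
Local Notation bd k := (@boundary (twist_group n) R rho k).
Hypothesis A1 : A - 1%:M \in unitmx.

Let dA : \det A = 1 := rep_det rho _.
Let dB : \det B = 1 := rep_det rho _.

Let homol (c d : chain (twist_group n) R 1) := exists u, c - d = bd 2 u.

Let bdD u v : bd 2 (u + v) = bd 2 u + bd 2 v :> chain _ _ 1.
Proof. by have := @boundary_linear _ _ rho 2 1 u v; rewrite !scale1r. Qed.
Let bd0 : bd 2 0 = 0 :> chain _ _ 1.
Proof.
by have := @boundary_linear _ _ rho 2 (-1) 0 0; rewrite scaler0 addr0 scaleN1r addNr.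
Qed.
Let bdN u : bd 2 (- u) = - bd 2 u :> chain _ _ 1.
Proof.
by have := @boundary_linear _ _ rho 2 (-1) u 0; rewrite !scaleN1r addr0 bd0 addr0.
Qed.

Let bd1D c d : bd 1 (c + d) = bd 1 c + bd 1 d :> chain _ _ 0.
Proof. by have := @boundary_linear _ _ rho 1 1 c d; rewrite !scale1r. Qed.

Let homol_refl c : homol c c.
Proof. by exists 0; rewrite subrr bd0. Qed.
Let homol_trans c d e : homol c d -> homol d e -> homol c e.
Proof. by move=> [u cd] [v de]; exists (u + v); rewrite bdD -cd -de addrA subrK. Qed.
Let homolD c d c' d' : homol c d -> homol c' d' -> homol (c + c') (d + d').
Proof. by move=> [u cd] [v cd']; exists (u + v); rewrite bdD -cd -cd' opprD addrACA. Qed.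
Let homolN c d : homol c d -> homol (- c) (- d).
Proof. by move=> [u cd]; exists (- u); rewrite bdN -cd opprB opprK addrC. Qed.
Let homol_sym c d : homol c d -> homol d c.
Proof. by move=> [u cd]; exists (- u); rewrite bdN -cd opprB. Qed.

Let homol_mul g h v : homol (s1 (g * h)%g v) (s1 g v + s1 h (v *m rho g)).
Proof.
exists (- sing (bar2 g h) v); rewrite bdN boundary2_sing.
by rewrite -[LHS]opprB -addrA addrC.
Qed.

Let homol1 v : homol (s1 1%g v) 0.
Proof.
have := homol_mul 1%g 1%g v; rewrite mulg1 rep1 mulmx1 => H.
have := homolD H (homolN (homol_refl (s1 1%g v))).
by rewrite subrr addrK => /homol_sym.
Qed.

Let homolV g v : homol (s1 g^-1%g v) (s1 g (- (v *m rho g^-1%g))).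
Proof.
have := homol_mul g^-1%g g v; rewrite mulVg => H.
have H2 := homol_trans (homol_sym (homol1 v)) H.
have := homolD H2 (homol_refl (s1 g (- (v *m rho g^-1%g)))).
by rewrite add0r -addrA -linearD subrr linear0 addr0 => /homol_sym.
Qed.

(** The boundary of [g|h] makes [gh] with coefficient v homologous to [g] with v plus [h] with v g,
    the rule that Fox derivatives obey. Only the coefficient on b is recorded: for cycles it
    determines the one on a. *)
Lemma homol_word u v : exists w,
  homol (s1 (cl u) v) (s1 (twist_a n) w + s1 (twist_b n) (v *m fox A B u)).
Proof.
elim: u v => [|l u IH] v.
  exists 0; rewrite mulmx0 !linear0 addr0; exact: homol1.
have [w Hw] := IH (v *m letter_mx A B l).
have rl : rho (cl [:: l]) = letter_mx A B l by rewrite rep_class /= mulmx1.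
have H : homol (s1 (cl (l :: u)) v)
   (s1 (cl [:: l]) v + s1 (cl u) (v *m letter_mx A B l)).
  rewrite -[l :: u]cat1s pres_class_cat -rl; exact: homol_mul.
have [w' Hw'] : exists w', homol (s1 (cl [:: l]) v)
    (s1 (twist_a n) w' + s1 (twist_b n) (v *m fox_letter B l)).
  case: l {IH Hw H} rl => -[] [] rl.
  - exists 0; rewrite linear0 add0r /fox_letter /= mulmxN.
    have := homolV (twist_b n) v.
    have -> : (twist_b n)^-1%g = cl [:: (true, true)].
      by rewrite -[LHS]/(pres_invg _) pres_invE.
    by rewrite rl.
  - exists 0; rewrite linear0 add0r /fox_letter /= mulmx1; exact: homol_refl.
  - exists (- (v *m letter_mx A B (false, true))).
    rewrite /fox_letter mulmx0 linear0 addr0.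
    have := homolV (twist_a n) v.
    have -> : (twist_a n)^-1%g = cl [:: (false, true)].
      by rewrite -[LHS]/(pres_invg _) pres_invE.
    by rewrite rl.
  - exists v; rewrite /fox_letter mulmx0 linear0 addr0; exact: homol_refl.
exists (w' + w); apply: homol_trans H _; apply: homol_trans (homolD Hw' Hw) _.
rewrite /= mulmxDr mulmxA !linearD /= addrACA; exact: homol_refl.
Qed.

(* The cycle carried by b, closed up along a. *)
Let zeta v := s1 (twist_b n) v - s1 (twist_a n) (v *m (B - 1%:M) *m invmx (A - 1%:M)).

Let bd_zeta v : bd 1 (zeta v) = 0.
Proof.
have nilE g h : [ffun=> g] = [ffun=> h] :> {ffun 'I_0 -> twist_group n}.
  by apply/ffunP => -[].
have zE : zeta v = s1 (twist_b n) v + s1 (twist_a n) (- (v *m (B - 1%:M) *m invmx (A - 1%:M))).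
  by rewrite linearN.
rewrite zE bd1D !boundary1_sing (nilE (twist_b n) (twist_a n)) -linearD.
have mB v' M : v' *m M - v' = v' *m (M - 1%:M) by rewrite mulmxBr mulmx1.
by rewrite !mB mulNmx mulmxKV // subrr linear0.
Qed.

Let bd_bd u : bd 1 (bd 2 u) = 0.
Proof.
elim/chain_ind: u => [|u v e e'|g v].
- by rewrite bd0; have := bd1D 0 0; rewrite addr0 => /eqP;
    rewrite -subr_eq subrr => /eqP <-.
- by rewrite bdD bd1D e e' addr0.
have [x [h ->]] : exists x h, g = bar2 x h by do 2!eexists; exact: bar2_eq.
rewrite boundary2_sing -linearN !bd1D !boundary1_sing.
have nilE k : [ffun=> k] = [ffun=> x] :> {ffun 'I_0 -> twist_group n}.
  by apply/ffunP => -[].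
rewrite (nilE h) (nilE (x * h)%g) -!linearD rep_mxM !mulNmx mulmxA.
by rewrite (_ : _ + _ = 0) ?linear0 //; apply/matrixP => i j; rewrite !mxE; ring.
Qed.

Let bd1_homol c d : homol c d -> bd 1 c = 0 -> bd 1 d = 0.
Proof.
move=> [u /eqP]; rewrite subr_eq => /eqP -> /eqP.
by rewrite bd1D bd_bd add0r => /eqP.
Qed.

(** The cycle condition is u (A - 1) + v (B - 1) = 0, and A - 1 is invertible, so u is recovered
    from v. *)
Let ab_cycle u v : bd 1 (s1 (twist_a n) u + s1 (twist_b n) v) = 0 ->
  s1 (twist_a n) u + s1 (twist_b n) v = zeta v.
Proof.
rewrite bd1D !boundary1_sing.
have -> : [ffun=> twist_b n] = [ffun=> twist_a n] :> {ffun 'I_0 -> twist_group n}.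
  by apply/ffunP => -[].
rewrite -linearD => /sing_inj e.
have e' : u *m (A - 1%:M) = - (v *m (B - 1%:M)).
  by apply/eqP; rewrite -addr_eq0 !mulmxBr !mulmx1 e.
have -> : u = - (v *m (B - 1%:M) *m invmx (A - 1%:M)).
  by rewrite -mulNmx -e' mulmxK.
by rewrite /zeta linearN addrC.
Qed.

Let cycle_homol c : bd 1 c = 0 -> exists v, homol c (zeta v).
Proof.
move=> c0.
have [u [v H]] : exists u v, homol c (s1 (twist_a n) u + s1 (twist_b n) v).
  elim/chain_ind: c {c0} => [|c d [u [v H]] [u' [v' H']]|g v].
  - by exists 0, 0; rewrite !linear0 addr0; exact: homol_refl.
  - exists (u + u'), (v + v'); rewrite !linearD addrACA; exact: homolD.
  - rewrite [g]bar1_eq -[g ord0]pres_class_repr.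
    have [w H] := homol_word (repr (g ord0)) v.
    by exists w, (v *m fox A B (repr (g ord0))).
by exists v; apply: (homol_trans H); rewrite -(ab_cycle (bd1_homol H c0)); exact: homol_refl.
Qed.

Let zeta_linear : linear zeta.
Proof.
move=> k u v; rewrite /zeta !mulmxDl -!scalemxAl !sing_linear scalerBr opprD.
by rewrite addrACA.
Qed.

(** A left inverse of [zeta] modulo the rows of D: the bar g with coefficient v goes to v times the
    Fox derivative of the word chosen by [repr]. Modulo D the choice is immaterial. *)
Let psi (c : chain (twist_group n) R 1) : 'rV[R]_2 :=
  \sum_(g \in [set: {ffun 'I_1 -> twist_group n}]) c g *m fox A B (repr (g ord0)).

Let psi_seq (c : chain (twist_group n) R 1) (s : seq {ffun 'I_1 -> twist_group n}) : uniq s ->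
  (forall g, g \notin s -> c g = 0) ->
  psi c = \sum_(g <- s) c g *m fox A B (repr (g ord0)).
Proof.
move=> us cs; rewrite /psi -(fsbig_widen [set` s]%classic) //.
  by rewrite -fsbig_seq.
by move=> g /= [_ /negP gs]; rewrite cs ?mul0mx.
Qed.

Let psi_linear : linear psi.
Proof.
move=> k c d.
have /finite_seqP [s sE] := chain_finite c; have /finite_seqP [t tE] := chain_finite d.
have cs g : g \notin undup (s ++ t) -> c g = 0.
  rewrite mem_undup mem_cat negb_or => /andP [gs _]; apply: contrapT => cg.
  have : [set g | c g <> 0]%classic g by [].
  by rewrite sE /=; apply/negP.
have dt g : g \notin undup (s ++ t) -> d g = 0.
  rewrite mem_undup mem_cat negb_or => /andP [_ gt]; apply: contrapT => dg.
  have : [set g | d g <> 0]%classic g by [].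
  by rewrite tE /=; apply/negP.
have us := undup_uniq (s ++ t).
rewrite !(psi_seq us) // => [|g gn]; last first.
  by change (k *: c g + d g = 0); rewrite cs // dt // scaler0 addr0.
rewrite scaler_sumr -big_split; apply: eq_bigr => g _ /=.
by rewrite scalemxAl -mulmxDl.
Qed.

Let psi_sing g v : psi (s1 g v) = v *m fox A B (repr g).
Proof.
rewrite (@psi_seq _ [:: bar1 g]) // ?big_seq1 /= /sing_fun ?eqxx ?ffunE //.
by move=> h; rewrite inE => /negPf hg; rewrite hg.
Qed.

Let psiD c d : psi (c + d) = psi c + psi d.
Proof. by have := psi_linear 1 c d; rewrite !scale1r. Qed.
Let psiN c : psi (- c) = - psi c.
Proof.
have psi0 : psi 0 = 0 by have := psi_linear (-1) 0 0; rewrite scaler0 addr0 scaleN1r addNr.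
by have := psi_linear (-1) c 0; rewrite !scaleN1r addr0 psi0 addr0.
Qed.

(** The word chosen for a product and the concatenation of the chosen words are equal in the group,
    so their derivatives differ by a multiple of D; the product rule cancels the rest. *)
Let psi_bd u : exists w, psi (bd 2 u) = w *m D.
Proof.
elim/chain_ind: u => [|u v [w e] [w' e']|g v].
- by exists 0; rewrite bd0 mul0mx; have := psiD 0 0; rewrite addr0 => /eqP;
    rewrite -subr_eq subrr => /eqP <-.
- by exists (w + w'); rewrite bdD psiD e e' mulmxDl.
have [x [h ->]] : exists x h, g = bar2 x h by do 2!eexists; exact: bar2_eq.
rewrite boundary2_sing !psiD psiN !psi_sing.
have gh : pres_eq (relator_lhs n) (relator_rhs n) (repr (x * h)%g) (repr x ++ repr h).
  by apply/pres_classP; rewrite pres_class_repr.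
have [X] := fox_pres_eq dA dB (rep_relation rho) gh.
rewrite fox_cat -rep_class pres_class_repr => /eqP; rewrite subr_eq => /eqP ->.
exists (- (v *m X)); rewrite mulNmx !mulmxDr -!mulmxA.
by apply/matrixP => i j; rewrite !mxE; ring.
Qed.

(** Both sides of the relation are words for one element. Expanding it along each and subtracting
    leaves a null-homologous chain with coefficient v D on b, which [ab_cycle] identifies. *)
Let zeta_relator v : homol (zeta (v *m D)) 0.
Proof.
have [u Hu] := homol_word (relator_lhs n) v.
have [w Hw] := homol_word (relator_rhs n) v.
have e : cl (relator_lhs n) = cl (relator_rhs n) by apply/pres_classP/pres_rel.
have := homolD (homol_sym Hu) (homolN (homol_sym Hw)); rewrite e subrr.
rewrite opprD addrACA -[s1 (twist_a n) u - _]linearB.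
rewrite -[s1 (twist_b n) _ - _]linearB -mulmxBr => H.
have H0 : bd 1 (s1 (twist_a n) (u - w) + s1 (twist_b n) (v *m D)) = 0.
  apply: bd1_homol (homol_sym H) _.
  by have := bd1D 0 0; rewrite addr0 => /eqP; rewrite -subr_eq subrr => /eqP <-.
by rewrite -(ab_cycle H0).
Qed.

Let zeta_cycle v : kernel_pred (bd 1) (zeta v).
Proof. by apply/eqP; exact: bd_zeta. Qed.

Let hclass (z : kernel (bd 1)) : homology rho 1 :=
  quotmod_class (image_submod_closed (bd 2) (bd 1)) z.

Let hclassD y z : hclass (y + z) = hclass y + hclass z.
Proof. exact: quotmod_classD. Qed.

Let hclassZ k z : hclass (k *: z) = k *: hclass z.
Proof. by rewrite -[RHS]/(quotmod_scale _ _) quotmod_scaleE. Qed.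

Let hclass0 : hclass 0 = 0.
Proof. by rewrite -[X in hclass X](scale0r 0) hclassZ scale0r. Qed.

Let hclass_eq y z : hclass y = hclass z <-> homol (val y) (val z).
Proof.
rewrite /hclass quotmod_classP; split=> [/asboolP [u e]|[u e]]; first by exists u.
by apply/asboolP; exists u.
Qed.

(** [zeta] supplies the generators and [zeta_relator] the relations. There are no others: if zeta(c)
    bounds, then applying [psi] puts c in the row space of D. *)
Lemma homology1_presentation :
  exists m : 'I_2 -> homology rho 1, presentation D m.
Proof.
exists (fun j => hclass (Kernel (zeta_cycle (delta_mx 0 j)))).
pose zk v := hclass (Kernel (zeta_cycle v)).
have zkP k u v : zk (k *: u + v) = k *: zk u + zk v.
  rewrite /zk -hclassZ -hclassD; congr hclass; apply: val_inj.
  exact: zeta_linear.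
have zk0 : zk 0 = 0.
  by have := zkP (-1) 0 0; rewrite scaler0 addr0 scaleN1r addNr.
have sumE (c : 'rV[R]_2) : \sum_j c 0 j *: zk (delta_mx 0 j) = zk c.
  rewrite [in RHS](row_sum_delta c).
  elim/big_rec2: _ => [//|j u v _ ->]; exact/esym/zkP.
split=> [x|c].
  have := quotmod_class_repr x; case: (repr x) => z zc <-.
  have [v Hv] := cycle_homol (eqP zc); exists v; rewrite sumE.
  exact/hclass_eq.
rewrite sumE -hclass0 /zk hclass_eq; split=> [[u e]|[d ->]]; last exact: zeta_relator.
have := psi_bd u; rewrite -e subr0 => -[w]; rewrite /= /zeta psiD psiN !psi_sing.
(* The words chosen for a and b need not be the letters themselves; [X] and [Y] measure the
   discrepancy and enter the final witness. *)
have [X] := fox_pres_eq dA dB (rep_relation rho) (pres_eq_repr n (wgen true)).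
have [Y] := fox_pres_eq dA dB (rep_relation rho) (pres_eq_repr n (wgen false)).
rewrite -/(twist_a n) -/(twist_b n) /= /fox_letter /= !mulmx0 !addr0 subr0 => ->.
move=> /eqP; rewrite subr_eq => /eqP ->; rewrite mulmxDr mulmx1 !mulmxA => H.
exists (w - c *m X + c *m (B - 1%:M) *m invmx (A - 1%:M) *m Y).
by rewrite mulmxDl mulmxBl -H; apply/matrixP => i j; rewrite !mxE; ring.
Qed.

End TwistHomology.

(** * Fitting ideals of square presentations *)

Section FittingIdeal.
Variable R : comNzRingType.

Lemma minors_ideal0 l r (A : 'M[R]_(l, r)) : minors_ideal A 0.
Proof. by exists (fun=> 0); rewrite big1 // => s _; rewrite mul0r. Qed.

Lemma minors_idealD l r (A : 'M[R]_(l, r)) x y :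
  minors_ideal A x -> minors_ideal A y -> minors_ideal A (x + y).
Proof.
move=> [b ->] [c ->]; exists (fun s => b s + c s).
by rewrite -big_split; apply: eq_bigr => s _; rewrite mulrDl.
Qed.

Lemma minors_idealM l r (A : 'M[R]_(l, r)) a x :
  minors_ideal A x -> minors_ideal A (a * x).
Proof.
move=> [b ->]; exists (fun s => a * b s).
by rewrite mulr_sumr; apply: eq_bigr => s _; rewrite mulrA.
Qed.

Lemma minors_ideal_sum l r (A : 'M[R]_(l, r)) (I : finType) (x : I -> R) :
  (forall i, minors_ideal A (x i)) -> minors_ideal A (\sum_i x i).
Proof.
move=> xA; elim/big_ind: _ => //; [exact: minors_ideal0 | exact: minors_idealD].
Qed.

(** Cauchy-Binet, summed over all maps instead of the increasing ones, in accordance with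
    [minors_ideal]. *)
Lemma det_mulmx_minors l r (Q : 'M[R]_(r, l)) (A : 'M[R]_(l, r)) :
  minors_ideal A (\det (Q *m A)).
Proof.
exists (fun f => \prod_i Q i (f i)); rewrite /determinant.
transitivity (\sum_(s : 'S_r) \sum_(f : {ffun 'I_r -> 'I_l})
    (-1) ^+ s * \prod_i (Q i (f i) * A (f i) (s i))).
  apply: eq_bigr => s _; rewrite -mulr_sumr; congr (_ * _).
  by rewrite -(bigA_distr_bigA (fun i k => Q i k * A k (s i))); apply: eq_bigr => i _; rewrite mxE.
rewrite exchange_big; apply: eq_bigr => f _ /=; rewrite mulr_sumr.
apply: eq_bigr => s _; rewrite big_split /= mulrCA; congr (_ * (_ * _)).
by apply: eq_bigr => i _; rewrite mxE.
Qed.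

(** Laplace expansion along the first k columns reduces this to [det_mulmx_minors]. *)
Lemma det_row_mx_minors l r k (P : 'M[R]_(k + r, k)) (Q : 'M[R]_(k + r, l))
  (A : 'M[R]_(l, r)) : minors_ideal A (\det (row_mx P (Q *m A))).
Proof.
elim: k P Q => [|k IH] P Q.
  have -> : row_mx P (Q *m A) = Q *m A; last exact: det_mulmx_minors.
  apply/matrixP => i j; rewrite [LHS]mxE; case: splitP => [[]//|j' ej].
  by congr (_ _ _); exact/esym/val_inj.
rewrite (expand_det_col _ (lshift r ord0)); apply: minors_ideal_sum => i.
apply: minors_idealM; rewrite /cofactor; apply: minors_idealM.
rewrite col'Kl row'_row_mx !row'Esub -mul_rowsub_mx; exact: IH.
Qed.

Local Notation comb m c := (\sum_j c 0 j *: m j).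

(** X and Y express each set of generators in the other. Relations among m become relations among m'
    through Y, whence [C], and the rows of 1 - XY are relations among m', whence [E]. *)
Lemma fitting_sub (M : lmodType R) l r l2 r2 (A : 'M[R]_(l, r)) (A' : 'M[R]_(l2, r2))
    (m : 'I_r -> M) (m' : 'I_r2 -> M) x :
  presentation A m -> presentation A' m' -> minors_ideal A x -> minors_ideal A' x.
Proof.
move=> [gen rel] [gen' rel2] [b ->]; apply: minors_ideal_sum => s.
apply: minors_idealM; set As := rowsub s A.
have [X0 X0P] := choice (fun i => gen (m' i)); pose X := \matrix_i X0 i.
have [Y0 Y0P] := choice (fun i => gen' (m i)); pose Y := \matrix_i Y0 i.
have XE (c : 'rV[R]_r2) : comb m' c = comb m (c *m X).
  under eq_bigr => i _ do rewrite X0P scaler_sumr.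
  rewrite exchange_big; apply: eq_bigr => j _ /=; rewrite mxE scaler_suml.
  by apply: eq_bigr => i _; rewrite scalerA mxE.
have YE (c : 'rV[R]_r) : comb m c = comb m' (c *m Y).
  under eq_bigr => i _ do rewrite Y0P scaler_sumr.
  rewrite exchange_big; apply: eq_bigr => j _ /=; rewrite mxE scaler_suml.
  by apply: eq_bigr => i _; rewrite scalerA mxE.
have [C CE] : exists C, As *m Y = C *m A'.
  have /choice [C0 C0P] i : exists d : 'rV_l2, row i (As *m Y) = d *m A'.
    apply/rel2; rewrite row_mul -YE; apply/rel; exists (delta_mx 0 (s i)).
    by rewrite -rowE; apply/rowP => j; rewrite !mxE.
  exists (\matrix_i C0 i); apply/row_matrixP => i.
  by rewrite C0P row_mul rowK.
have [E EE] : exists E, 1%:M - X *m Y = E *m A'.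
  have /choice [E0 E0P] i : exists d : 'rV_l2, row i (1%:M - X *m Y) = d *m A'.
    apply/rel2; rewrite raddfB /= row_mul.
    transitivity (comb m' (row i 1%:M) - comb m' (row i X *m Y)).
      by rewrite -sumrB; apply: eq_bigr => j _; rewrite -scalerBl; congr (_ *: _);
        rewrite [LHS]mxE; congr (_ + _); rewrite [LHS]mxE.
    rewrite -YE rowK -X0P (bigD1 i) //= !mxE eqxx scale1r big1 ?addr0 ?subrr //.
    by move=> j /negPf ji; rewrite !mxE eq_sym ji scale0r.
  exists (\matrix_i E0 i); apply/row_matrixP => i.
  by rewrite E0P row_mul rowK.
(* The bordered matrix has the chosen minor as its determinant, since the factor containing Y is
   unipotent, and its last columns are a multiple of A'. *)
have := det_row_mx_minors (col_mx As (- X)) (col_mx C E) A'.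
have -> : row_mx (col_mx As (- X)) (col_mx C E *m A') =
    block_mx As 0 (- X) 1%:M *m block_mx 1%:M Y 0 1%:M.
  rewrite mulmx_block !mulmx1 !mulmx0 !addr0 mul_col_mx -CE -EE.
  by rewrite block_mxEh addrC mulNmx.
by rewrite det_mulmx det_lblock det_ublock !det1 !mulr1.
Qed.

Lemma fitting_ideal_unique (M : lmodType R) (I J : set R) :
  is_fitting_ideal M I -> is_fitting_ideal M J -> I = J.
Proof.
move=> [l [r [A [m [P ->]]]]] [l2 [r2 [A' [m' [P' ->]]]]].
by apply/seteqP; split=> x; apply: fitting_sub; eassumption.
Qed.

Lemma divisorial_hull_principal (d : R) :
  divisorial_hull (principal_ideal d) = principal_ideal d.
Proof.
apply/seteqP; split=> x; first by apply; exact: (@subset_refl _ (principal_ideal d)).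
move=> [s ->] c sub; apply: sub; by exists s.
Qed.

Lemma minors_ideal_square r (D : 'M[R]_r) :
  minors_ideal D = principal_ideal (\det D).
Proof.
apply/seteqP; split=> x [b ->].
  exists (\sum_s b s * \det (rowsub s (1%:M : 'M[R]_r))).
  rewrite mulr_suml; apply: eq_bigr => s _.
  by rewrite -mulrA -det_mulmx mul_rowsub_mx mul1mx.
exists (fun s => if s == [ffun i => i] then b else 0).
rewrite (bigD1 [ffun i => i]) //= eqxx big1 ?addr0 => [|s /negPf ->]; last by rewrite mul0r.
by congr (_ * \det _); apply/matrixP => i j; rewrite mxE ffunE.
Qed.

(** The Fitting ideal does not depend on the presentation, and a principal ideal is its own
    divisorial hull. *)
Lemma is_order_square (M : lmodType R) r (D : 'M[R]_r) (m : 'I_r -> M) d :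
  presentation D m ->
  (is_order M d <-> principal_ideal (\det D) = principal_ideal d).
Proof.
move=> P; have FD : is_fitting_ideal M (principal_ideal (\det D)).
  by exists r, r, D, m; split=> //; rewrite minors_ideal_square.
split=> [[I FI]|e].
  by rewrite (fitting_ideal_unique FI FD) divisorial_hull_principal.
by exists (principal_ideal (\det D)); rewrite // divisorial_hull_principal.
Qed.

(** By Cramer's rule the determinant annihilates the module. *)
Lemma torsion_square (M : lmodType R) r (D : 'M[R]_r) (m : 'I_r -> M) :
  presentation D m -> \det D != 0 -> torsion_module M.
Proof.
move=> [gen rel] dD x; exists (\det D) => //; have [c ->] := gen x.
transitivity (comb m (\det D *: c)).
  by rewrite scaler_sumr; apply: eq_bigr => j _; rewrite mxE scalerA.
apply/rel; exists (c *m \adj D).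
by rewrite -mulmxA mul_adj_mx mul_mx_scalar.
Qed.

End FittingIdeal.

(** * Power series over a complete discrete valuation ring *)

Section SeriesCoefficients.
Variable R : comNzRingType.
Implicit Types f g : series R.

Lemma scoefD f g i : scoef (f + g) i = scoef f i + scoef g i.
Proof. by []. Qed.
Lemma scoefN f i : scoef (- f) i = - scoef f i.
Proof. by []. Qed.
Lemma scoefB f g i : scoef (f - g) i = scoef f i - scoef g i.
Proof. by []. Qed.
Lemma scoefM f g i : scoef (f * g) i = \sum_(j < i.+1) scoef f j * scoef g (i - j)%N.
Proof. by []. Qed.
Lemma scoefZ a f i : scoef (a *: f) i = a * scoef f i.
Proof. by []. Qed.
Lemma scoefC a i : scoef (a%:A : series R) i = a * (i == 0%N)%:R.
Proof. by []. Qed.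
Lemma scoef_sum (I : Type) (r : seq I) (P : pred I) (F : I -> series R) i :
  scoef (\sum_(j <- r | P j) F j) i = \sum_(j <- r | P j) scoef (F j) i.
Proof. by elim/big_rec2: _ => // j u v _ <-. Qed.

Lemma scoefTM0 f : scoef (series_T R * f) 0 = 0.
Proof. by rewrite scoefM big_ord1 mul0r. Qed.

Lemma scoefTMS f i : scoef (series_T R * f) i.+1 = scoef f i.
Proof.
rewrite scoefM !big_ord_recl /= mul0r add0r mul1r subSS subn0 big1 ?addr0 //.
by move=> j _; rewrite mul0r.
Qed.

Definition sshift f : series R := Series (fun i => scoef f i.+1).

Lemma series_shift f : f = (scoef f 0)%:A + series_T R * sshift f.
Proof.
apply: seriesP => -[|i]; rewrite scoefD scoefC ?scoefTM0 ?scoefTMS /=.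
  by rewrite mulr1 addr0.
by rewrite mulr0 add0r.
Qed.

Lemma scoefX_small f k i : scoef f 0 = 0 -> (i < k)%N -> scoef (f ^+ k) i = 0.
Proof.
move=> f0; elim: k i => // k IH i; rewrite ltnS => ik.
rewrite exprS scoefM big_ord_recl f0 mul0r add0r big1 // => j _.
rewrite IH ?mulr0 //= /bump /= add1n.
by have := ltn_ord j; lia.
Qed.

End SeriesCoefficients.

Lemma series_unitE (R : comUnitRingType) (f : series R) :
  (f \is a GRing.unit) = (scoef f 0 \is a GRing.unit).
Proof.
apply/idP/idP => [|f0]; first exact: (rmorph_unit (@scoef0 R)).
set c := scoef f 0 in f0.
suff H (g : series R) : scoef g 0 = 1 -> g \is a GRing.unit.
  have : c^-1 *: f \is a GRing.unit by apply: H; rewrite scoefZ mulVr.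
  rewrite -[_ *: f]mulr_algl unitrM => /andP [] //.
move=> g0; set h := 1 - g; have h0 : scoef h 0 = 0 by rewrite scoefB g0 subrr.
(* The inverse of 1 - h as a geometric series: h^k starts in degree k, so m + 1 terms give the
   coefficient of index m. *)
pose q := Series (fun m => scoef (\sum_(k < m.+1) h ^+ k) m).
have qE m N : (m < N)%N -> scoef q m = scoef (\sum_(k < N) h ^+ k) m.
  move=> mN; rewrite /= !scoef_sum (big_ord_widen _ (fun k => scoef (h ^+ k) m) mN).
  rewrite big_mkcond /=; apply: eq_bigr => k _; case: ltnP => // mk.
  by rewrite scoefX_small.
apply: (@series_unitP _ _ q); apply: seriesP => m.
transitivity (scoef ((\sum_(k < m.+1) h ^+ k) * g) m).
  rewrite !scoefM; apply: eq_bigr => j _; rewrite (qE _ m.+1) //.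
have -> : g = - (h - 1) by rewrite /h; ring.
rewrite mulrN mulrC -subrX1 opprB scoefB scoefX_small ?subr0 //.
Qed.

(** The lowest nonzero coefficient of f forces the coefficients of g to vanish one after another. *)
Lemma series_mul_eq0 (R : idomainType) (f g : series R) :
  f * g = 0 -> f != 0 -> g = 0.
Proof.
move=> fg0 /eqP f0.
have [i fi] : exists i, scoef f i != 0.
  apply: contrapT => H; apply: f0; apply: seriesP => i.
  by apply/eqP; apply: contrapT => /negP fi; apply: H; exists i.
have exi : exists i, scoef f i != 0 by exists i.
case: (ex_minnP exi) => {i fi exi} d fd dmin.
apply: seriesP; elim/ltn_ind => i IH.
have : scoef (f * g) (d + i) = 0 by rewrite fg0.
rewrite scoefM.
rewrite (bigD1 (inord d : 'I_(d + i).+1)) //= inordK ?ltnS ?leq_addr //.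
rewrite big1 ?addr0 => [/eqP|j].
  by rewrite mulf_eq0 (negPf fd) /= addKn => /eqP ->.
move=> jd; have [jld|jgd|je] := ltngtP j d.
- by have [->|/dmin] := eqVneq (scoef f j) 0; [rewrite mul0r | rewrite leqNgt jld].
- rewrite IH ?mulr0 //.
  by have := ltn_ord j; lia.
- case/eqP: jd; apply: val_inj; rewrite /= inordK ?je //.
  by rewrite ltnS leq_addr.
Qed.

Section DiscreteValuation.
Variables (O : idomainType) (F : fieldType) (res : {rmorphism O -> F}).
Hypothesis hO : is_cdvr0 res.
Local Notation I := [set r | res r = 0]%classic.

Lemma cdvr_unitE r : (r \is a GRing.unit) = (res r != 0).
Proof. by have [_ _ []] := hO. Qed.

Lemma cdvr_uniformizer : exists w : O, [/\ w != 0, res w = 0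
  & forall r, r != 0 -> exists u k, u \is a GRing.unit /\ r = u * w ^+ k].
Proof.
have [_ [w [w0 wU wP]] _] := hO; exists w; split=> //.
by apply/eqP; rewrite -[_ == _]negbK -cdvr_unitE.
Qed.

Lemma cdvr_char0 k : (0 < k)%N -> (k%:R : O) != 0.
Proof.
move=> k0; have [ch _ _] := hO; apply/negP => kO.
have [p _ pO] : exists2 p, true & p \in [pchar O].
  elim/ltn_ind: k k0 kO => k IH k0 kO.
  have k1 : (1 < k)%N by case: k k0 kO {IH} => [|[|k]] // _; rewrite oner_eq0.
  have [d dE] := dvdnP (pdiv_dvd k).
  move: kO; rewrite dE natrM mulf_eq0 => /orP [d0|p0]; last first.
    by exists (pdiv k) => //; rewrite inE pdiv_prime.
  have dpos : (0 < d)%N by move: k0; rewrite dE muln_gt0 => /andP [].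
  apply: IH d0 => //; rewrite dE ltn_Pmulr //.
  by rewrite prime_gt1 // pdiv_prime.
by rewrite ch in pO.
Qed.

Variable w : O.
Hypotheses (w0 : w != 0) (resw : res w = 0).
Hypothesis wP : forall r, r != 0 -> exists u k, u \is a GRing.unit /\ r = u * w ^+ k.

Lemma cdvr_dvd r : res r = 0 -> exists c, r = c * w.
Proof.
move=> r0; have [->|/wP [u [[|k] [uU e]]]] := eqVneq r 0.
- by exists 0; rewrite mul0r.
- by move: uU; rewrite cdvr_unitE -[u]mulr1 -(expr0 w) -e r0 eqxx.
- by exists (u * w ^+ k); rewrite e exprSr mulrA.
Qed.

Lemma ideal_pow_unif k r : ideal_pow I k r <-> exists c, r = c * w ^+ k.
Proof. exact: ideal_pow_principal resw cdvr_dvd k r. Qed.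

Lemma cdvr_separated r : (forall k, exists c, r = c * w ^+ k) -> r = 0.
Proof.
by have [_ _ [_ _ [sep _]]] := hO; move=> H; apply: sep => k; exact/ideal_pow_unif.
Qed.

Lemma cdvr_complete (u : nat -> O) :
  (forall k, exists c, u k.+1 - u k = c * w ^+ k) ->
  exists l, forall k, exists c, u k - l = c * w ^+ k.
Proof.
have [_ _ [_ _ [_ cpl]]] := hO; move=> H.
have [|l lP] := cpl u; first by move=> k; exact/ideal_pow_unif.
by exists l => k; apply/ideal_pow_unif.
Qed.

Local Notation resS := (res \o @scoef0 O).
Local Notation IS := [set f : series O | resS f = 0]%classic.

(** The maximal ideal is (w, T), so its k-th power is generated by the w^(k-i) T^i; the truncated
    difference leaves the coefficients of index at least k free. *)
Lemma series_ideal_pow k (f : series O) :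
  ideal_pow IS k f <-> forall i, exists c, scoef f i = c * w ^+ (k - i).
Proof.
split=> [[m [c [x [xI ->]]]]|]; last first.
  elim: k f => [|k IH] f fw; first exact: ideal_pow0.
  rewrite [f]series_shift; apply: ideal_powD.
    have [c ->] := fw 0%N; rewrite subn0.
    have -> : (c * w ^+ k.+1)%:A = c%:A * w%:A ^+ k.+1 :> series O.
      by rewrite -(rmorphXn (in_alg (series O))) -(rmorphM (in_alg (series O))).
    apply/ideal_powMl/ideal_powX; change (res (scoef (w%:A : series O) 0) = 0).
    by rewrite scoefC mulr1.
  apply: ideal_powS; first by change (res 0 = 0); rewrite rmorph0.
  by apply: IH => i; have [d e] := fw i.+1; exists d; rewrite /= e subSS.
have dvM j (a : O) i : (i <= j)%N -> (exists d, a = d * w ^+ j) -> exists d, a = d * w ^+ i.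
  by move=> /subnK <- [d ->]; exists (d * w ^+ (j - i)); rewrite exprD mulrA.
have dvD j (a b : O) : (exists d, a = d * w ^+ j) -> (exists d, b = d * w ^+ j) ->
    exists d, a + b = d * w ^+ j.
  by move=> [d ->] [e ->]; exists (d + e); rewrite mulrDl.
have dv0 j : exists d, 0 = d * w ^+ j by exists 0; rewrite mul0r.
have prodP (y : 'I_k -> series O) : (forall j, IS (y j)) ->
    forall i, exists c, scoef (\prod_j y j) i = c * w ^+ (k - i).
  elim: k y {x xI} => [|k IH] y yI i.
    by rewrite sub0n; exists (scoef (\prod_j y j) i); rewrite mulr1.
  rewrite big_ord_recl scoefM; elim/big_ind: _ => [|a b|[j ji] _ /=]; [exact: dv0|exact: dvD|].
  have [b e] := IH (fun j => y (lift ord0 j)) (fun j => yI _) (i - j)%N; rewrite e.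
  case: j ji e => [|j] ji e; first last.
    by apply: (dvM (k - (i - j.+1))%N); [lia | exists (scoef (y ord0) j.+1 * b); rewrite mulrA].
  have [d y0d] := cdvr_dvd (yI ord0); have -> : scoef (y ord0) 0 = d * w := y0d.
  apply: (dvM (k - (i - 0)).+1%N); first by lia.
  by exists (d * b); rewrite exprS; ring.
move=> i; rewrite scoef_sum; apply: (big_ind (fun a => exists d, a = d * w ^+ (k - i))) => [|a b|j _]; [exact: dv0|exact: dvD|].
rewrite scoefM; apply: (big_ind (fun a => exists d, a = d * w ^+ (k - i))) => [|a b|[a ai] _ /=]; [exact: dv0|exact: dvD|].
have [d ->] := prodP (x j) (xI j) (i - a)%N.
apply: (dvM (k - (i - a))%N); first by lia.
by exists (scoef (c j) a * d); rewrite mulrA.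
Qed.

Lemma series_complete_local : is_complete_local resS.
Proof.
have [_ _ [sur _ _]] := hO; split=> [x|f|].
- have [r <-] := sur x; exists r%:A.
  by change (res (scoef (r%:A : series O) 0) = res r); rewrite scoefC mulr1.
- by rewrite series_unitE cdvr_unitE.
split=> [f fI|u uI].
  apply: seriesP => i; apply: cdvr_separated => k.
  have /series_ideal_pow fk := fI (k + i)%N.
  by have [c] := fk i; rewrite addnK; exists c.
(* A difference in the power k + i of the ideal has its coefficient i divisible by w^k, hence the
   shift of the sequence by i. *)
have ex i : exists l, forall k, exists c, scoef (u (k + i)%N) i - l = c * w ^+ k.
  apply: (cdvr_complete (u := fun k => scoef (u (k + i)%N) i)) => k.
  have /series_ideal_pow uk := uI (k + i)%N.
  by have [c] := uk i; rewrite addnK addSn => e; exists c; rewrite -e scoefB.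
have [l lP] := choice ex; exists (Series l) => k; apply/series_ideal_pow => i.
rewrite scoefB /=; have [ki|/ltnW ik] := leqP k i.
  by exists (scoef (u k) i - l i); rewrite (eqP ki) mulr1.
by have [c] := lP i (k - i)%N; rewrite subnK // => ->; exists c.
Qed.

End DiscreteValuation.

(** * Evaluation of power series at an element of the maximal ideal *)

Section SeriesEvaluation.
Variables (O : comUnitRingType) (F : fieldType) (R : comUnitAlgType O).
Variables (res : {rmorphism R -> F}) (tau : R).
Hypotheses (Rcl : is_complete_local res) (res_tau : res tau = 0).
Local Notation I := [set r | res r = 0]%classic.

Let ev k (f : series O) : R := \sum_(i < k) scoef f i *: tau ^+ i.

Let evS k f : ev k.+1 f = (scoef f 0)%:A + tau * ev k (sshift f).
Proof.
rewrite /ev big_ord_recl expr0; congr (_ + _); rewrite mulr_sumr.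
by apply: eq_bigr => i _; rewrite -scalerAr -exprS.
Qed.

Let ideal_powZ k a r : ideal_pow I k r -> ideal_pow I k (a *: r).
Proof. by rewrite -mulr_algl; exact: ideal_powMl. Qed.

Let ev_cauchy f k : ideal_pow I k (ev k.+1 f - ev k f).
Proof.
rewrite /ev big_ord_recr /= addrAC subrr add0r; apply: ideal_powZ.
exact: ideal_powX.
Qed.

Let ev_limit f : exists l, forall k, ideal_pow I k (ev k f - l).
Proof. by have [_ _ [_ cpl]] := Rcl; apply: cpl => k; exact: ev_cauchy. Qed.

Definition series_eval (f : series O) : R := projT1 (cid (ev_limit f)).

Let evP f k : ideal_pow I k (ev k f - series_eval f).
Proof. by rewrite /series_eval; case: cid => l /=. Qed.

Let sep a b : (forall k, ideal_pow I k (a - b)) -> a = b.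
Proof.
have [_ _ [s _]] := Rcl => H; apply/eqP; rewrite -subr_eq0; apply/eqP.
exact: s.
Qed.

Lemma series_eval_linear : linear series_eval.
Proof.
move=> a f g; apply: sep => k.
have evL : ev k (a *: f + g) = a *: ev k f + ev k g.
  rewrite /ev scaler_sumr -big_split; apply: eq_bigr => i _ /=.
  by rewrite scalerDl scalerA.
have -> : series_eval (a *: f + g) - (a *: series_eval f + series_eval g) =
  - (ev k (a *: f + g) - series_eval (a *: f + g))
  + (a *: (ev k f - series_eval f) + (ev k g - series_eval g)).
  rewrite evL scalerBr -(mulr_algl a (ev k f)) -(mulr_algl a (series_eval f)).
  by ring.
apply: ideal_powD; first exact: ideal_powN.
by apply: ideal_powD => //; exact: ideal_powZ.
Qed.

Lemma sshiftM (f g : series O) : sshift (f * g) = scoef f 0 *: sshift g + sshift f * g.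
Proof.
apply: seriesP => i; rewrite scoefD scoefZ [LHS]/= big_ord_recl subn0.
by congr (_ + _); apply: eq_bigr => j _; rewrite /= subSS.
Qed.

(** Truncated evaluation is multiplicative only modulo the k-th power; the induction peels off the
    constant term of f. *)
Let evM k f g : ideal_pow I k (ev k (f * g) - ev k f * ev k g).
Proof.
elim: k f => [|k IH] f; first exact: ideal_pow0.
have evL h a h' : ev k (a *: h + h') = a *: ev k h + ev k h'.
  rewrite /ev scaler_sumr -big_split; apply: eq_bigr => i _ /=.
  by rewrite scalerDl scalerA.
rewrite evS sshiftM evL (evS k f).
have -> : scoef (f * g) 0 = scoef f 0 * scoef g 0 by rewrite scoefM big_ord1.
have -> : (scoef f 0 * scoef g 0)%:A + tau * (scoef f 0 *: ev k (sshift g) + ev k (sshift f * g))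
   - ((scoef f 0)%:A + tau * ev k (sshift f)) * ev k.+1 g =
   tau * (ev k (sshift f * g) - ev k (sshift f) * ev k g
     - ev k (sshift f) * (ev k.+1 g - ev k g)).
  rewrite mulrDl {1}[ev k.+1 g]evS.
  rewrite -scalerA -(mulr_algl (scoef f 0) _%:A).
  by rewrite -(mulr_algl (scoef f 0) (ev k _)); ring.
apply: ideal_powS => //; apply: ideal_powB; first exact: IH.
by apply: ideal_powMl; exact: ev_cauchy.
Qed.

Lemma series_eval_monoid : monoid_morphism series_eval.
Proof.
split=> [|f g]; apply: sep => k; apply: (ideal_pow_le (leqnSn k)).
  have <- : ev k.+1 1 = 1.
    rewrite evS scale1r /ev big1 ?mulr0 ?addr0 // => i _.
    by rewrite /= scale0r.
  by rewrite -opprB; exact/ideal_powN.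
set E := series_eval; have -> : E (f * g) - E f * E g =
  - (ev k.+1 (f * g) - E (f * g)) + (ev k.+1 (f * g) - ev k.+1 f * ev k.+1 g)
  + ev k.+1 f * (ev k.+1 g - E g) + E g * (ev k.+1 f - E f) by ring.
apply: ideal_powD; last exact: ideal_powMl.
apply: ideal_powD; last exact: ideal_powMl.
by apply: ideal_powD => //; exact: ideal_powN.
Qed.

HB.instance Definition _ := GRing.isLinear.Build O (series O) R _ series_eval
  series_eval_linear.
HB.instance Definition _ := GRing.isMonoidMorphism.Build (series O) R series_eval
  series_eval_monoid.

(** Uniqueness concerns arbitrary algebra morphisms, but continuity is automatic: peeling off k
    coefficients writes a value as its truncated sum plus tau^k times another value. *)
Lemma series_evaluation : exists psi : {lrmorphism series O -> R},
  [/\ psi (series_T O) = tau, forall f, res (psi f) = res (scoef0 f)%:A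
    & forall psi' : {lrmorphism series O -> R}, psi' (series_T O) = tau -> psi' =1 psi].
Proof.
have uniq (phi : {lrmorphism series O -> R}) : phi (series_T O) = tau ->
    forall k f, ideal_pow I k (phi f - ev k f).
  move=> phiT; elim=> [|k IH] f; first exact: ideal_pow0.
  have -> : phi f = (scoef f 0)%:A + tau * phi (sshift f).
    by rewrite {1}[f]series_shift rmorphD rmorphM /= -phiT linearZ /= rmorph1.
  rewrite evS opprD addrACA subrr add0r -mulrBr; exact: ideal_powS.
exists (series_eval : {lrmorphism series O -> R}); split=> [|f|psi' psiT f].
- apply: sep => k; apply: (ideal_pow_le (leq_trans (leqnSn k) (leqnSn _))).
  have <- : ev k.+2 (series_T O) = tau.
    rewrite !evS scale0r scale1r /ev big1 ?mulr0 ?addr0 ?mulr1 ?add0r // => i _.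
    by rewrite /= scale0r.
  by rewrite -opprB; exact/ideal_powN.
- have := ideal_pow1_res (evP f 1); rewrite evS /ev big_ord0 mulr0 addr0 rmorphB.
  by move=> /eqP; rewrite subr_eq0 => /eqP.
apply: sep => k; have -> : psi' f - series_eval f =
  psi' f - ev k f + (ev k f - series_eval f) by ring.
by apply: ideal_powD => //; exact: uniq.
Qed.

End SeriesEvaluation.

(** * Pairs of 2x2 matrices and their traces *)

Section QuaternionBasis.
Variables (R : comNzRingType) (A B : 'M[R]_2).

Definition qcomb (c : 'rV[R]_4) : 'M[R]_2 :=
  (c 0 0)%:M + c 0 1 *: A + (c 0 2%:R *: B + c 0 3%:R *: (A *m B)).

Lemma qcomb_linear : linear qcomb.
Proof. by move=> k c d; apply/matrixP => i j; rewrite /qcomb !mxE; ring. Qed.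
HB.instance Definition _ := GRing.isLinear.Build R 'rV[R]_4 'M[R]_2 _ qcomb
  qcomb_linear.

Definition row4 (a b c d : R) : 'rV[R]_4 :=
  \row_j (nth 0 [:: a; b; c; d] j).

Lemma qcomb_row4 a b c d :
  qcomb (row4 a b c d) = a%:M + b *: A + (c *: B + d *: (A *m B)).
Proof. by rewrite /qcomb !mxE. Qed.

Lemma row4E (c : 'rV[R]_4) : c = row4 (c 0 0) (c 0 1) (c 0 2%:R) (c 0 3%:R).
Proof.
apply/rowP => j; rewrite mxE; case: j => -[|[|[|[|//]]]] /= ?;
  by congr (c _ _); apply: val_inj.
Qed.

Hypotheses (dA : \det A = 1) (dB : \det B = 1) (tAB : \tr A = \tr B).
Local Notation x := (\tr A).
Local Notation y := (\tr (A *m B)).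

(** In the coordinates on 1, A, B, AB, left multiplication by A, and below by B, depends on x and y
    alone; this is why the traces determine the pair. *)
Lemma qcomb_mulA c : A *m qcomb c =
  qcomb (row4 (- c 0 1) (c 0 0 + x * c 0 1) (- c 0 3%:R) (c 0 2%:R + x * c 0 3%:R)).
Proof.
rewrite qcomb_row4 /qcomb !mulmxDr mul_mx_scalar -!scalemxAr mulmxA.
rewrite cayley_hamilton2 dA mulmxBl -scalemxAl mul1mx.
by apply/matrixP => i j; rewrite !mxE; ring.
Qed.

Lemma qcomb_mulB c : B *m qcomb c =
  qcomb (row4 ((y - x ^+ 2) * c 0 1 - c 0 2%:R - x * c 0 3%:R) (x * c 0 1 + c 0 3%:R)
    (c 0 0 + x * c 0 1 + x * c 0 2%:R + y * c 0 3%:R) (- c 0 1)).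
Proof.
(* The polarised Cayley-Hamilton identity. *)
have BA : B *m A = x *: B + x *: A + (y - x ^+ 2)%:M - A *m B.
  move: tAB; rewrite [A]mx2E [B]mx2E !mx2S !tr_mx2 => tAB'.
  have hE : B 1 1 = A 0 0 + A 1 1 - B 0 0 by rewrite tAB'; ring.
  by rewrite hE; congr mx2; ring.
have BB : B *m B = x *: B - 1%:M by rewrite cayley_hamilton2 dB tAB.
rewrite qcomb_row4 /qcomb !mulmxDr mul_mx_scalar -!scalemxAr (mulmxA B A B) BA BB.
rewrite !mulmxBl !mulmxDl -!scalemxAl mul_scalar_mx -!mulmxA BB mulmxBr mulmx1 -scalemxAr.
by apply/matrixP => i j; rewrite !mxE; ring.
Qed.

(** AB - BA = (C - 1) BA with C the commutator of A and B, so the determinant is 2 - tr C, and tr C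
    = z. This turns irreducibility into 2 - z being nonzero. *)
Lemma det_lie : \det (A *m B - B *m A) = 2 - zed x y.
Proof.
move: dA dB tAB; rewrite /zed [A]mx2E [B]mx2E !mx2S !tr_mx2 !det_mx2.
move: (A 0 0) (A 0 1) (A 1 0) (A 1 1) (B 0 0) (B 0 1) (B 1 0) (B 1 1).
move=> a b c d e f g h dA' dB' tAB'.
have hE : h = a + d - e by rewrite tAB'; ring.
have bc : b * c = a * d - 1 by rewrite -dA'; ring.
have fg : f * g = e * (a + d - e) - 1 by rewrite -hE -dB'; ring.
by rewrite hE; ring: bc fg.
Qed.

End QuaternionBasis.

Section QuaternionBasisUnit.
Variables (R : comUnitRingType) (A B : 'M[R]_2).
Hypothesis ABU : A *m B - B *m A \in unitmx.

(* U + V B = 0 with U, V polynomials in A forces V (AB - BA) = 0. *)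
Lemma qcomb_inj c : qcomb A B c = 0 -> c = 0.
Proof.
have lin0 (a b : R) : a%:M + b *: A = 0 -> a = 0 /\ b = 0.
  move=> e; have b0 : b = 0.
    have : b *: (A *m B - B *m A) = 0.
      have -> : b *: (A *m B - B *m A) = (a%:M + b *: A) *m B - B *m (a%:M + b *: A).
        rewrite mulmxDl mulmxDr mul_scalar_mx mul_mx_scalar -scalemxAl -scalemxAr.
        by apply/matrixP => i j; rewrite !mxE; ring.
      by rewrite e mul0mx mulmx0 subrr.
    move/(congr1 (fun M => (M *m invmx (A *m B - B *m A)) 0 0)).
    by rewrite -scalemxAl mulmxV // mul0mx !mxE mulr1.
  move: e; rewrite b0 scale0r addr0 => /matrixP /(_ 0 0).
  by rewrite !mxE eqxx mulr1n => ->.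
set U := (c 0 0)%:M + c 0 1 *: A; set V := (c 0 2%:R)%:M + c 0 3%:R *: A.
have qE : qcomb A B c = U + V *m B.
  by rewrite /qcomb /V mulmxDl mul_scalar_mx -scalemxAl.
rewrite qE => e.
have cA a b : A *m (a%:M + b *: A) = (a%:M + b *: A) *m A.
  by rewrite mulmxDl mulmxDr mul_scalar_mx mul_mx_scalar -scalemxAl -scalemxAr.
have V0 : V = 0.
  have : V *m (A *m B - B *m A) = 0.
    have -> : V *m (A *m B - B *m A) = A *m (U + V *m B) - (U + V *m B) *m A.
      have cU : A *m U = U *m A by exact: cA.
      have cV : A *m V = V *m A by exact: cA.
      rewrite mulmxBr (mulmxDr A U) (mulmxDl U) cU (mulmxA A V B) cV -!mulmxA.
      by rewrite opprD addrACA subrr add0r.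
    by rewrite e mulmx0 mul0mx subrr.
  by move=> /(congr1 (mulmx^~ (invmx (A *m B - B *m A)))); rewrite mulmxK // mul0mx.
have U0 : U = 0 by move: e; rewrite V0 mul0mx addr0.
have [c0 c1] := lin0 _ _ U0; have [c2 c3] := lin0 _ _ V0.
by rewrite [c]row4E c0 c1 c2 c3; apply/rowP => j; rewrite !mxE; case: j => -[|[|[|[|]]]].
Qed.

End QuaternionBasisUnit.

Section Conjugation.
Variables (R : comUnitRingType) (F : fieldType) (res : {rmorphism R -> F}).
Hypothesis unitE : forall r, (r \is a GRing.unit) = (res r != 0).

Lemma unitmx_res k (M : 'M[R]_k) : (M \in unitmx) = (map_mx res M \in unitmx).
Proof. by rewrite !unitmxE unitE det_map_mx unitfE. Qed.

Lemma map_qcomb (A B : 'M[R]_2) c :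
  map_mx res (qcomb A B c) = qcomb (map_mx res A) (map_mx res B) (map_mx res c).
Proof.
by rewrite /qcomb !map_mxD !map_mxZ map_mxM map_scalar_mx !mxE.
Qed.

(** Invertibility of the 4x4 coordinate matrix is tested over the residue field, where injectivity
    suffices. *)
Lemma qcomb_surj (A B : 'M[R]_2) : A *m B - B *m A \in unitmx ->
  forall X, exists c, qcomb A B c = X.
Proof.
move=> ABU X.
pose M : 'M[R]_4 := \matrix_i (mxvec (qcomb A B (delta_mx 0 i)) : 'rV_4).
have ME (c : 'rV[R]_4) : c *m M = mxvec (qcomb A B c).
  rewrite [in RHS](row_sum_delta c) !linear_sum mulmx_sum_row.
  by apply: eq_bigr => i _; rewrite rowK !linearZ.
have MU : M \in unitmx.
  rewrite unitmx_res unitmxE unitfE; apply/negP => /det0P [v v0 vM].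
  case/negP: v0; apply/eqP.
  apply: (@qcomb_inj F (map_mx res A) (map_mx res B)).
    by move: ABU; rewrite unitmx_res map_mxB !map_mxM.
  apply: (can_inj (@mxvecK _ 2 2)); rewrite linear0 -[RHS]vM.
  rewrite [in LHS](row_sum_delta v) !linear_sum mulmx_sum_row.
  apply: eq_bigr => i _; rewrite !linearZ; congr (_ *: _).
  transitivity (map_mx res (mxvec (qcomb A B (delta_mx 0 i)))).
    rewrite map_mxvec map_qcomb; congr (mxvec (qcomb _ _ _)).
    by apply/rowP => j; rewrite !mxE rmorph_nat.
  by rewrite -map_row rowK.
exists (mxvec X *m invmx M); apply: (can_inj (@mxvecK _ 2 2)).
by rewrite -ME mulmxKV.
Qed.

(** Keeping the coordinates on 1, A, B, AB while replacing A, B by A', B' intertwines the left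
    multiplications. Applied to the matrix units of the first column, and keeping the first column
    of the result, this gives P; it reduces to the identity, hence is invertible. *)
Lemma same_trace_conj (A B A' B' : 'M[R]_2) :
  \det A = 1 -> \det B = 1 -> \tr A = \tr B ->
  \det A' = 1 -> \det B' = 1 -> \tr A' = \tr B' ->
  \tr A = \tr A' -> \tr (A *m B) = \tr (A' *m B') ->
  map_mx res A = map_mx res A' -> map_mx res B = map_mx res B' ->
  A *m B - B *m A \in unitmx ->
  exists2 P, P \in unitmx & P *m A = A' *m P /\ P *m B = B' *m P.
Proof.
move=> dA dB tAB dA' dB' tAB' tA tP rA rB ABU.
have /choice [c cE] := fun j : 'I_2 => qcomb_surj ABU (delta_mx j 0).
pose P : 'M[R]_2 := \matrix_(i, j) qcomb A' B' (c j) i 0.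
have key (X X' : 'M[R]_2) (l : 'rV[R]_4 -> 'rV[R]_4) :
    (forall d, X *m qcomb A B d = qcomb A B (l d)) ->
    (forall d, X' *m qcomb A' B' d = qcomb A' B' (l d)) -> P *m X = X' *m P.
  move=> lX lX'; apply/matrixP => i j.
  (* X times the matrix unit (j, 0) is the combination of the units (k, 0) with the entries of
     column j of X. *)
  have e : l (c j) = \sum_k X k j *: c k.
    apply/eqP; rewrite -subr_eq0; apply/eqP; apply: (qcomb_inj ABU).
    rewrite linearB /= -lX linear_sum /= cE; apply/eqP; rewrite subr_eq0; apply/eqP.
    apply/matrixP => s t; rewrite summxE mxE (bigD1 j) //= !mxE eqxx /=.
    rewrite big1 ?addr0 => [|k /negPf kj]; last by rewrite mxE kj mulr0.
    rewrite (bigD1 s) //= linearZ /= cE !mxE eqxx /= big1 ?addr0 //.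
    by move=> k /negPf ks; rewrite linearZ /= cE !mxE eq_sym ks mulr0.
  have -> : (X' *m P) i j = (X' *m qcomb A' B' (c j)) i 0.
    by rewrite !mxE; apply: eq_bigr => k _; rewrite mxE.
  rewrite lX' e linear_sum summxE mxE; apply: eq_bigr => k _.
  by rewrite linearZ /= !mxE mulrC.
exists P; last first.
  split.
    apply: (key _ _ _ (qcomb_mulA B dA)) => d.
    by rewrite qcomb_mulA // tA.
  apply: (key _ _ _ (qcomb_mulB dB tAB)) => d.
  by rewrite qcomb_mulB // tA tP.
rewrite unitmx_res (_ : map_mx res P = 1%:M) ?unitmx1 //.
apply/matrixP => i j.
have := congr1 (fun M => map_mx res M i 0) (cE j); rewrite /= map_qcomb rA rB -map_qcomb.
by rewrite !mxE rmorph_nat andbT => <-.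
Qed.

End Conjugation.

(** * Irreducibility and the commutator *)

Section Irreducibility.

(** Equivalently A N = N adj(A) for N = AB - BA, so the row kernel of N is stable under A and, by
    antisymmetry, under B. *)
Lemma lie_anticommute (R : comNzRingType) (A B : 'M[R]_2) :
  A *m (A *m B - B *m A) = \tr A *: (A *m B - B *m A) - (A *m B - B *m A) *m A.
Proof. by rewrite [A]mx2E [B]mx2E !mx2S tr_mx2; congr mx2; ring. Qed.

Lemma adj_mx2E (R : comNzRingType) (A : 'M[R]_2) : \adj A = (\tr A)%:M - A.
Proof. by rewrite [A]mx2E !mx2S tr_mx2; congr mx2; ring. Qed.

Variables (n : int) (K : fieldType) (rho : sl2rep (twist_group n) K).
Local Notation A := (rho (twist_a n)).
Local Notation B := (rho (twist_b n)).

Lemma stablemx_gen (U : 'M[K]_2) : stablemx U A -> stablemx U B ->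
  forall g, stablemx U (rho g).
Proof.
move=> UA UB g; rewrite -[g]pres_class_repr rep_class.
have Ul l : stablemx U (letter_mx A B l).
  rewrite /letter_mx; case: l => -[] [] //=; rewrite adj_mx2E;
    by apply: stablemxD; rewrite ?stablemxN // stablemxC.
elim: (repr g) => [|l u IH] /=; first exact: stablemxC.
exact: stablemxM.
Qed.

End Irreducibility.

(** If the commutator is singular, its kernel is nonzero and stable, so the commutator is 0. Then A
    and B commute, each is scalar because an eigenspace is stable, and a coordinate line is
    stable. *)
Lemma irreducible_lie n (K : closedFieldType) (rho : sl2rep (twist_group n) K) :
  irreducible_rep rho ->
  \det (rho (twist_a n) *m rho (twist_b n) - rho (twist_b n) *m rho (twist_a n)) != 0.
Proof.
set A := rho (twist_a n); set B := rho (twist_b n); set N := _ - _ => irr.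
apply/negP => /eqP dN.
have sub_stable (U X : 'M[K]_2) : U *m X = 0 -> True by [].
have kerN : N = 0.
  case: (irr (kermx N)) => [|k0|kf].
  - apply: stablemx_gen; rewrite -/A -/B; apply/sub_kermxP.
      by rewrite -mulmxA lie_anticommute mulmxBr -scalemxAr mulmxA mulmx_ker
        scaler0 mul0mx subrr.
    have -> : N = - (B *m A - A *m B) by rewrite opprB.
    rewrite mulmxN -mulmxA lie_anticommute mulmxBr -scalemxAr mulmxA.
    rewrite (_ : kermx _ *m _ = 0) ?scaler0 ?mul0mx ?subrr ?oppr0 //.
    by rewrite -[LHS]opprK -mulmxN opprB mulmx_ker oppr0.
  - have NU : N \in unitmx.
      by rewrite -row_free_unit -kermx_eq0 k0.
    by move: NU; rewrite unitmxE dN unitr0.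
  - by apply: (row_full_inj kf); rewrite mulmx_ker mulmx0.
have AB : A *m B = B *m A by apply/eqP; rewrite -subr_eq0; apply/eqP.
have scal X : X *m A = A *m X -> X *m B = B *m X -> exists l, X = l%:M.
  move=> XA XB; have [l] : exists l, root (char_poly X) l.
    by apply/closed_rootP; rewrite size_char_poly.
  rewrite -eigenvalue_root_char => /eigenvalueP [v vX v0].
  exists l; case: (irr (kermx (X - l%:M))) => [|k0|kf].
  - apply: stablemx_gen; rewrite -/A -/B; apply/sub_kermxP; rewrite -mulmxA.
      have -> : A *m (X - l%:M) = (X - l%:M) *m A.
        by rewrite mulmxBr mulmxBl XA mul_mx_scalar mul_scalar_mx.
      by rewrite mulmxA mulmx_ker mul0mx.
    have -> : B *m (X - l%:M) = (X - l%:M) *m B.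
      by rewrite mulmxBr mulmxBl XB mul_mx_scalar mul_scalar_mx.
    by rewrite mulmxA mulmx_ker mul0mx.
  - case/negP: v0; rewrite -submx0 -k0; apply/sub_kermxP.
    by rewrite mulmxBr vX mul_mx_scalar subrr.
  - apply/eqP; rewrite -subr_eq0; apply/eqP.
    by apply: (row_full_inj kf); rewrite mulmx_ker mulmx0.
have [l Al] := scal A erefl AB; have [m Bm] := scal B (esym AB) erefl.
case: (irr (delta_mx 0 0)) => [|/matrixP /(_ 0 0) /eqP|].
- apply: stablemx_gen; rewrite -/A -/B ?Al ?Bm; exact: stablemxC.
- by rewrite !mxE oner_eq0.
- by rewrite /row_full mxrank_delta.
Qed.

Lemma absolutely_irreducible_lie n (F : fieldType) (rho : sl2rep (twist_group n) F) :
  absolutely_irreducible rho ->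
  \det (rho (twist_a n) *m rho (twist_b n) - rho (twist_b n) *m rho (twist_a n)) != 0.
Proof.
move=> [K [iota [_ /irreducible_lie]]] /=.
by rewrite -!map_mxM -map_mxB det_map_mx fmorph_eq0.
Qed.

(** * Lifting a residual pair with prescribed traces *)

Section Lifting.
Variables (R : comUnitRingType) (F : fieldType) (res : {rmorphism R -> F}).
Hypothesis Rcl : is_complete_local res.

(** With A in companion form and the traces fixed, B is given by its last column (q, s), and det B =
    1 is this conic. Hensel's lemma is applied in a variable whose partial derivative is nonzero. *)
Lemma lift_conic (x y : R) (q0 s0 : F) :
  q0 ^+ 2 + q0 * res y - res x * q0 * s0 + s0 ^+ 2 - res x * s0 + 1 = 0 ->
  2 * q0 + res y - res x * s0 != 0 \/ 2 * s0 - res x * q0 - res x != 0 ->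
  exists q s, [/\ res q = q0, res s = s0
    & q ^+ 2 + q * y - x * q * s + s ^+ 2 - x * s + 1 = 0].
Proof.
have [sur _ _] := Rcl; have [q1 q1E] := sur q0; have [s1 s1E] := sur s0.
move=> e [u0|v0].
  pose P : {poly R} := 'X^2 + (y - x * s1)%:P * 'X + (s1 ^+ 2 - x * s1 + 1)%:P.
  have PE a : P.[a] = a ^+ 2 + (y - x * s1) * a + (s1 ^+ 2 - x * s1 + 1).
    by rewrite /P !hornerE.
  have dP a : P^`().[a] = 2 * a + (y - x * s1).
    by rewrite /P !derivE !(hornerE, hornerMn) /=; ring.
  have [||q q0' qq] := hensel Rcl (p := P) (a := q1).
  - rewrite PE -[RHS]e !(rmorphD, rmorphM, rmorphN, rmorphXn) rmorph1 q1E s1E; ring.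
  - by rewrite dP !(rmorphD, rmorphM, rmorphN) rmorph1 q1E s1E addrA.
  exists q, s1; rewrite qq; split=> //; rewrite -[RHS]q0' PE; ring.
pose P : {poly R} := 'X^2 - (x * q1 + x)%:P * 'X + (q1 ^+ 2 + q1 * y + 1)%:P.
have PE a : P.[a] = a ^+ 2 - (x * q1 + x) * a + (q1 ^+ 2 + q1 * y + 1).
  by rewrite /P !hornerE.
have dP a : P^`().[a] = 2 * a - (x * q1 + x).
  by rewrite /P !derivE !(hornerE, hornerMn) /=; ring.
have [||s s0' ss] := hensel Rcl (p := P) (a := s1).
- rewrite PE -[RHS]e !(rmorphD, rmorphM, rmorphN, rmorphXn) rmorph1 q1E s1E; ring.
- by rewrite dP !(rmorphD, rmorphM, rmorphN) rmorph1 q1E s1E opprD addrA.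
exists q1, s; rewrite ss; split=> //; rewrite -[RHS]s0' PE; ring.
Qed.

Lemma lift_pair (A0 B0 : 'M[F]_2) (x y : R) :
  \det A0 = 1 -> \det B0 = 1 -> \tr A0 = res x -> \tr B0 = res x ->
  \tr (A0 *m B0) = res y -> \det (A0 *m B0 - B0 *m A0) != 0 ->
  exists A B : 'M[R]_2, [/\ \det A = 1 /\ \det B = 1, \tr A = x /\ \tr B = x,
    \tr (A *m B) = y & map_mx res A = A0 /\ map_mx res B = B0].
Proof.
move=> dA dB tA tB tAB dN.
pose C0 := mx2 0 1 (-1) (res x).
have [P0 P0U PA] : exists2 P0, P0 \in unitmx & P0 *m A0 = C0 *m P0.
  move: dA tA dN; rewrite [A0]mx2E [B0]mx2E !mx2S !det_mx2 tr_mx2.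
  move: (A0 0 0) (A0 0 1) (A0 1 0) (A0 1 1) (B0 0 0) (B0 0 1) (B0 1 0) (B0 1 1).
  move=> a b c d e f g h dA' tA' dN'.
  have bc : b * c = a * d - 1 by rewrite -dA'; ring.
  (* The rows are v and v A0 for v = (s, t), invertible when v is cyclic. The vectors (1, 0), (0,
     1), (1, 1) all fail only for scalar A0, which commutes with B0. *)
  pose P s t := mx2 s t (s * a + t * c) (s * b + t * d).
  have PP s t : P s t *m mx2 a b c d = C0 *m P s t.
    rewrite /P /C0 !mx2S -tA'; by congr mx2; ring: bc.
  have PU s t : s * (s * b + t * d) - t * (s * a + t * c) != 0 -> P s t \in unitmx.
    by rewrite unitmxE unitfE det_mx2.
  have [b0|b0] := eqVneq b 0; last first.
    by exists (P 1 0) => //; apply: PU; rewrite !mul1r !mul0r addr0 subr0.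
  have [c0|c0] := eqVneq c 0; last first.
    by exists (P 0 1) => //; apply: PU; rewrite !mul1r !mul0r !add0r oppr_eq0.
  exists (P 1 1) => //; apply: PU; apply: contraNneq dN'; rewrite b0 c0 => H.
  have -> : d = a by apply/eqP; rewrite -subr_eq0 -[X in _ == X]H; apply/eqP; ring.
  by apply/eqP; ring.
have [q0 [s0 [B1E conic0 uv]]] : exists q0 s0, [/\
    P0 *m B0 *m invmx P0 = mx2 (res x - s0) q0 (res y + q0 - res x * s0) s0,
    q0 ^+ 2 + q0 * res y - res x * q0 * s0 + s0 ^+ 2 - res x * s0 + 1 = 0 &
    2 * q0 + res y - res x * s0 != 0 \/ 2 * s0 - res x * q0 - res x != 0].
  set B1 := P0 *m B0 *m invmx P0.
  have A1E : C0 = P0 *m A0 *m invmx P0 by rewrite PA mulmxK.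
  have tB1 : \tr B1 = res x by rewrite /B1 mxtrace_mulC mulmxA mulVmx // mul1mx.
  have dB1 : \det B1 = 1.
    by rewrite /B1 !det_mulmx dB mulr1 -det_mulmx mulmxV // det1.
  have CB : C0 *m B1 = P0 *m (A0 *m B0) *m invmx P0.
    by rewrite A1E /B1 !mulmxA mulmxKV.
  have BC : B1 *m C0 = P0 *m (B0 *m A0) *m invmx P0.
    by rewrite A1E /B1 !mulmxA mulmxKV.
  have tCB : \tr (C0 *m B1) = res y.
    by rewrite CB mxtrace_mulC !mulmxA mulVmx // mul1mx.
  have dCB : \det (C0 *m B1 - B1 *m C0) != 0.
    rewrite CB BC -mulmxBl -mulmxBr !det_mulmx mulrAC -det_mulmx mulmxV //.
    by rewrite det1 mul1r.
  exists (B1 0 1), (B1 1 1); move: tB1 dB1 tCB dCB; rewrite [B1]mx2E.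
  move: (B1 0 0) (B1 0 1) (B1 1 0) (B1 1 1) => p q r s; rewrite !mx2S !mxE /=.
  rewrite !tr_mx2 !det_mx2 => tB1 dB1 tCB dCB.
  have pE : p = res x - s by rewrite -tB1; ring.
  have rE : r = res y + q - res x * s by rewrite -tCB; ring.
  split; first by rewrite pE rE.
    transitivity (1 - (p * s - q * r)); last by rewrite dB1 subrr.
    by rewrite pE rE; ring.
  have [u0|u0] := eqVneq (2 * q + res y - res x * s) 0; [right | by left].
  apply: contraNneq dCB => v0; apply/eqP.
  (* The determinant of the commutator is a quadratic form in the two partial derivatives of the
     conic, so they cannot both vanish. *)
  transitivity (- (2 * q + res y - res x * s) ^+ 2 - (2 * s - res x * q - res x)
    * (2 * s - res x * q - res x + res x * (2 * q + res y - res x * s))).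
    by rewrite pE rE; ring.
  by rewrite u0 v0; ring.
have [q [s [qE sE con]]] := lift_conic conic0 uv.
have [sur unitE _] := Rcl.
have /choice [lf lfE] : forall a, exists r, res r = a by exact: sur.
pose P := map_mx lf P0.
have PE : map_mx res P = P0 by apply/matrixP => i j; rewrite !mxE lfE.
have PU : P \in unitmx by rewrite (unitmx_res unitE) PE.
pose C := mx2 0 1 (-1) x; pose B2 := mx2 (x - s) q (y + q - x * s) s.
have map_mx2 a b c d : map_mx res (mx2 a b c d) = mx2 (res a) (res b) (res c) (res d).
  by apply: mx2_eq; rewrite !mxE.
have conj_det (M : 'M[R]_2) : \det (invmx P *m M *m P) = \det M.
  by rewrite !det_mulmx mulrAC -det_mulmx mulVmx // det1 mul1r.
have conj_tr (M : 'M[R]_2) : \tr (invmx P *m M *m P) = \tr M.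
  by rewrite mxtrace_mulC mulmxA mulmxV // mul1mx.
exists (invmx P *m C *m P), (invmx P *m B2 *m P); split.
- rewrite !conj_det !det_mx2; split; first by ring.
  transitivity (1 - (q ^+ 2 + q * y - x * q * s + s ^+ 2 - x * s + 1)); first by ring.
  by rewrite con subr0.
- by rewrite !conj_tr !tr_mx2; split; ring.
- have -> : invmx P *m C *m P *m (invmx P *m B2 *m P) = invmx P *m (C *m B2) *m P.
    by rewrite !mulmxA mulmxK.
  by rewrite conj_tr mx2M tr_mx2; ring.
have conj_map (M : 'M[R]_2) (M0 : 'M[F]_2) : P0 *m M0 = map_mx res M *m P0 ->
    map_mx res (invmx P *m M *m P) = M0.
  move=> e; apply: (can_inj (mulKmx P0U)); rewrite -[in LHS]PE -map_mxM.
  by rewrite !mulmxA mulmxV // mul1mx map_mxM PE -e.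
split; apply: conj_map; rewrite map_mx2.
  by rewrite rmorph0 rmorphN rmorph1.
rewrite !(rmorphB, rmorphD, rmorphM) /= qE sE -B1E.
by rewrite mulmxKV.
Qed.

End Lifting.

(** * The universal deformation *)

Lemma map_word_mx (R S : comNzRingType) (phi : {rmorphism R -> S}) (A B : 'M[R]_2) u :
  map_mx phi (word_mx A B u) = word_mx (map_mx phi A) (map_mx phi B) u.
Proof.
elim: u => [|[x e] u IH] /=; first by rewrite map_mx1.
by rewrite map_mxM IH; congr (_ *m _); rewrite /letter_mx; case: x e => -[];
  rewrite //= map_mx_adj.
Qed.

Lemma word_mx_conj (R : comNzRingType) (A B A' B' P : 'M[R]_2) u :
  \tr A = \tr A' -> \tr B = \tr B' -> P *m A = A' *m P -> P *m B = B' *m P ->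
  P *m word_mx A B u = word_mx A' B' u *m P.
Proof.
move=> tA tB PA PB; elim: u => [|[x e] u IH] /=; first by rewrite mulmx1 mul1mx.
rewrite -mulmxA -IH !mulmxA; congr (_ *m _); rewrite /letter_mx.
by case: x e => -[] //=; rewrite !adj_mx2E mulmxBr mulmxBl mul_mx_scalar mul_scalar_mx
  ?PA ?PB ?tA ?tB.
Qed.

Section UniversalDeformation.
Variables (n : int) (O : idomainType) (F : fieldType) (resO : {rmorphism O -> F}).
Hypothesis hO : is_cdvr0 resO.
Variable rhobar : sl2rep (twist_group n) F.
Local Notation A0 := (rhobar (twist_a n)).
Local Notation B0 := (rhobar (twist_b n)).
Hypothesis lie0 : \det (A0 *m B0 - B0 *m A0) != 0.
Local Notation resS := (resO \o @scoef0 O).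

Variables X Y : series O.
Hypotheses (resX : resS X = \tr A0) (resY : resS Y = \tr (A0 *m B0)).
Hypothesis fXY : fval n X Y = 0.
(** (X, Y) is the universal point of the curve above the residual traces. Hensel's lemma supplies
    this in either variable, so both cases share what follows. *)
Hypothesis param : forall (R' : comUnitAlgType O) (res' : {rmorphism R' -> F}) x' y',
  is_complete_local_algebra resO res' -> res' x' = \tr A0 ->
  res' y' = \tr (A0 *m B0) -> fval n x' y' = 0 ->
  exists psi : {lrmorphism series O -> R'},
    [/\ forall f, res' (psi f) = resS f, psi X = x', psi Y = y'
      & forall psi' : {lrmorphism series O -> R'},
        psi' X = x' -> psi' Y = y' -> psi' =1 psi].

(** f_n(x, y) (A - B) = 0, and A - B has a unit entry because A0 and B0 differ; the argument
    tolerates zero divisors in R'. *)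
Lemma rep_fval_eq0 (R' : comUnitRingType) (res' : {rmorphism R' -> F})
    (rho' : sl2rep (twist_group n) R') :
  (forall r, (r \is a GRing.unit) = (res' r != 0)) ->
  (forall g, map_rep res' rho' g = rhobar g) ->
  fval n (\tr (rho' (twist_a n))) (\tr (rho' (twist_a n) *m rho' (twist_b n))) = 0.
Proof.
move=> unitE defo; set A := rho' _; set B := rho' _.
have := relator_mxB n (rep_det rho' _ : \det A = 1) (rep_det rho' _ : \det B = 1)
  (rep_tr_ab rho').
rewrite (rep_relation rho') subrr; set v := fval _ _ _ => /esym e.
apply: contrapT => v0; case/negP: lie0.
have -> : A0 = B0.
  apply/matrixP => i j; apply/eqP; rewrite -subr_eq0.
  rewrite -!defo -/A -/B !mxE -rmorphB -[_ == 0]negbK -unitE; apply/negP => u.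
  move/matrixP: e => /(_ i j); rewrite !mxE => e; apply: v0.
  by rewrite -[v](mulrK u) e mul0r.
by rewrite subrr det0.
Qed.

(** A deformation factors by [same_trace_conj]. Uniqueness holds because conjugation preserves
    traces and a morphism is determined by the images of X and Y. *)
Lemma universal_exists : exists rho : sl2rep (twist_group n) (series O),
  [/\ is_universal_deformation resO rhobar resS rho, \tr (rho (twist_a n)) = X
    & \tr (rho (twist_a n * twist_b n)%g) = Y].
Proof.
have Scl := series_complete_local hO.
have [w [w0 resw wP]] := cdvr_uniformizer hO.
have {}Scl : is_complete_local resS := Scl _ w0 resw wP.
have [A [B [[dA dB] [tA tB] tAB [rA rB]]]] := lift_pair Scl (rep_det rhobar _)
  (rep_det rhobar _) (esym resX) (etrans (esym (rep_tr_ab rhobar)) (esym resX))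
  (esym resY) lie0.
have tAB' : \tr A = \tr B by rewrite tA tB.
have rel : word_mx A B (relator_lhs n) = word_mx A B (relator_rhs n).
  apply/eqP; rewrite -subr_eq0 relator_mxB // tA tAB fXY scale0r //.
pose rho := pair_rep dA dB rel.
have ra : rho (twist_a n) = A by exact: pair_rep_a.
have rb : rho (twist_b n) = B by exact: pair_rep_b.
have defo : is_deformation rhobar resS rho.
  move=> g; rewrite -[g]pres_class_repr [RHS]rep_class.
  change (map_mx resS (rho (pres_class _ _ (repr g))) = word_mx A0 B0 (repr g)).
  by rewrite rep_class map_word_mx ra rb rA rB.
exists rho; rewrite rep_mxM ra rb tA tAB; split=> //; split=> //.
  split=> // c; change (resO (scoef (c%:A : series O) 0) = resO c).
  by rewrite scoefC mulr1.
move=> R' res' rho' R'cl defo'.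
have [[_ unitE' _] _] := R'cl.
set A' := rho' (twist_a n); set B' := rho' (twist_b n).
have resA' : map_mx res' A' = A0 by rewrite -defo'.
have resB' : map_mx res' B' = B0 by rewrite -defo'.
have [|||psi [psir psiX psiY psiU]] := param (x' := \tr A') (y' := \tr (A' *m B')) R'cl.
- by rewrite -resA' trace_map_mx.
- by rewrite -resA' -resB' -map_mxM trace_map_mx.
- exact: rep_fval_eq0 unitE' defo'.
have psim (M : 'M[series O]_2) : map_mx res' (map_mx psi M) = map_mx resS M.
  by apply/matrixP => i j; rewrite !mxE psir.
exists psi; split; first (split=> //; split).
- have [|||||||||||P PU [PA PB]] := same_trace_conj unitE' (A := map_mx psi A)
    (B := map_mx psi B) (A' := A') (B' := B').
  + by rewrite det_map_mx dA rmorph1.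
  + by rewrite det_map_mx dB rmorph1.
  + by rewrite !trace_map_mx tAB'.
  + exact: rep_det.
  + exact: rep_det.
  + exact: rep_tr_ab.
  + by rewrite trace_map_mx /= tA psiX.
  + by rewrite -map_mxM trace_map_mx /= tAB psiY.
  + by rewrite psim rA resA'.
  + by rewrite psim rB resB'.
  + rewrite (unitmx_res unitE') map_mxB !map_mxM !psim rA rB.
    by rewrite unitmxE unitfE.
  exists P => // g; apply: (can_inj (mulmxK PU)); rewrite mulmxKV //.
  rewrite -[g]pres_class_repr (rep_class rho').
  change (word_mx A' B' (repr g) *m P = P *m map_mx psi (rho (pres_class _ _ (repr g)))).
  rewrite rep_class map_word_mx ra rb; apply/esym/word_mx_conj => //.
    by rewrite trace_map_mx /= tA psiX.
  by rewrite trace_map_mx -tAB' /= tA psiX -rep_tr_ab.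
- move=> g; rewrite defo' -defo; exact: psim.
move=> psi' [_ [[P PU Pg] _]].
have trg g : psi' (\tr (rho g)) = \tr (rho' g).
  rewrite Pg; change (psi' (\tr (rho g)) = \tr (P *m map_mx psi' (rho g) *m invmx P)).
  by rewrite mxtrace_mulC mulmxA mulVmx // mul1mx trace_map_mx.
apply: psiU; first by rewrite -tA -ra trg.
by rewrite -tAB -ra -rb -rep_mxM trg rep_mxM.
Qed.

End UniversalDeformation.

(** * Weierstrass preparation *)

Section SeriesMap.
Variables (R S : comNzRingType) (phi : {rmorphism R -> S}).

Lemma series_map_zmod : zmod_morphism (series_map phi).
Proof. by move=> f g; apply: seriesP => i; rewrite /= rmorphB. Qed.

Lemma series_map_monoid : monoid_morphism (series_map phi).
Proof.
split=> [|f g]; apply: seriesP => i; first by rewrite /= rmorph_nat.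
rewrite /= rmorph_sum; apply: eq_bigr => j _; exact: rmorphM.
Qed.

HB.instance Definition _ :=
  GRing.isZmodMorphism.Build (series R) (series S) (series_map phi) series_map_zmod.
HB.instance Definition _ :=
  GRing.isMonoidMorphism.Build (series R) (series S) (series_map phi) series_map_monoid.

Lemma series_mapC a : series_map phi a%:A = (phi a)%:A.
Proof. by apply: seriesP => i; rewrite /= rmorphM rmorph_nat. Qed.

Lemma series_map_T : series_map phi (series_T R) = series_T S.
Proof. by apply: seriesP => i; rewrite /= rmorph_nat. Qed.

Lemma series_map_var a : series_map phi (series_var a) = series_var (phi a).
Proof. by rewrite /series_var rmorphD /= series_mapC series_map_T. Qed.

End SeriesMap.

Section Weierstrass.
Variables (O : idomainType) (F : fieldType) (res : {rmorphism O -> F}).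
Hypothesis hO : is_cdvr0 res.

(* A distinguished polynomial of degree m, as a power series. *)
Definition distinguished m (g : series O) : Prop :=
  [/\ scoef g m = 1, forall i, (m < i)%N -> scoef g i = 0
    & forall i, (i < m)%N -> res (scoef g i) = 0].

Let wdvd w k (f : series O) := exists h : series O, f = w ^+ k *: h.

Let wdvdP w k f : (forall i, exists c, scoef f i = c * w ^+ k) -> wdvd w k f.
Proof.
move=> /choice [h hE]; exists (Series h); apply: seriesP => i.
by rewrite scoefZ hE mulrC.
Qed.

(** Write f = w V' + T^m U with U a unit, and q = Q U^(-1). Dividing q f by T^m and dropping the
    lower terms gives Q + w [th](Q). For q f to be distinguished this must equal 1, a fixed-point
    equation solved w-adically. *)
Lemma weierstrass_preparation m (f : series O) :
  (forall i, (i < m)%N -> res (scoef f i) = 0) -> scoef f m \is a GRing.unit ->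
  exists q, q \is a GRing.unit /\ distinguished m (q * f).
Proof.
have [w [w0 resw wP]] := cdvr_uniformizer hO => fm fmU.
pose sh (h : series O) : series O := Series (fun i => scoef h (i + m)%N).
have shD a h h' : sh (a *: h + h') = a *: sh h + sh h' by [].
pose U := sh f; have UU : U \is a GRing.unit by rewrite series_unitE.
have [V' V'E] : exists V', forall i, scoef f i = w * scoef V' i + (if (i < m)%N then 0 else scoef f i).
  have /choice [v vE] : forall i, exists c, (i < m)%N -> scoef f i = c * w.
    move=> i; have [im|im] := ltnP i m; last by exists 0.
    by have [c e] := cdvr_dvd hO wP (fm i im); exists c.
  exists (Series (fun i => if (i < m)%N then v i else 0)) => i /=.
  case: ltnP => im; last by rewrite mulr0 add0r.
  by rewrite vE // addr0 mulrC.
have shTm h : sh (series_T O ^+ m * h) = h.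
  apply: seriesP => i; change (scoef (series_T O ^+ m * h) (i + m) = scoef h i).
  elim: (m) => [|k IH]; first by rewrite expr0 mul1r addn0.
  by rewrite exprS -mulrA addnS scoefTMS.
have lowTm h i : (i < m)%N -> scoef (series_T O ^+ m * h) i = 0.
  elim: (m) i => // k IH [|i]; rewrite exprS -mulrA ?scoefTM0 // scoefTMS; exact: IH.
have fE : f = w *: V' + series_T O ^+ m * U.
  apply: seriesP => i; rewrite scoefD scoefZ V'E; congr (_ + _).
  case: ltnP => im; first by rewrite lowTm.
  by rewrite -[in RHS](subnK im) -[RHS]/(scoef (sh _) (i - m)) shTm /= subnK.
pose th Q := sh (Q * U^-1 * V').
have thB Q Q' : th (Q - Q') = th Q - th Q'.
  rewrite /th -!mulrA mulrBl addrC -scaleN1r shD; apply: seriesP => i.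
  by rewrite !scoefD scoefZ scoefN mulN1r addrC.
have thZ a Q : th (a *: Q) = a *: th Q by rewrite /th -!scalerAl.
pose Q_ := fix Q_ k := if k is k'.+1 then 1 - w *: th (Q_ k') else 0.
have Qd k : wdvd w k (Q_ k.+1 - Q_ k).
  elim: k => [|k [h hE]]; first by exists (Q_ 1%N - Q_ 0%N); rewrite scale1r.
  exists (- th h).
  have -> : Q_ k.+2 - Q_ k.+1 = - (w *: th (Q_ k.+1 - Q_ k)).
    rewrite thB scalerBr -[Q_ k.+2]/(1 - w *: th (Q_ k.+1)).
    by rewrite -[X in _ - X = _]/(1 - w *: th (Q_ k)); ring.
  by rewrite hE thZ scalerA -exprS scalerN.
have /choice [l lP] : forall i, exists l, forall k, exists c,
    scoef (Q_ k) i - l = c * w ^+ k.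
  move=> i; apply: (cdvr_complete hO resw wP (u := fun k => scoef (Q_ k) i)) => k.
  by have [h hE] := Qd k; exists (scoef h i); rewrite -scoefB hE scoefZ mulrC.
pose Q := Series l.
have QP k : wdvd w k (Q_ k - Q) by apply: wdvdP => i; rewrite scoefB; exact: lP.
have wdvdD k g h : wdvd w k g -> wdvd w k h -> wdvd w k (g + h).
  by move=> [g' ->] [h' ->]; exists (g' + h'); rewrite scalerDr.
have QE : Q + w *: th Q = 1.
  apply/eqP; rewrite -subr_eq0; apply/eqP; apply: seriesP => i.
  apply: (cdvr_separated hO resw wP) => k.
  have [h ->] : wdvd w k (Q + w *: th Q - 1).
    have -> : Q + w *: th Q - 1 = - (Q_ k.+1 - Q) + - (w *: th (Q_ k - Q)).
      by rewrite thB scalerBr -[Q_ k.+1]/(1 - w *: th (Q_ k)); ring.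
    apply: wdvdD.
      by have [h ->] := QP k.+1; exists (- (w *: h)); rewrite scalerN scalerA -exprSr.
    have [h ->] := QP k; exists (- (w *: th h)).
    by rewrite thZ !scalerN !scalerA mulrC.
  by exists (scoef h i); rewrite scoefZ mulrC.
exists (Q * U^-1); split.
  rewrite unitrM unitrV UU andbT series_unitE (cdvr_unitE hO).
  have -> : scoef Q 0 = 1 - w * scoef (th Q) 0 by rewrite -scoefZ -[X in X - _]/(scoef 1 0) -QE scoefD addrK.
  by rewrite rmorphB rmorphM resw mul0r subr0 rmorph1 oner_eq0.
have gE : Q * U^-1 * f = w *: (Q * U^-1 * V') + series_T O ^+ m * Q.
  by rewrite {1}fE mulrDr -scalerAr; congr (_ + _); rewrite mulrCA mulrVK.
have shg i : scoef (Q * U^-1 * f) (i + m) = (i == 0%N)%:R.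
  rewrite gE scoefD scoefZ -[scoef (_ ^+ m * Q) _]/(scoef (sh _) i) shTm.
  by rewrite -[RHS]/(scoef 1 i) -QE scoefD scoefZ addrC.
split=> [|i mi|i im]; first by rewrite -[m in scoef _ m]add0n shg.
  by rewrite -(subnK (ltnW mi)) shg subn_eq0 leqNgt mi.
by rewrite gE scoefD scoefZ lowTm // addr0 rmorphM resw mul0r.
Qed.

(** The coefficient i + m of (v - 1) h vanishes. It is coefficient i of v - 1 plus later
    coefficients times lower ones of h, which w divides; so divisibility of v - 1 by w^k improves to
    w^(k+1). *)
Lemma distinguished_assoc m (v g h : series O) :
  distinguished m g -> distinguished m h -> g = v * h -> g = h.
Proof.
have [w [w0 resw wP]] := cdvr_uniformizer hO.
move=> [gm gbig _] [hm hbig hsmall] gvh.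
suff v0 : v - 1 = 0 by rewrite gvh; move/eqP: v0; rewrite subr_eq0 => /eqP ->; rewrite mul1r.
set q := v - 1; have qh : q * h = g - h by rewrite /q mulrBl mul1r -gvh.
have qhbig i : scoef (q * h) (i + m) = 0.
  rewrite qh scoefB; case: i => [|i]; first by rewrite add0n gm hm subrr.
  by rewrite gbig ?hbig ?subrr // addSn ltnS leq_addl.
have step k : (forall i, exists c, scoef q i = c * w ^+ k) ->
    forall i, exists c, scoef q i = c * w ^+ k.+1.
  move=> IH i; have := qhbig i; rewrite scoefM.
  rewrite (bigD1 (inord i : 'I_(i + m).+1)) //= inordK ?ltnS ?leq_addr // addKn hm mulr1.
  move/eqP; rewrite addr_eq0 => /eqP ->.
  suff [c ->] : exists c, \sum_(j < (i + m).+1 | j != inord i)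
      scoef q j * scoef h (i + m - j) = c * w ^+ k.+1 by exists (- c); rewrite mulNr.
  apply: (big_ind (fun a => exists c, a = c * w ^+ k.+1)) => [|a b [c ->] [d ->]|j ji].
  - by exists 0; rewrite mul0r.
  - by exists (c + d); rewrite mulrDl.
  have [jlt|jgt|je] := ltngtP j i.
  - by exists 0; rewrite hbig ?mulr0 ?mul0r //; lia.
  - have [c ->] := IH j; have [|d ->] := cdvr_dvd hO wP (r := scoef h (i + m - j)).
      by apply: hsmall; have := ltn_ord j; lia.
    by exists (c * d); rewrite exprS; ring.
  - case/eqP: ji; apply: val_inj; rewrite /= inordK ?je //.
    by rewrite ltnS leq_addr.
apply: seriesP => i; apply: (cdvr_separated hO resw wP) => k.
elim: k i => [|k IH] i; last exact: step.
by exists (scoef q i); rewrite mulr1.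
Qed.

Lemma distinguished_prod (cs : seq O) : (forall c, c \in cs -> res c = 0) ->
  distinguished (size cs) (\prod_(c <- cs) (series_T O + c%:A)).
Proof.
elim: cs => [|c cs IH] resc; rewrite ?big_nil ?big_cons.
  by split=> // -[].
have [] := IH (fun d dcs => resc d (mem_behead (s := c :: cs) dcs)) => gm gbig gsmall.
move: (\prod_(_ <- _) _) gm gbig gsmall => g gm gbig gsmall.
have gE i : scoef ((series_T O + c%:A) * g) i = (if i is i'.+1 then scoef g i' else 0) + c * scoef g i.
  rewrite mulrDl scoefD mulr_algl scoefZ; congr (_ + _).
  by case: i => [|i]; rewrite ?scoefTM0 ?scoefTMS.
have rc : res c = 0 by apply: resc; rewrite mem_head.
split=> [|i|i].
- by rewrite gE /= gm gbig // mulr0 addr0.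
- by case: i => // i im; rewrite gE !gbig // ?mulr0 ?addr0 // leqW.
rewrite gE [size _]/= ltnS rmorphD rmorphM rc mul0r addr0.
by case: i => [|i] im; rewrite ?rmorph0 // gsmall.
Qed.

End Weierstrass.

(** * Finite extensions of complete discrete valuation rings *)

Section IntegralClosure.
Variables (O : idomainType) (F : finFieldType) (res : {rmorphism O -> F}).
Hypothesis hO : is_cdvr0 res.
Variables (w : O) (w0 : w != 0) (resw : res w = 0).
Hypothesis wP : forall r, r != 0 -> exists u k, u \is a GRing.unit /\ r = u * w ^+ k.
Variables (L : fieldType) (emb : {rmorphism O -> L}).
Hypothesis emb_inj : injective emb.
Variable d : nat.
Hypothesis algL : forall x : L, exists p : {poly O},
  [/\ p != 0, (size p <= d.+1)%N & (map_poly emb p).[x] = 0].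

Local Notation ev p x := ((map_poly emb p).[x]).
Local Notation integral := (integralOver emb).

Let emb_eq0 a : (emb a == 0) = (a == 0).
Proof. by rewrite -(inj_eq emb_inj) rmorph0. Qed.

Let evE n (p : {poly O}) x : (size p <= n)%N ->
  ev p x = \sum_(i < n) emb p`_i * x ^+ i.
Proof.
move=> sp; rewrite (horner_coef_wide (n := n)); last first.
  exact: leq_trans (size_poly _ _) sp.
by apply: eq_bigr => i _; rewrite coef_map.
Qed.

(** Common factors w are divided out; the exponent of w in the leading coefficient bounds how
    often. *)
Lemma primitive_relation (x : L) : exists p : {poly O},
  [/\ (size p <= d.+1)%N, ev p x = 0 & exists i, res p`_i != 0].
Proof.
have [p [p0 sp px]] := algL x.
have [i [k [u [uU pi]]]] : exists i k u, u \is a GRing.unit /\ p`_i = u * w ^+ k.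
  have l0 : lead_coef p != 0 by rewrite lead_coef_eq0.
  by have [u [k [uU e]]] := wP l0; exists (size p).-1, k, u.
elim: k p {p0} sp px pi => [|k IH] p sp px pi.
  by exists p; split=> //; exists i; rewrite pi mulr1 -(cdvr_unitE hO).
have [[j pj]|nounit] := pselect (exists j, res p`_j != 0).
  by exists p; split=> //; exists j.
have /choice [c cE] : forall j, exists c, p`_j = c * w.
  move=> j; apply: (cdvr_dvd hO wP); apply/eqP; apply: contrapT => /negP pj.
  by apply: nounit; exists j.
pose q := \poly_(j < size p) c j.
have pq : p = w *: q.
  apply/polyP => j; rewrite coefZ coef_poly; case: ltnP => js; first by rewrite cE mulrC.
  by rewrite mulr0 nth_default.
apply: (IH q).
- exact: leq_trans (size_poly _ _) sp.
- move: px; rewrite pq map_polyZ hornerZ => /eqP.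
  by rewrite mulf_eq0 emb_eq0 (negPf w0) => /eqP.
- apply: (mulfI w0); rewrite -coefZ -pq pi exprS; ring.
Qed.

Lemma integral_monic_unit (p : {poly O}) x : lead_coef p \is a GRing.unit ->
  ev p x = 0 -> integral x.
Proof.
move=> lU px; exists ((lead_coef p)^-1 *: p).
  by rewrite monicE lead_coefZ mulVr.
by rewrite rootE map_polyZ hornerZ px mulr0.
Qed.

(** Multiplied by x^(-D), the equation w q(x) = 1 becomes a polynomial equation for 1/x with leading
    coefficient 1 - w q_0, a unit. *)
Lemma integral_inverse x (q : {poly O}) : emb w * ev q x = 1 -> integral x^-1.
Proof.
move=> wq.
have x0 : x != 0 \/ x = 0 by case: (eqVneq x 0); [right | left].
case: x0 => [x0|->]; last by rewrite invr0; exact: integral0.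
pose D := size q; pose r := 'X^D - \poly_(i < D.+1) (w * q`_(D - i)).
have rD : r`_D = 1 - w * q`_0 by rewrite coefB coefXn eqxx coef_poly leqnn subnn.
have rDU : r`_D \is a GRing.unit.
  by rewrite rD (cdvr_unitE hO) rmorphB rmorphM resw mul0r subr0 rmorph1 oner_eq0.
have sr : size r = D.+1.
  apply/eqP; rewrite eqn_leq; apply/andP; split.
    rewrite (leq_trans (size_polyD _ _)) // geq_max size_polyXn leqnn.
    by rewrite size_polyN size_poly.
  by rewrite ltnNge; apply/negP => /(nth_default 0) e; rewrite e unitr0 in rDU.
apply: (@integral_monic_unit r); first by rewrite lead_coefE sr.
apply: (mulfI (expf_neq0 D x0)); rewrite mulr0.
rewrite rmorphB /= map_polyXn hornerD hornerN hornerXn mulrBr -exprMn divff // expr1n.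
suff -> : x ^+ D * ev (\poly_(i < D.+1) (w * q`_(D - i))) x^-1 = emb w * ev q x.
  by rewrite wq subrr.
rewrite (evE (n := D.+1)) ?size_poly // (evE (n := D.+1) (p := q)) ?leqnSn //.
rewrite !mulr_sumr.
rewrite (reindex_inj rev_ord_inj); apply: eq_bigr => i _ /=.
have iD : (i <= D)%N by rewrite -ltnS.
rewrite coef_poly subSS ltnS leq_subr subKn // rmorphM exprVn.
rewrite mulrCA -mulrA; congr (_ * (_ * _)).
by rewrite -{1}(subnK iD) exprD mulrC mulrA mulVf ?mul1r // expf_neq0.
Qed.

(* If x is not integral, then O[x] contains 1/w. *)
Lemma integral_or_inverse x : integral x \/ integral x^-1.
Proof.
have [[q wq]|noinv] := pselect (exists q : {poly O}, emb w * ev q x = 1).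
  by right; exact: integral_inverse wq.
left; have [p [_ px [i0 pi0]]] := primitive_relation x.
have ex : exists i, res p`_i != 0 by exists i0.
have bd i : res p`_i != 0 -> (i <= size p)%N.
  by move=> pi; rewrite leqNgt; apply: contra pi => /ltnW si; rewrite nth_default ?rmorph0.
(* r is the last index with a unit coefficient, so x^r = a(x) + w b(x) with deg a < r; division by
   the monic X^r - a brings every polynomial in x below degree r modulo w. *)
case: (ex_maxnP ex bd) => r pr rmax.
have prU : p`_r \is a GRing.unit by rewrite (cdvr_unitE hO).
pose a := \poly_(i < r) (- (p`_r)^-1 * p`_i).
have monA : 'X^r - a \is monic.
  by rewrite monicE lead_coefDl ?lead_coefXn // size_polyXn size_polyN ltnS size_poly.
have /choice [c cE] : forall i, exists c, (r < i)%N -> p`_i = c * w.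
  move=> i; have [ri|ri] := ltnP r i; last by exists 0.
  have [|c e] := cdvr_dvd hO wP (r := p`_i); last by exists c.
  by apply/eqP; apply: contraLR ri => /rmax; rewrite leqNgt.
pose b := \poly_(i < size p) (if (r < i)%N then - (p`_r)^-1 * c i else 0).
have ab : 'X^r - a - w *: b = (p`_r)^-1 *: p.
  apply/polyP => i; rewrite !coefB !coefZ coefXn !coef_poly.
  have [ri|ir|->] := ltngtP i r.
  - by rewrite if_same mulr0 mulr0n; ring.
  - rewrite mulr0n; case: ltnP => [_|/(nth_default 0) e]; rewrite (cE i) //; first by ring.
    by rewrite -(cE i) // e; ring.
  - by rewrite if_same mulVr // mulr0 mulr1n; ring.
have xr : ev ('X^r - a) x = emb w * ev b x.
  have : ev ('X^r - a - w *: b) x = 0 by rewrite ab map_polyZ hornerZ px mulr0.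
  rewrite [map_poly _ _]rmorphB hornerD hornerN /= map_polyZ hornerZ => /eqP.
  by rewrite subr_eq0 => /eqP.
have step (q : {poly O}) : exists q1 q2 : {poly O},
    (size q1 <= r)%N /\ ev q x = ev q1 x + emb w * ev q2 x.
  exists (q %% ('X^r - a)), (q %/ ('X^r - a) * b); split.
    rewrite -ltnS; have := ltn_modpN0 q (monic_neq0 monA).
    by rewrite size_polyDl ?size_polyXn // size_polyN ltnS size_poly.
  rewrite {1}(Pdiv.IdomainMonic.divp_eq monA q) rmorphD rmorphM !hornerD hornerM /= xr.
  by rewrite rmorphM hornerM addrC; congr (_ + _); rewrite mulrCA.
have /choice [s1] := step => /choice [s2 sE].
(* Iterating, x^r = T_k(x) + w^k Q_k(x) with deg T_k < r, and the T_k converge coefficientwise. *)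
pose Q := fix Q k := if k is k'.+1 then s2 (Q k') else 'X^r.
pose T k := \sum_(j < k) w ^+ j *: s1 (Q j).
have QT k : x ^+ r = ev (T k) x + emb w ^+ k * ev (Q k) x.
  elim: k => [|k IH].
    by rewrite /T big_ord0 rmorph0 horner0 add0r mul1r /= map_polyXn hornerXn.
  rewrite IH {1}(sE (Q k)).2 mulrDr addrA exprSr -mulrA; congr (_ + _).
  by rewrite /T big_ord_recr /= rmorphD hornerD /= map_polyZ hornerZ rmorphXn.
have sT k : (size (T k) <= r)%N.
  apply: (leq_trans (size_sum _ _ _)); apply/bigmax_leqP => j _.
  by apply: (leq_trans (size_scale_leq _ _)); exact: (sE (Q j)).1.
have /choice [l lP] : forall i, exists l, forall k, exists c, (T k)`_i - l = c * w ^+ k.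
  move=> i; apply: (cdvr_complete hO resw wP (u := fun k => (T k)`_i)) => k.
  rewrite /T big_ord_recr /= coefD addrAC subrr add0r coefZ mulrC.
  by exists (s1 (Q k))`_i.
pose Tl := \poly_(i < r) l i.
have TE k : exists e : {poly O}, T k - Tl = w ^+ k *: e.
  have /choice [e eE] : forall i, exists c, (T k)`_i - l i = c * w ^+ k by move=> i; exact: lP.
  exists (\poly_(i < r) e i); apply/polyP => i; rewrite coefB coefZ !coef_poly.
  case: ltnP => ri; first by rewrite eE mulrC.
  by rewrite mulr0 nth_default ?subrr // (leq_trans (sT k)).
(* z is divisible by every power of w in O[x]; if z = 0, then x is integral. *)
pose z := x ^+ r - ev Tl x.
have zE k : exists e : {poly O}, z = emb w ^+ k * ev e x.
  have [e eE] := TE k; exists (e + Q k).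
  have : ev (T k - Tl) x = ev (w ^+ k *: e) x by rewrite eE.
  rewrite [X in X.[x] = _]rmorphB hornerD hornerN /= map_polyZ hornerZ rmorphXn => eE'.
  by rewrite /z (QT k) rmorphD hornerD mulrDr addrAC eE'.
have [z0|z0] := eqVneq z 0.
  exists ('X^r - Tl).
    by rewrite monicE lead_coefDl ?lead_coefXn // size_polyXn size_polyN ltnS size_poly.
  by rewrite rootE rmorphB hornerD hornerN /= map_polyXn hornerXn -/z z0.
exfalso; apply: noinv.
(* Otherwise a relation for z with constant term h_0 = u w^j makes h_0 a multiple of z, hence of
   w^(j+1), in O[x], so 1/w lies in O[x]. *)
have [h h0 hz] : exists2 h : {poly O}, h`_0 != 0 & ev h z = 0.
  have [h [h0 _]] := algL z; elim: (size h) {-2}h (leqnn (size h)) h0 => [|k IH] {}h sh h0 hz.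
    by move: sh h0; rewrite leqn0 size_poly_eq0 => ->.
  have [e|h00] := eqVneq h`_0 0; last by exists h.
  have hE : h = \poly_(i < k) h`_i.+1 * 'X.
    apply/polyP => -[|i]; rewrite coefMX ?e //= coef_poly; case: ltnP => // ki.
    by rewrite nth_default // (leq_trans sh).
  apply: (IH (\poly_(i < k) h`_i.+1)); first exact: size_poly.
    by apply: contraNneq h0 => e0; rewrite hE e0 mul0r.
  move: hz; rewrite {1}hE rmorphM hornerM /= map_polyX hornerX => /eqP.
  by rewrite mulf_eq0 (negPf z0) orbF => /eqP.
have [u [j [uU h0E]]] := wP h0.
pose h1 := \poly_(i < (size h)) h`_i.+1.
have hE : h = h1 * 'X + (h`_0)%:P.
  apply/polyP => -[|i]; rewrite coefD coefMX coefC /= ?add0r // addr0 coef_poly.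
  by case: ltnP => // si; rewrite nth_default // leqW.
have [e0 zE0] := zE 0%N; rewrite mul1r in zE0.
have [e1 zE1] := zE j.+1.
have uw : emb (u * w ^+ j) = - (emb w ^+ j.+1 * ev e1 x * ev (h1 \Po e0) x).
  move: hz; rewrite {1}hE rmorphD rmorphM hornerD hornerM /= map_polyX hornerX.
  rewrite map_polyC hornerC /= h0E => /eqP; rewrite addrC addr_eq0 => /eqP ->.
  by rewrite map_comp_poly horner_comp -zE0 -zE1 mulrC.
exists (- (u^-1) *: (e1 * (h1 \Po e0))).
rewrite map_polyZ hornerZ rmorphM hornerM.
apply: (mulfI (x := emb (u * w ^+ j))).
  by rewrite emb_eq0 mulf_neq0 ?expf_neq0 //; apply: contraTneq uU => ->; rewrite unitr0.
have uV : emb u * emb u^-1 = 1 by rewrite -rmorphM mulrV // rmorph1.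
rewrite mulr1 {2}uw rmorphM rmorphXn rmorphN exprS.
transitivity (- (emb u * emb u^-1) * (emb w * emb w ^+ j * ev e1 x * ev (h1 \Po e0) x)).
  by ring.
by rewrite uV mulN1r.
Qed.

End IntegralClosure.

(** * The residue field of a local ring *)

Section ResidueField.
Variables (A : comUnitRingType).
Hypothesis Aloc : forall x y : A,
  x \isn't a GRing.unit -> y \isn't a GRing.unit -> x + y \isn't a GRing.unit.

(** Locality is an argument so that the ideal structure can be attached to the predicate. *)
Definition nonunit_pred
    of (forall x y : A, x \isn't a GRing.unit -> y \isn't a GRing.unit ->
          x + y \isn't a GRing.unit) : {pred A} :=
  fun x => x \isn't a GRing.unit.
Local Notation nonunits := (nonunit_pred Aloc).

Lemma nonunit_idealr_closed : idealr_closed nonunits.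
Proof.
split=> [||a u v uU vU].
- by change ((0 : A) \isn't a GRing.unit); rewrite unitr0.
- by change (~~ ((1 : A) \isn't a GRing.unit)); rewrite unitr1.
change (a * u + v \isn't a GRing.unit); apply: Aloc => //.
by rewrite unitrM negb_and [u \isn't a _]uU orbT.
Qed.
HB.instance Definition _ := isIdealr.Build A nonunits nonunit_idealr_closed.

Definition residue : Type := Quotient.quot nonunits.
HB.instance Definition _ := GRing.ComNzRing.on residue.

Definition residue_class (x : A) : residue := \pi_(Quotient.quot nonunits)%qT x.

Lemma residue_class_zmod : zmod_morphism residue_class.
Proof. exact: (rmorphB (\pi_(Quotient.quot nonunits)%qT)). Qed.
Lemma residue_class_monoid : monoid_morphism residue_class.
Proof. by split; [exact: rmorph1 | exact: (rmorphM (\pi_(Quotient.quot nonunits)%qT))]. Qed.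
HB.instance Definition _ := GRing.isZmodMorphism.Build A residue residue_class
  residue_class_zmod.
HB.instance Definition _ := GRing.isMonoidMorphism.Build A residue residue_class
  residue_class_monoid.

Lemma residue_class_surj (q : residue) : exists x, residue_class x = q.
Proof. by exists (generic_quotient.repr q); exact: reprK. Qed.

Lemma residue_class_eq0 x : (residue_class x == 0) = (x \isn't a GRing.unit).
Proof.
rewrite -(rmorph0 residue_class); apply/eqP/idP => [/eqP|xU].
  by rewrite /residue_class -Quotient.idealrBE subr0.
by apply/eqP; rewrite /residue_class -Quotient.idealrBE subr0.
Qed.

Definition residue_inv (q : residue) : residue :=
  if q == 0 then 0 else residue_class (generic_quotient.repr q)^-1.

Lemma residue_mulVf q : q != 0 -> residue_inv q * q = 1.
Proof.
move=> q0; rewrite /residue_inv (negPf q0).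
have qE : residue_class (generic_quotient.repr q) = q := reprK q.
rewrite -{2}qE -rmorphM mulVr ?rmorph1 //.
by move: q0; rewrite -{1}qE residue_class_eq0 negbK.
Qed.

Lemma residue_inv0 : residue_inv 0 = 0.
Proof. by rewrite /residue_inv eqxx. Qed.

HB.instance Definition _ := GRing.ComNzRing_isField.Build residue
  residue_mulVf residue_inv0.

Lemma residue_field : exists (E : fieldType) (red : {rmorphism A -> E}),
  (forall q, exists x, red x = q) /\
  forall x, (x \is a GRing.unit) = (red x != 0).
Proof.
exists (residue : fieldType), (residue_class : {rmorphism A -> residue}).
split=> [|x]; first exact: residue_class_surj.
by rewrite residue_class_eq0 negbK.
Qed.

End ResidueField.

Section FiniteField.
Variables (E : fieldType) (s : seq E) (sP : forall x, x \in s).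

(** A copy of E that carries its list of elements, so that the finite structures can be declared on
    it. *)
Definition listed_field of (forall x, x \in s) : Type := E.
Local Notation T := (listed_field sP).
HB.instance Definition _ := GRing.Field.on T.

Let pickle (x : T) : nat := index (x : E) s.
Let unpickle (i : nat) : option T := Some (nth 0 s i : T).
Let pickleK : pcancel pickle unpickle.
Proof. by move=> x; rewrite /unpickle /pickle nth_index. Qed.
HB.instance Definition _ := isCountable.Build T pickleK.

Let finT : Finite.axiom (undup s : seq T).
Proof. by move=> x; rewrite count_uniq_mem ?undup_uniq // mem_undup sP. Qed.
HB.instance Definition _ := isFinite.Build T finT.

Lemma listed_finField : exists (E' : finFieldType) (f : {rmorphism E -> E'}),
  bijective f.
Proof.
by exists (T : finFieldType), (idfun : {rmorphism E -> T}); exists idfun.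
Qed.

End FiniteField.

Lemma root_all_finite (E : fieldType) (q : {poly E}) : q != 0 ->
  (forall x, root q x) -> exists s : seq E, forall x, x \in s.
Proof.
move=> q0 qx; apply: contrapT => nos.
have big k : exists s : seq E, uniq s /\ size s = k.
  elim: k => [|k [s [us sk]]]; first by exists [::].
  have [x xs] : exists x, x \notin s.
    apply: contrapT => nox; apply: nos; exists s => x.
    by apply: contrapT => /negP xs; apply: nox; exists x.
  by exists (x :: s); rewrite /= xs us sk.
have [s [us sk]] := big (size q).
have aq : all (root q) s by apply/allP.
by have := max_poly_roots q0 aq us; rewrite sk ltnn.
Qed.

Section FactorMorphism.
Variables (O : comNzRingType) (F E : fieldType).
Variables (res : {rmorphism O -> F}) (g : {rmorphism O -> E}).
Hypothesis sur : forall a, exists c, res c = a.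
Hypothesis ker : forall c, res c = 0 -> g c = 0.

Definition factor_morphism (a : F) : E := g (projT1 (cid (sur a))).

Lemma factor_morphismE c : factor_morphism (res c) = g c.
Proof.
rewrite /factor_morphism; case: cid => c' /= e; apply/eqP.
by rewrite -subr_eq0 -rmorphB ker // rmorphB e subrr.
Qed.

Lemma factor_morphism_zmod : zmod_morphism factor_morphism.
Proof.
move=> a b; have [c <-] := sur a; have [c' <-] := sur b.
by rewrite -rmorphB !factor_morphismE rmorphB.
Qed.
Lemma factor_morphism_monoid : monoid_morphism factor_morphism.
Proof.
split=> [|a b]; first by rewrite -(rmorph1 res) factor_morphismE rmorph1.
have [c <-] := sur a; have [c' <-] := sur b.
by rewrite -rmorphM !factor_morphismE rmorphM.
Qed.
HB.instance Definition _ := GRing.isZmodMorphism.Build F E factor_morphism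
  factor_morphism_zmod.
HB.instance Definition _ := GRing.isMonoidMorphism.Build F E factor_morphism
  factor_morphism_monoid.

Lemma factor_rmorphism : exists kappa : {rmorphism F -> E},
  forall c, kappa (res c) = g c.
Proof. by exists (factor_morphism : {rmorphism F -> E}); exact: factor_morphismE. Qed.

End FactorMorphism.

(** * From a valuation ring to a complete discrete valuation ring *)

Section ValuationExtension.
Variables (O : idomainType) (F : finFieldType) (res : {rmorphism O -> F}).
Hypothesis hO : is_cdvr0 res.
Variables (w : O) (w0 : w != 0) (resw : res w = 0).
Hypothesis wP : forall r, r != 0 -> exists u k, u \is a GRing.unit /\ r = u * w ^+ k.
Variables (A : idomainType) (iota : {rmorphism O -> A}).
Hypothesis iota_inj : injective iota.
Local Notation W := (iota w).
Local Notation "x %D y" := (exists c, y = c * x) (at level 70).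
Hypothesis total : forall x y : A, x %D y \/ y %D x.
Hypothesis WnU : W \isn't a GRing.unit.
Variable d : nat.
Hypothesis algA : forall x : A, exists p : {poly O}, [/\ (size p <= d.+1)%N,
  (map_poly iota p).[x] = 0 & exists i, res p`_i != 0].

Let nonunitM (c x : A) : x \isn't a GRing.unit -> c * x \isn't a GRing.unit.
Proof. by move=> xU; rewrite unitrM negb_and xU orbT. Qed.

Let nonunitD (x y : A) : x \isn't a GRing.unit -> y \isn't a GRing.unit ->
  x + y \isn't a GRing.unit.
Proof.
move=> xU yU; have [[c ->]|[c ->]] := total x y.
  by rewrite -{1}[x]mul1r -mulrDl nonunitM.
by rewrite -{2}[y]mul1r -mulrDl nonunitM.
Qed.

Let iota0 a : a != 0 -> iota a != 0.
Proof. by rewrite -[X in _ -> _ != X](rmorph0 iota) (inj_eq iota_inj). Qed.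

Let W0 : W != 0. Proof. exact: iota0. Qed.

(** Selects a term of least valuation, expressed through divisibility. *)
Let min_dvd (f : nat -> A) k : exists2 i, (i <= k)%N & forall j, (j <= k)%N -> f i %D f j.
Proof.
elim: k => [|k [i ik iP]].
  by exists 0%N => // j; rewrite leqn0 => /eqP ->; exists 1; rewrite mul1r.
have [[c e]|[c e]] := total (f i) (f k.+1).
  exists i; first exact: leqW.
  move=> j; rewrite leq_eqVlt => /orP [/eqP ->|]; last by rewrite ltnS; exact: iP.
  by exists c.
exists k.+1 => // j; rewrite leq_eqVlt => /orP [/eqP ->|].
  by exists 1; rewrite mul1r.
by rewrite ltnS => /iP [c' ->]; exists (c' * c); rewrite e mulrA.
Qed.

Let iotaU u : u \is a GRing.unit -> iota u \is a GRing.unit.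
Proof. exact: rmorph_unit. Qed.

(* Two terms of an algebraic relation for x have the same valuation. *)
Let power_assoc (x : A) : x != 0 -> exists e u s t,
  [/\ (0 < e <= d)%N, u \is a GRing.unit & x ^+ e * W ^+ s = u * W ^+ t].
Proof.
move=> x0; have [p [sp px [i0 pi0]]] := algA x.
pose f i := iota p`_i * x ^+ i.
have i0d : (i0 <= d)%N.
  rewrite -ltnS (leq_trans _ sp) // ltnNge; apply: contra pi0 => /(nth_default 0) ->.
  by rewrite rmorph0.
have [i id iP] := min_dvd f d.
have fi0 : f i != 0.
  have [c e] := iP _ i0d; apply: contraTneq pi0 => fi; move: e; rewrite fi mulr0 => /eqP.
  rewrite mulf_eq0 expf_eq0 (negPf x0) andbF orbF => pi; rewrite negbK.
  have [->|/iota0/negPf] := eqVneq p`_i0 0; first by rewrite rmorph0.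
  by rewrite pi.
have /choice [c cE] : forall j, exists c, (j <= d)%N -> f j = c * f i.
  move=> j; have [jd|jd] := leqP j d; last by exists 0.
  by have [c e] := iP j jd; exists c.
have sum0 : \sum_(j < d.+1) c j = 0.
  apply: (mulIf fi0); rewrite mul0r -[RHS]px (horner_coef_wide (n := d.+1)); last first.
    exact: leq_trans (size_poly _ _) sp.
  rewrite mulr_suml; apply: eq_bigr => j _; rewrite -cE; last by rewrite -ltnS.
  by rewrite coef_map.
have ci : c i = 1 by apply: (mulIf fi0); rewrite -cE // mul1r.
(* The quotients c_j sum to 0 and c_i = 1; since nonunits are closed under addition, another c_j is
   a unit. *)
have [j [jd ji cU]] : exists j, [/\ (j <= d)%N, j != i & c j \is a GRing.unit].
  apply: contrapT => noj; move: sum0; rewrite -ltnS in id.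
  rewrite (bigD1 (Ordinal id)) //= ci => /eqP; rewrite addrC addr_eq0 => /eqP e.
  have : \sum_(j < d.+1 | j != Ordinal id) c j \isn't a GRing.unit.
    apply: (big_ind (fun a => a \isn't a GRing.unit)) => [||j ji]; rewrite ?unitr0 //.
    apply/negP => cU; apply: noj; exists j; split=> //; first by rewrite -ltnS.
  by rewrite e unitrN unitr1.
have pj0 : p`_j != 0.
  apply: contraTneq cU => pj; have := cE j jd; rewrite /f pj rmorph0 mul0r => /esym/eqP.
  by rewrite mulf_eq0 (negPf fi0) orbF => /eqP ->; rewrite unitr0.
have pi0' : p`_i != 0.
  by apply: contraNneq fi0 => pi; rewrite /f pi rmorph0 mul0r.
have rel : iota p`_j * x ^+ j = c j * (iota p`_i * x ^+ i) by exact: cE.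
have [u1 [k1 [u1U e1]]] := wP pj0; have [u2 [k2 [u2U e2]]] := wP pi0'.
rewrite e1 e2 !rmorphM !rmorphXn in rel.
move: ji; rewrite neq_ltn => /orP [ji|ij].
  exists (i - j)%N, (iota u1 / (c j * iota u2)), k2, k1; split.
  - by rewrite subn_gt0 ji (leq_trans (leq_subr _ _)).
  - by rewrite unitrM unitrV unitrM cU !iotaU.
  apply: (mulfI (expf_neq0 j x0)); rewrite mulrA -exprD subnKC ?(ltnW ji) //.
  have cuU : c j * iota u2 \is a GRing.unit by rewrite unitrM cU iotaU.
  apply: (mulrI cuU); transitivity (iota u1 * W ^+ k1 * x ^+ j); first by rewrite rel; ring.
  transitivity ((c j * iota u2) / (c j * iota u2) * (iota u1 * W ^+ k1 * x ^+ j)).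
    by rewrite divrr // mul1r.
  by ring.
exists (j - i)%N, (c j * iota u2 / iota u1), k1, k2; split.
- by rewrite subn_gt0 ij (leq_trans (leq_subr _ _)).
- by rewrite unitrM unitrV unitrM cU !iotaU.
apply: (mulfI (expf_neq0 i x0)); rewrite mulrA -exprD subnKC ?(ltnW ij) //.
have uU := iotaU u1U; apply: (mulrI uU).
transitivity (iota u1 * W ^+ k1 * x ^+ j); first by ring.
rewrite rel; transitivity (iota u1 * (iota u1)^-1 * (c j * (iota u2 * W ^+ k2 * x ^+ i))).
  by rewrite mulrV // mul1r.
by ring.
Qed.

(** A common multiple of the exponents e <= d in [power_assoc]: the valuation of x^D is an integral
    multiple of that of W. *)
Let D := d`!.

Let power_val (x : A) : x != 0 -> exists k u, u \is a GRing.unit /\ x ^+ D = u * W ^+ k.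
Proof.
move=> x0; have [e [u [s [t [/andP [e0 ed] uU xe]]]]] := power_assoc x0.
have eD : (e %| D)%N by apply: dvdn_fact; rewrite e0.
have {}xe : x ^+ D * W ^+ (s * (D %/ e)) = u ^+ (D %/ e) * W ^+ (t * (D %/ e)).
  by rewrite -{1}(divnK eD) mulnC exprM exprM -exprMn xe exprMn -exprM.
move: (s * _)%N (t * _)%N (u ^+ _) (unitrX (D %/ e) uU) xe => {}s {}t {}u {}uU xe.
have [st|ts] := leqP s t.
  exists (t - s)%N, u; split=> //; apply: (mulIf (expf_neq0 s W0)).
  by rewrite xe -mulrA -exprD subnK.
(* A negative exponent would make W a unit. *)
case/negP: WnU; have : W ^+ (s - t) \is a GRing.unit.
  have : x ^+ D * W ^+ (s - t) = u.
    apply: (mulIf (expf_neq0 t W0)); rewrite -mulrA -exprD subnK ?(ltnW ts) //.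
  by move=> e'; move: uU; rewrite -e' unitrM => /andP [].
by rewrite unitrX_pos // subn_gt0.
Qed.

Let val_pos x k u : x \isn't a GRing.unit -> u \is a GRing.unit ->
  x ^+ D = u * W ^+ k -> (0 < k)%N.
Proof.
move=> xU uU; case: k => // e; case/negP: xU.
by rewrite -(unitrX_pos x (fact_gt0 d)) e mulr1.
Qed.

(** pi is a nonunit whose D-th power has the least exponent of W. Dividing y by pi lowers the
    exponent of y; if y divides pi instead, minimality makes the quotient a unit. *)
Lemma extension_uniformizer : exists pi : A, [/\ pi != 0, pi \isn't a GRing.unit
  & forall y, y != 0 -> exists u k, u \is a GRing.unit /\ y = u * pi ^+ k].
Proof.
pose P k := `[< exists x u, [/\ x != 0, x \isn't a GRing.unit, u \is a GRing.unit
  & x ^+ D = u * W ^+ k] >].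
have exP : exists k, P k.
  by exists D; apply/asboolP; exists W, 1; rewrite W0 WnU unitr1 mul1r.
case: (ex_minnP exP) => k /asboolP [pi [u [pi0 piU uU piE]]] kmin.
have k0 := val_pos piU uU piE.
exists pi; split=> // y y0; have [l [v [vU yE]]] := power_val y0.
elim/ltn_ind: l y v y0 vU yE => l IH y v y0 vU yE.
have [yU|yU] := boolP (y \is a GRing.unit).
  by exists y, 0%N; rewrite mulr1.
have kl : (k <= l)%N by apply: kmin; apply/asboolP; exists y, v.
have [[c yc]|[c pc]] := total pi y; last first.
  exists c^-1, 1%N; suff cU : c \is a GRing.unit.
    by rewrite unitrV cU expr1 pc mulKr.
  rewrite -(unitrX_pos c (fact_gt0 d)) -/D.
  have : u = c ^+ D * v * W ^+ (l - k).
    apply: (mulIf (expf_neq0 k W0)); rewrite -mulrA -exprD subnK // -piE pc exprMn yE.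
    by rewrite mulrA.
  by move=> e; move: uU; rewrite e !unitrM => /andP [/andP []].
have c0 : c != 0 by apply: contraNneq y0 => e; rewrite yc e mul0r.
have cE : c ^+ D = v / u * W ^+ (l - k).
  apply: (mulIf (expf_neq0 k W0)); rewrite -[RHS]mulrA -exprD subnK //.
  apply: (mulIr uU); rewrite -mulrA [W ^+ k * u]mulrC -piE -exprMn -yc yE.
  by rewrite mulrAC divrK.
have [||u' [j [u'U cj]]] := IH (l - k)%N _ c (v / u) c0 _ cE.
- by rewrite ltn_subrL k0 (leq_trans k0 kl).
- by rewrite unitrM unitrV vU uU.
by exists u', j.+1; rewrite yc cj exprSr mulrA.
Qed.

(** Every residue is a root of a nonzero polynomial of degree at most d over F. There are finitely
    many of these, so their product vanishes on the whole residue field, which is therefore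
    finite. *)
Lemma extension_residue : exists (E : finFieldType) (red : {rmorphism A -> E})
    (kappa : {rmorphism F -> E}),
  [/\ forall q, exists x, red x = q, forall x, (x \is a GRing.unit) = (red x != 0)
    & forall c, red (iota c) = kappa (res c)].
Proof.
have [E [red [redsur redU]]] := residue_field nonunitD.
have [_ _ [ressur _ _]] := hO.
have redW : red W = 0 by apply/eqP; rewrite -[_ == _]negbK -redU.
have ker c : res c = 0 -> (red \o iota) c = 0.
  by move=> /(cdvr_dvd hO wP) [c' ->]; rewrite /= !rmorphM redW mulr0.
have [kappa kappaE] := factor_rmorphism ressur ker.
pose pol (f : {ffun 'I_d.+1 -> F}) := \poly_(i < d.+1) f (inord i).
pose Q := \prod_(f | pol f != 0) map_poly kappa (pol f).
have Q0 : Q != 0 by apply/prodf_neq0 => f f0; rewrite map_poly_eq0.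
have [|s sP] := root_all_finite Q0.
  move=> q; have [x <-] := redsur q; have [p [sp px [i pi]]] := algA x.
  pose f := [ffun i : 'I_d.+1 => res p`_i].
  have fE : pol f = map_poly res p.
    apply/polyP => j; rewrite coef_poly coef_map; case: ltnP => jd.
      by rewrite ffunE inordK.
    have -> : p`_j = 0 by apply: nth_default; exact: leq_trans sp jd.
    exact: (esym (rmorph0 res)).
  have f0 : pol f != 0.
    by apply: contraNneq pi => e; rewrite -(coef_map res) -fE e coef0.
  rewrite /Q (bigD1 f) //= rootM; apply/orP; left.
  rewrite fE -map_poly_comp (eq_map_poly kappaE) map_poly_comp rootE horner_map px.
  by rewrite rmorph0.
have [E' [f fbij]] := listed_finField sP.
have finj := bij_inj fbij; case: fbij => g fK gK.
exists E', (f \o red : {rmorphism A -> E'}), (f \o kappa : {rmorphism F -> E'}).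
split=> [q|x|c]; first by have [x xE] := redsur (g q); exists x; rewrite /= xE gK.
  by rewrite redU -(inj_eq finj) rmorph0.
by rewrite /= kappaE.
Qed.

Section Completeness.
Variables (E : finFieldType) (red : {rmorphism A -> E}).
Hypothesis redsur : forall q, exists x, red x = q.
Hypothesis redU : forall x, (x \is a GRing.unit) = (red x != 0).
Variable pi : A.
Hypotheses (pi0 : pi != 0) (piU : pi \isn't a GRing.unit).
Hypothesis piP : forall y, y != 0 -> exists u k, u \is a GRing.unit /\ y = u * pi ^+ k.

Lemma extension_dvd r : red r = 0 -> exists c, r = c * pi.
Proof.
move=> r0; have [->|/piP [u [[|k] [uU e]]]] := eqVneq r 0.
- by exists 0; rewrite mul0r.
- by move: uU; rewrite redU -[u]mulr1 -(expr0 pi) -e r0 eqxx.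
- by exists (u * pi ^+ k); rewrite e exprSr mulrA.
Qed.

(* A is a finite O-module modulo W, hence W-adically complete. *)
Lemma extension_series (v : nat -> A) : exists l, forall J, exists c,
  \sum_(j < J) W ^+ j * v j - l = c * W ^+ J.
Proof.
have [e [u [uU WE]]] : exists e u, u \is a GRing.unit /\ W = u * pi ^+ e.
  by have [u [e [uU WE]]] := piP W0; exists e, u.
have /choice [rep repE] := redsur.
have digits k y : exists (a : nat -> E) y', y = \sum_(i < k) rep (a i) * pi ^+ i + pi ^+ k * y'.
  elim: k y => [|k IH] y; first by exists (fun=> 0), y; rewrite big_ord0 add0r mul1r.
  have [|c yc] := @extension_dvd (y - rep (red y)); first by rewrite rmorphB repE subrr.
  have [a [y' cE]] := IH c; exists (fun i => if i is i'.+1 then a i' else red y), y'.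
  rewrite big_ord_recl mulr1 -addrA -[LHS](subrK (rep (red y))) yc addrC; congr (_ + _).
  rewrite cE mulrDl mulr_suml exprS; congr (_ + _); last by ring.
  by apply: eq_bigr => i _; rewrite exprS; ring.
(* W is a unit times pi^e, so e digits from the finite set of representatives describe y modulo
   W. *)
have step y : exists (a : nat -> E) y', y = \sum_(i < e) rep (a i) * pi ^+ i + W * y'.
  have [a [y' yE]] := digits e y; exists a, (u^-1 * y'); rewrite {1}yE WE.
  congr (_ + _); transitivity (u * u^-1 * (pi ^+ e * y')); last by ring.
  by rewrite mulrV ?mul1r.
have /choice [a] := step => /choice [nxt aE].
(* z_j is the carry into position j when the v_j are rewritten in digits. *)
pose z := fix z j := if j is j'.+1 then nxt (v j' + z j') else 0.
pose b j := a (v j + z j).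
have vz j : v j + z j = \sum_(i < e) rep (b j i) * pi ^+ i + W * z j.+1 by exact: aE.
(* For each position t.1 and digit t.2 the coefficient is a w-adic series of indicators in O, which
   converges; finitely many such limits assemble the sum. *)
have /choice [l lP] : forall t : 'I_e * E, exists l, forall J, exists c,
    \sum_(j < J) w ^+ j * (b j t.1 == t.2)%:R - l = c * w ^+ J.
  move=> t; apply: (cdvr_complete hO resw wP
    (u := fun J => \sum_(j < J) w ^+ j * (b j t.1 == t.2)%:R)) => J.
  rewrite big_ord_recr /= addrAC subrr add0r mulrC.
  by exists (b J t.1 == t.2)%:R.
exists (\sum_(t : 'I_e * E) rep t.2 * pi ^+ t.1 * iota (l t)) => J.
have /choice [c cE] : forall t : 'I_e * E, exists c, \sum_(j < J) w ^+ j * (b j t.1 == t.2)%:R - l t = c * w ^+ J.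
  by move=> t; exact: lP.
have sumE : \sum_(j < J) W ^+ j * v j =
    \sum_(t : 'I_e * E) rep t.2 * pi ^+ t.1 * iota (\sum_(j < J) w ^+ j * (b j t.1 == t.2)%:R)
    + W ^+ J * z J.
  have dig j : \sum_(i < e) rep (b j i) * pi ^+ i =
      \sum_(t : 'I_e * E) rep t.2 * pi ^+ t.1 * (b j t.1 == t.2)%:R.
    rewrite -(pair_bigA _ (fun (i : 'I_e) (q : E) => rep q * pi ^+ i * (b j i == q)%:R)).
    apply: eq_bigr => i _ /=; rewrite (bigD1 (b j i)) //= eqxx mulr1 big1 ?addr0 //.
    by move=> q /negPf qb; rewrite eq_sym qb mulr0.
  elim: (J) => [|j IH].
    rewrite big_ord0 mulr0 addr0 big1 // => t _.
    by rewrite big_ord0 rmorph0 mulr0.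
  have -> : \sum_(j0 < j.+1) W ^+ j0 * v j0 =
      \sum_(j0 < j) W ^+ j0 * v j0 + W ^+ j * v j by rewrite big_ord_recr.
  rewrite IH -addrA [W ^+ j * z j + _]addrC -mulrDr vz dig mulrDr addrA exprSr mulrA.
  congr (_ + _); rewrite mulr_sumr -big_split; apply: eq_bigr => t _ /=.
  by rewrite big_ord_recr /= rmorphD rmorphM rmorphXn rmorph_nat; ring.
exists (\sum_(t : 'I_e * E) rep t.2 * pi ^+ t.1 * iota (c t) + z J).
rewrite sumE addrAC -sumrB mulrDl [z J * _]mulrC; congr (_ + _).
rewrite mulr_suml; apply: eq_bigr => t _.
by rewrite -mulrBr -rmorphB cE rmorphM rmorphXn mulrA.
Qed.

Lemma extension_complete_local : is_complete_local red.
Proof.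
split=> //.
have redpi : red pi = 0 by apply/eqP; rewrite -[_ == _]negbK -redU.
have ipowE := ideal_pow_principal redpi extension_dvd.
split=> [r rI|u uI].
  apply/eqP; apply: contrapT => /negP r0; have [v [k [vU rE]]] := piP r0.
  have [c] := (ipowE _ _).1 (rI k.+1); rewrite rE exprS mulrA => /(mulIf (expf_neq0 k pi0)) vc.
  by case/negP: piU; move: vU; rewrite vc unitrM => /andP [].
have [e [a [aU WE]]] : exists e a, a \is a GRing.unit /\ W = a * pi ^+ e.
  by have [a [e [aU WE]]] := piP W0; exists e, a.
have e0 : (0 < e)%N.
  by case: e WE => // WE; case/negP: WnU; rewrite WE mulr1.
have WpE j : pi ^+ (e * j) = a ^- j * W ^+ j.
  by rewrite WE exprMn -exprM mulKr // unitrX.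
have tele k l : (k <= l)%N -> exists c, u l - u k = c * pi ^+ k.
  move=> /subnK <-; elim: (l - k)%N => [|m [c IH]]; first by exists 0; rewrite subrr mul0r.
  have [c' e'] := (ipowE _ _).1 (uI (m + k)%N).
  exists (c' * pi ^+ m + c); rewrite addSn -(subrKA (u (m + k)%N)) e' IH exprD; ring.
(* Since pi^(ej) is W^j up to a unit, the subsequence u_{ej} has differences W^j v_j and is a W-adic
   series. *)
have /choice [v vE] : forall j, exists v, u (e * j.+1)%N - u (e * j)%N = W ^+ j * v.
  move=> j; have [|c ->] := tele (e * j)%N (e * j.+1)%N; first by rewrite leq_mul2l leqnSn orbT.
  by exists (c * a ^- j); rewrite WpE; ring.
have [l lP] := extension_series v; exists (u 0%N + l) => k; apply/ipowE.
have uE J : u (e * J)%N = u 0%N + \sum_(j < J) W ^+ j * v j.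
  elim: J => [|J IH]; first by rewrite muln0 big_ord0 addr0.
  by rewrite big_ord_recr /= addrA -IH -vE addrC subrK.
have ke : (k <= e * k)%N by rewrite leq_pmull.
have [c1 t1] := tele _ _ ke; have [c2 t2] := lP k.
exists (- c1 + c2 * a ^+ k * pi ^+ (e * k - k)).
have W2 : W ^+ k = a ^+ k * (pi ^+ (e * k - k) * pi ^+ k).
  by rewrite -exprD subnK // WE exprMn -exprM.
transitivity (- (u (e * k)%N - u k) + (\sum_(j < k) W ^+ j * v j - l)).
  by rewrite uE; ring.
by rewrite t1 t2 W2; ring.
Qed.

End Completeness.

Lemma valuation_extension : exists (F' : finFieldType) (res' : {rmorphism A -> F'})
  (kappa : {rmorphism F -> F'}), is_cdvr0_extension res res' iota kappa.
Proof.
have [E [red [kappa [redsur redU kE]]]] := extension_residue.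
have [pi [pi0 piU piP]] := extension_uniformizer.
exists E, red, kappa; split=> //; split; last exact: extension_complete_local piP.
  move=> p; apply/negP; rewrite inE => /andP [pp /eqP pA].
  have /negP := cdvr_char0 hO (prime_gt0 pp); apply; apply/eqP/iota_inj.
  by rewrite rmorph_nat rmorph0.
by exists pi.
Qed.

End ValuationExtension.

(** * The integral closure as a ring *)

Section IntegralRing.
Variables (O : idomainType) (L : fieldType) (emb : {rmorphism O -> L}).

Definition integral_pred : {pred L} := [pred x | `[< integralOver emb x >]].

Lemma integral_predE x : (x \in integral_pred) = `[< integralOver emb x >].
Proof. by []. Qed.

Record intring := IntRing { intval :> L; _ : intval \in integral_pred }.
HB.instance Definition _ := [isSub for intval].
HB.instance Definition _ := [Choice of intring by <:].

Lemma integral_subring : subring_closed integral_pred.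
Proof.
split=> [|x y|x y]; rewrite ?integral_predE; first exact/asboolP/integral1.
  by move=> /asboolP ix /asboolP iy; apply/asboolP; exact: integral_sub.
by move=> /asboolP ix /asboolP iy; apply/asboolP; exact: integral_mul.
Qed.
HB.instance Definition _ :=
  GRing.isSubringClosed.Build L integral_pred integral_subring.
HB.instance Definition _ := [SubChoice_isSubComNzRing of intring by <:].

Definition intring_unit : {pred intring} :=
  [pred x | (val x != 0) && ((val x)^-1 \in integral_pred)].
(** Off the units the inverse must be the identity, which is the default value [x] of [insubd]; 0 is
    covered by 0^-1 = 0. *)
Definition intring_inv (x : intring) : intring := insubd x (val x)^-1.

Lemma intring_invE (x : intring) : (val x)^-1 \in integral_pred ->
  val (intring_inv x) = (val x)^-1.
Proof. by move=> xV; rewrite val_insubd xV. Qed.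

Lemma intring_mulVx : {in intring_unit, left_inverse 1 intring_inv *%R}.
Proof.
move=> x /andP [x0 xV]; apply: val_inj.
by rewrite rmorphM /= intring_invE // mulVf.
Qed.

Lemma intring_unitP x y : y * x = 1 -> intring_unit x.
Proof.
move=> /(congr1 val) yx; have {}yx : val y * val x = 1 := yx.
have x0 : val x != 0 by apply: contra_eq_neq yx => ->; rewrite mulr0 eq_sym oner_eq0.
apply/andP; split=> //; suff <- : val y = (val x)^-1 by exact: valP.
by apply: (mulIf x0); rewrite yx mulVf.
Qed.

Lemma intring_inv_out : {in [predC intring_unit], intring_inv =1 id}.
Proof.
move=> x; rewrite inE /= => xU; apply: val_inj; rewrite val_insubd.
case: ifP => // xV; move: xU; rewrite inE /= xV andbT negbK => /eqP ->.
by rewrite invr0.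
Qed.
HB.instance Definition _ := GRing.ComNzRing_hasMulInverse.Build intring
  intring_mulVx intring_unitP intring_inv_out.

Lemma intring_integral : GRing.integral_domain_axiom intring.
Proof.
move=> x y /(congr1 val) xy; have {xy} /eqP : val x * val y = 0 := xy.
rewrite mulf_eq0 => /orP [] /eqP e; apply/orP; [left | right];
  by apply/eqP/val_inj; rewrite e rmorph0.
Qed.
HB.instance Definition _ :=
  GRing.ComUnitRing_isIntegral.Build intring intring_integral.

Lemma intring_embP c : emb c \in integral_pred.
Proof. by rewrite integral_predE; apply/asboolP/integral_id. Qed.
Definition intring_emb c : intring := IntRing (intring_embP c).
Lemma intring_emb_zmod : zmod_morphism intring_emb.
Proof. by move=> a b; apply: val_inj; rewrite /= rmorphB. Qed.
Lemma intring_emb_monoid : monoid_morphism intring_emb.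
Proof. by split=> [|a b]; apply: val_inj; rewrite /= ?rmorph1 ?rmorphM. Qed.
HB.instance Definition _ :=
  GRing.isZmodMorphism.Build O intring intring_emb intring_emb_zmod.
HB.instance Definition _ :=
  GRing.isMonoidMorphism.Build O intring intring_emb intring_emb_monoid.

End IntegralRing.

Section IntegralExtension.
Variables (O : idomainType) (F : finFieldType) (res : {rmorphism O -> F}).
Hypothesis hO : is_cdvr0 res.

Lemma integral_extension (L : fieldType) (emb : {rmorphism O -> L}) d :
  injective emb ->
  (forall x : L, exists p : {poly O},
    [/\ p != 0, (size p <= d.+1)%N & (map_poly emb p).[x] = 0]) ->
  exists (F' : finFieldType) (res' : {rmorphism intring emb -> F'})
    (kappa : {rmorphism F -> F'}),
    is_cdvr0_extension res res' (intring_emb emb : {rmorphism O -> intring emb}) kappa.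
Proof.
move=> emb_inj algL; have [w [w0 resw wP]] := cdvr_uniformizer hO.
apply: (@valuation_extension O F res hO w w0 resw wP _ _ _ _ _ d).
- by move=> a b /(congr1 val) /emb_inj.
- move=> x y; have [->|x0] := eqVneq x 0; first by right; exists 0; rewrite mul0r.
  have [->|y0] := eqVneq y 0; first by left; exists 0; rewrite mul0r.
  have vx0 : val x != 0 by apply: contraNneq x0 => e; apply/eqP/val_inj; rewrite e rmorph0.
  have vy0 : val y != 0 by apply: contraNneq y0 => e; apply/eqP/val_inj; rewrite e rmorph0.
  have [i|i] := integral_or_inverse hO w0 resw wP emb_inj algL (val x / val y).
    right; have iP : val x / val y \in integral_pred emb by apply/asboolP.
    by exists (IntRing iP); apply: val_inj; rewrite rmorphM /= divfK.
  left; have iP : (val x / val y)^-1 \in integral_pred emb by apply/asboolP.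
  by exists (IntRing iP); apply: val_inj; rewrite rmorphM /= invf_div divfK.
(* If 1/w were integral, clearing denominators in a monic relation would make 1 plus a multiple of w
   equal to 0. *)
- apply/negP => /andP [/= W0]; rewrite integral_predE => /asboolP [p pm].
  rewrite rootE => /eqP pw.
  have [n sp] : exists n, size p = n.+1.
    by exists (size p).-1; rewrite prednK // lt0n size_poly_eq0 monic_neq0.
  have : emb (\sum_(i < n.+1) p`_i * w ^+ (n - i)) = 0.
    transitivity (emb w ^+ n * (map_poly emb p).[(emb w)^-1]); last by rewrite pw mulr0.
    rewrite (horner_coef_wide (n := n.+1)); last by rewrite -sp size_poly.
    rewrite rmorph_sum mulr_sumr; apply: eq_bigr => i _.
    rewrite coef_map rmorphM rmorphXn exprVn mulrCA; congr (_ * _).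
    have le_in : (i <= n)%N by rewrite -ltnS.
    apply: (mulIf (expf_neq0 i W0)); rewrite divfK ?expf_neq0 //.
    by rewrite -exprD subnK.
  rewrite -(rmorph0 emb) => /emb_inj; rewrite big_ord_recr /= subnn mulr1.
  move: pm; rewrite monicE lead_coefE sp => /eqP -> /(congr1 res).
  rewrite rmorphD rmorph1 rmorph0 rmorph_sum big1 => [|i _].
    by rewrite add0r => /eqP; rewrite oner_eq0.
  by rewrite rmorphM rmorphXn resw expr0n subn_eq0 leqNgt ltn_ord mulr0.
- move=> x; have [p [sp px pr]] := primitive_relation hO w0 wP emb_inj algL (val x).
  exists p; split=> //; apply: val_inj; rewrite rmorph0 -px.
  rewrite -horner_map -map_poly_comp; congr (_.[_]); exact: eq_map_poly.
Qed.

End IntegralExtension.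

Lemma irreducible_factor (K : fieldType) (g : {poly K}) : (1 < size g)%N ->
  exists2 h, irreducible_poly h & h %| g.
Proof.
have [N] := ubnP (size g); elim: N g => // N IH g /ltnSE gN g1.
have [irr|nirr] := pselect (irreducible_poly g); first by exists g.
have [h [h1 hg nhg]] : exists h : {poly K}, [/\ size h != 1%N, h %| g & ~~ (h %= g)].
  apply: contrapT => no; apply: nirr; split=> // q q1 qg.
  by apply/negPn/negP => nqg; apply: no; exists q.
have g0 : g != 0 by rewrite -size_poly_gt0 (ltn_trans _ g1).
have h0 : h != 0 by apply: contraTneq hg => ->; rewrite dvd0p.
have hs : (size h < size g)%N.
  by rewrite ltn_neqAle dvdp_leq // andbT; apply: contra nhg; rewrite (dvdp_size_eqp hg).
have [||q qirr qh] := IH h; first exact: leq_trans hs gN.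
  by rewrite ltn_neqAle eq_sym h1 size_poly_gt0.
by exists q => //; exact: dvdp_trans qh hg.
Qed.

Lemma clear_denominators (O : idomainType) (p : {poly {fraction O}}) :
  exists c (q : {poly O}), c != 0 /\ map_poly (@tofrac O) q = tofrac c *: p.
Proof.
elim/poly_ind: p => [|p a [c [q [c0 qE]]]].
  by exists 1, 0; rewrite oner_neq0 rmorph0 scaler0.
have [b [d [d0 bE]]] : exists b d, d != 0 /\ tofrac b = a * tofrac d.
  elim/quotW: a => x; exists (frac x).1, (frac x).2; split; first exact: denom_ratioP.
  unlock FracField.tofrac; rewrite -[RHS]FracField.pi_mul; apply/eqmodP.
  rewrite /= FracField.equivfE /FracField.mulf !numden_Ratio ?mulf_neq0 ?denom_ratioP ?oner_neq0 //.
  by apply/eqP; ring.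
exists (c * d), (d *: q * 'X + (c * b)%:P); split; first by rewrite mulf_neq0.
rewrite rmorphD /= rmorphM /= map_polyX map_polyC map_polyZ qE /= !tofracM bE.
by rewrite -!mul_polyC !polyCM; ring.
Qed.

(** A root is adjoined to the fraction field through an irreducible factor of g. As g is monic, the
    root lies in the integral closure, and the dimension of the extension bounds the degrees of
    relations. *)
Lemma root_extension (O : idomainType) (F : finFieldType) (res : {rmorphism O -> F})
    (g : {poly O}) :
  is_cdvr0 res -> g \is monic -> (1 < size g)%N ->
  exists (O' : idomainType) (F' : finFieldType) (res' : {rmorphism O' -> F'})
    (iota : {rmorphism O -> O'}) (kappa : {rmorphism F -> F'}),
    is_cdvr0_extension res res' iota kappa /\
    exists b, root (map_poly iota g) b.
Proof.
move=> hO gm g1; pose tf : {rmorphism O -> {fraction O}} := @tofrac O.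
have tf_inj : injective tf by move=> a b /eqP; rewrite tofrac_eq => /eqP.
have [|h hirr hg] := @irreducible_factor _ (map_poly tf g).
  by rewrite size_map_poly_id0 ?tofrac_eq0 ?lead_coef_eq0 ?monic_neq0.
have [L _ [z hz _]] := irredp_FAdjoin hirr.
pose emb : {rmorphism O -> L} := in_alg L \o tf.
have emb_inj : injective emb by move=> a b /fmorph_inj /tf_inj.
have gz : root (map_poly emb g) z.
  rewrite map_poly_comp; apply: root_dvdp hz.
  by rewrite (dvdp_map (in_alg L)).
have algL (x : L) : exists p : {poly O},
    [/\ p != 0, (size p <= (\dim {:L}).+1)%N & (map_poly emb p).[x] = 0].
  have /polyOver1P [q qE] := minPolyOver 1%AS x.
  have [c [p [c0 pE]]] := clear_denominators q.
  have cF : tofrac c != 0 by rewrite tofrac_eq0.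
  have sq : size p = size q.
    by rewrite -(size_map_inj_poly tf_inj (rmorph0 tf) p) pE size_scale.
  have sm : size q = (adjoin_degree 1%AS x).+1 by rewrite -size_minPoly qE size_map_poly.
  exists p; split.
  - by rewrite -size_poly_eq0 sq sm.
  - rewrite sq sm ltnS; have := dim_Fadjoin 1%AS x; rewrite dimv1 muln1 => <-.
    exact: dimvS (subvf _).
  - rewrite map_poly_comp pE map_polyZ hornerZ -qE minPolyxx mulr0 //.
have [F' [res' [kappa ext]]] := integral_extension hO emb_inj algL.
exists (intring emb), F', res', (intring_emb emb), kappa; split=> //.
have zP : z \in integral_pred emb by rewrite integral_predE; apply/asboolP; exists g.
exists (IntRing zP); apply/rootP/val_inj; move/rootP: gz; rewrite rmorph0 => <-.
rewrite -horner_map -map_poly_comp; congr (_.[_]); exact: eq_map_poly.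
Qed.

Lemma extension_trans (O O1 O2 : idomainType) (F F1 F2 : fieldType)
    (res : {rmorphism O -> F}) (res1 : {rmorphism O1 -> F1}) (res2 : {rmorphism O2 -> F2})
    (iota : {rmorphism O -> O1}) (kappa : {rmorphism F -> F1})
    (iota1 : {rmorphism O1 -> O2}) (kappa1 : {rmorphism F1 -> F2}) :
  is_cdvr0_extension res res1 iota kappa -> is_cdvr0_extension res1 res2 iota1 kappa1 ->
  is_cdvr0_extension res res2 (iota1 \o iota) (kappa1 \o kappa).
Proof.
move=> [_ i e] [hO2 i1 e1]; split=> //; first exact: inj_comp.
by move=> c /=; rewrite e1 e.
Qed.

(** Roots are adjoined one at a time, each over the extension already built; the cofactor of a root
    remains monic. *)
Lemma splitting_extension (O : idomainType) (F : finFieldType) (res : {rmorphism O -> F})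
    (g : {poly O}) :
  is_cdvr0 res -> g \is monic ->
  exists (O' : idomainType) (F' : finFieldType) (res' : {rmorphism O' -> F'})
    (iota : {rmorphism O -> O'}) (kappa : {rmorphism F -> F'}),
    is_cdvr0_extension res res' iota kappa /\
    exists bs : seq O', map_poly iota g = \prod_(b <- bs) ('X - b%:P).
Proof.
have [N] := ubnP (size g); elim: N O F res g => // N IH O F res g /ltnSE gN hO gm.
have [g1|g1] := leqP (size g) 1.
  exists O, F, res, idfun, idfun; split; first by split.
  exists [::]; rewrite big_nil map_poly_id //.
  have /size_poly1P [c _ gc] : size g == 1%N by rewrite eqn_leq g1 size_poly_gt0 monic_neq0.
  by move: gm; rewrite monicE gc lead_coefC => /eqP ->.
have [O1 [F1 [res1 [iota [kappa [ext [b rb]]]]]]] := root_extension hO gm g1.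
have [hO1 _ _] := ext; have /factor_theorem [q qE] := rb.
have gm1 : map_poly iota g \is monic by exact: monic_map.
have qm : q \is monic by move: gm1; rewrite qE monicMr // monicXsubC.
have sq : size g = (size q).+1.
  rewrite -(size_map_poly_id0 (f := iota)) ?qE ?size_Mmonic ?monic_neq0 ?monicXsubC //.
    by rewrite size_XsubC addn2.
  by rewrite (eqP gm) rmorph1 oner_neq0.
have [|O2 [F2 [res2 [iota1 [kappa1 [ext1 [bs qbs]]]]]]] := IH O1 F1 res1 q _ hO1 qm.
  by rewrite -sq.
exists O2, F2, res2, (iota1 \o iota), (kappa1 \o kappa); split.
  exact: extension_trans ext1.
exists (iota1 b :: bs); rewrite map_poly_comp qE rmorphM /= qbs big_cons mulrC.
by rewrite rmorphB /= map_polyX map_polyC.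
Qed.

(** * The L-function *)

Lemma det_mx2_sub1 (R : comNzRingType) (M : 'M[R]_2) : \det (M - 1%:M) = \det M - \tr M + 1.
Proof.
rewrite [in RHS](mx2E M) det_mx2 tr_mx2 (mx2E (M - 1%:M)) det_mx2 !mxE /=.
by rewrite mulr1n mulr0n; ring.
Qed.

Lemma principal_ideal_unit (R : comUnitRingType) (u c : R) :
  u \is a GRing.unit -> principal_ideal (u * c) = principal_ideal c.
Proof.
move=> uU; apply/seteqP; split=> x [s ->]; first by exists (s * u); rewrite mulrA.
by exists (s * u^-1); rewrite mulrA divrK.
Qed.

Section LFunction.
Variables (n : int) (R : comUnitRingType) (F : fieldType) (res : {rmorphism R -> F}).
Hypothesis unitE : forall r, (r \is a GRing.unit) = (res r != 0).
Variables (rho : sl2rep (twist_group n) R) (abar : F).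
Local Notation A := (rho (twist_a n)).
Local Notation B := (rho (twist_b n)).
Local Notation X := (\tr A).
Local Notation Y := (\tr (A *m B)).
Hypotheses (fXY : fval n X Y = 0) (resX : res X = abar) (resY : res Y = abar).
Hypotheses (kbar : kval n abar = 0) (two_neq0 : (2 : F) != 0).
Hypothesis zbar : 2 - zed abar abar != 0.

Let abar0 : abar != 0.
Proof.
by apply: contraNneq (oner_neq0 F) => a0; rewrite -(kval_root_S kbar) {1}a0 !mul0r.
Qed.
Let abar2 : abar - 2 != 0.
Proof.
by apply: contraNneq (oner_neq0 F) => a0; rewrite -(kval_root_S kbar) a0 mulr0 mul0r.
Qed.
Let sbar : cheb (zed abar abar) n != 0.
Proof.
by apply: contraNneq (oner_neq0 F) => a0; rewrite -(kval_root_S kbar) a0 mulr0.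
Qed.

Let resz : res (zed X Y) = zed abar abar.
Proof. by rewrite /zed !(rmorph_nat, rmorphXn, rmorphB, rmorphD, rmorphM) resX resY. Qed.

(** In the residue field the extra factors of [det_relator_fox] are products of 2, abar, abar - 2,
    S_n(z) and 2 - z up to sign; none vanishes, in view of [kval_root_S]. *)
Lemma relator_fox_associated : exists2 u, u \is a GRing.unit &
  \det (relator_fox A B n) = u * (Y - X) ^+ 2.
Proof.
have := det_relator_fox (rep_det rho _) (rep_det rho _) (rep_tr_ab rho) fXY.
set P := ((2 - Y) * _); set Q := ((2 - _) ^+ 2); set N := (2 * _ * cheb _ n) => e.
have QU : Q \is a GRing.unit.
  by rewrite unitE /Q rmorphXn rmorphB rmorph_nat resz expf_neq0.
have NU : N \is a GRing.unit.
  by rewrite unitE /N !rmorphM rmorphB rmorph_nat rmorph_cheb resz resX !mulf_neq0.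
have PU : P \is a GRing.unit.
  rewrite unitE /P !(rmorph_nat, rmorphXn, rmorphM, rmorphB, rmorphD) rmorph_cheb.
  rewrite resz resX resY mulf_neq0 //; first by rewrite -oppr_eq0 opprB.
  have := kval_root_S kbar; set S := cheb _ n => aS.
  (* The relation abar (abar - 2) S = 1 removes S from this factor. *)
  have -> : (abar - 2) * (abar ^+ 2 - abar ^+ 2 * abar + abar ^+ 2) * S
      + (abar + abar - abar ^+ 2) = - (2 * abar * (abar - 2)).
    transitivity (abar * (abar - 2) * S * (abar * (2 - abar)) + abar * (2 - abar)); first by ring.
    by rewrite aS; ring.
  by rewrite oppr_eq0 !mulf_neq0.
exists (P^-1 * N); first by rewrite unitrM unitrV PU NU.
apply: (mulrI PU); apply: (mulrI QU).
transitivity (P * (Q * \det (relator_fox A B n))); first by ring.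
rewrite e; transitivity (P * P^-1 * (N * (Y - X) ^+ 2 * Q)); first by rewrite mulrV ?mul1r.
by ring.
Qed.

Lemma meridian_unit : A - 1%:M \in unitmx.
Proof.
rewrite unitmxE; have dA := rep_det rho (twist_a n).
have -> : \det (A - 1%:M) = 2 - X by rewrite det_mx2_sub1 dA; ring.
by rewrite unitE rmorphB rmorph_nat resX -opprB oppr_eq0.
Qed.

(** The square presentation reduces the order to det D, which generates the ideal of c^2; since c^2
    is nonzero, so is det D, and the module is torsion. *)
Lemma L_functionE (v c d : R) : v \is a GRing.unit -> Y - X = v * c -> c ^+ 2 != 0 ->
  is_L_function rho d <-> principal_ideal (c ^+ 2) = principal_ideal d.
Proof.
move=> vU e c0; have [u uU uE] := relator_fox_associated.
have [m mP] := homology1_presentation meridian_unit.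
have dE : \det (relator_fox A B n) = (u * v ^+ 2) * c ^+ 2 by rewrite uE e; ring.
have uvU : u * v ^+ 2 \is a GRing.unit by rewrite unitrM uU unitrX.
rewrite -(principal_ideal_unit _ uvU) -dE -(is_order_square d mP); split=> [[]//|dO].
split=> //; apply: torsion_square mP _.
by apply: contraNneq c0 => d0; apply/eqP/(mulrI uvU); rewrite mulr0 -dE.
Qed.

End LFunction.

Section Diagonal.
Variables (n : int) (R : comUnitRingType) (F : fieldType) (res : {rmorphism R -> F}).
Hypothesis unitE : forall r, (r \is a GRing.unit) = (res r != 0).
Variables (t y : R).
Hypotheses (rest : res y = res t) (kbar : kval n (res t) = 0) (two_neq0 : (2 : F) != 0).

Let lvalU : lval t n \is a GRing.unit.
Proof.
rewrite unitE; have [u uE] := kval_lval_coprime kbar.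
have -> : res (lval t n) = lval (res t) n.
  by rewrite /lval; case: odd; rewrite rmorphB !rmorph_cheb rmorphB rmorph1.
have : (4 : F) != 0 by rewrite -[4%:R]/((2 * 2)%:R : F) natrM mulf_neq0.
by apply: contraNneq => l0; rewrite -uE l0 mulr0.
Qed.

(** p is a slice of f_n. Its values at y and t differ by a unit times y - t, and they are 0 and -
    k_n l_n with l_n a unit. *)
Let associated (p : {poly R}) : p.[t] = fval n t t -> p.[y] = 0 ->
  res p^`().[t] != 0 -> exists2 v, v \is a GRing.unit & y - t = v * kval n t.
Proof.
move=> pt py dp; have [u uU e] := horner_diff_unit unitE (esym rest) dp.
exists (u^-1 * lval t n); first by rewrite unitrM unitrV uU.
apply: (mulrI uU); rewrite -e py pt fval_diag_factor.
transitivity (u * u^-1 * (kval n t * lval t n)); first by rewrite mulrV //; ring.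
by ring.
Qed.

Lemma diagonal_y : fval n t y = 0 ->
  int_eval2 (dy_poly (f_poly n)) (res t) (res t) != 0 ->
  exists2 v, v \is a GRing.unit & y - t = v * kval n t.
Proof.
move=> fty dy; apply: (associated (p := fpolY n t)); rewrite ?horner_fpolY //.
by rewrite deriv_fpolY rmorph_int_eval2.
Qed.

Lemma diagonal_x : fval n y t = 0 ->
  int_eval2 (dx_poly (f_poly n)) (res t) (res t) != 0 ->
  exists2 v, v \is a GRing.unit & y - t = v * kval n t.
Proof.
move=> fty dx; apply: (associated (p := fpolX n t)); rewrite ?horner_fpolX //.
by rewrite deriv_fpolX rmorph_int_eval2.
Qed.

End Diagonal.

Lemma prod_XsubC_uniq (R : idomainType) (bs : seq R) :
  (forall b, b \in bs -> (\prod_(c <- bs) ('X - c%:P))^`().[b] != 0) -> uniq bs.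
Proof.
elim: bs => //= c bs IH dn.
have derivE x : (\prod_(b <- c :: bs) ('X - b%:P))^`().[x] =
    (\prod_(b <- bs) ('X - b%:P)).[x] + (x - c) * (\prod_(b <- bs) ('X - b%:P))^`().[x].
  by rewrite big_cons derivM derivXsubC mul1r hornerD hornerM hornerXsubC.
have root0 x : x \in bs -> (\prod_(b <- bs) ('X - b%:P)).[x] = 0.
  by move=> xbs; apply/eqP; rewrite -rootE root_prod_XsubC.
apply/andP; split.
  apply/negP => cbs; have := dn c (mem_head _ _).
  by rewrite derivE root0 // subrr mul0r addr0 eqxx.
apply: IH => b bbs; have := dn b; rewrite in_cons bbs orbT => /(_ isT).
by rewrite derivE root0 // add0r; apply: contraNneq => ->; rewrite mulr0.
Qed.

Lemma mup_map (F F' : fieldType) (kappa : {rmorphism F -> F'}) (p : {poly F}) x :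
  p != 0 -> mup (kappa x) (map_poly kappa p) = mup x p.
Proof.
move=> p0; have kp0 : map_poly kappa p != 0 by rewrite map_poly_eq0.
have dvdE k : (('X - (kappa x)%:P) ^+ k %| map_poly kappa p) = (('X - x%:P) ^+ k %| p).
  by rewrite -(dvdp_map kappa) rmorphXn /= rmorphB /= map_polyX map_polyC.
apply/eqP; rewrite eqn_leq (mup_geq _ _ p0) -dvdE -(mup_geq _ _ kp0) leqnn.
by rewrite (mup_geq _ _ kp0) dvdE -(mup_geq _ _ p0) leqnn.
Qed.

Lemma mup_simple (F : fieldType) (p : {poly F}) x :
  root p x -> p^`().[x] != 0 -> mup x p = 1%N.
Proof.
move=> px dp; have p0 : p != 0 by apply: contraNneq dp => ->; rewrite deriv0 horner0.
apply/eqP; rewrite eqn_leq mup_leq // mup_geq // expr1 dvdp_XsubCl px andbT.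
apply: contra dp => /dvdpP [q ->].
rewrite expr2 mulrA [q * _ * _]mulrC derivM derivXsubC mul1r hornerD !hornerM !hornerXsubC.
by rewrite subrr mulr0 mul0r addr0.
Qed.

Lemma scoefTXM (R : comNzRingType) k (f : series R) i :
  scoef (series_T R ^+ k * f) i = if (i < k)%N then 0 else scoef f (i - k).
Proof.
elim: k i => [|k IH] i; first by rewrite mul1r subn0.
by rewrite exprS -mulrA; case: i => [|i]; rewrite ?scoefTM0 ?scoefTMS ?IH.
Qed.

Section KSeries.
Variables (n : int) (O : idomainType) (F : finFieldType) (resO : {rmorphism O -> F}).
Hypothesis hO : is_cdvr0 resO.

Lemma kpol_neq0 (R : idomainType) : kpol R n != 0.
Proof.
have [e eE] := lead_kpol R n.
by rewrite -lead_coef_eq0 eE expf_neq0 // oppr_eq0 oner_neq0.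
Qed.

Lemma kval_simple_root (b : O) : kval n b = 0 -> (kpol O n)^`().[b] != 0.
Proof.
move=> kb; have [u uE] := kval_deriv_root kb; have := cdvr_char0 hO.
move=> c0; apply: contra_eq_neq uE => ->; rewrite mulr0 eq_sym mulf_neq0 ?c0 //.
(* 3n - 1 is a nonzero integer, being prime to 3. *)
have : (0 < `|(3 * n - 1)%R|)%N by lia.
move=> /c0; case: (3 * n - 1) => k; first by rewrite absz_nat.
by rewrite NegzE abszN absz_nat rmorphN oppr_eq0.
Qed.

Variable alpha : O.
Hypothesis kalpha : kval n alpha = 0.
Local Notation t := (series_var alpha).

Lemma series_var_subC : t - alpha%:A = series_T O.
Proof. by rewrite /series_var addrC addKr. Qed.

Lemma kval_series : exists q,
  kval n t = series_T O * (((kpol O n)^`().[alpha])%:A + series_T O * q).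
Proof.
have [q qE] := horner_taylor2 (kpol (series O) n) alpha%:A (series_T O).
exists q; rewrite -[kval n t]horner_kpol qE horner_kpol.
rewrite -[alpha%:A]/(in_alg (series O) alpha) -rmorph_kval kalpha rmorph0 add0r.
rewrite -(map_kpol (in_alg (series O))) deriv_map horner_map /=; ring.
Qed.

Lemma series_T_reg (f : series O) : series_T O * f = 0 -> f = 0.
Proof. by move=> e; apply: seriesP => i; rewrite -scoefTMS e. Qed.

Lemma kval_series_neq0 : kval n t != 0.
Proof.
have [q ->] := kval_series; apply: contraNneq (kval_simple_root kalpha).
move=> /series_T_reg /(congr1 (fun f => scoef f 0)); rewrite scoefD scoefTM0 scoefC.
by rewrite addr0 /= mulr1 => ->.
Qed.

Lemma kval_series_sqr_neq0 : kval n t ^+ 2 != 0.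
Proof.
apply: contraNneq kval_series_neq0; rewrite expr2 => e; apply/eqP.
exact: (series_mul_eq0 e kval_series_neq0).
Qed.

(** Over F, k_n = (X - a)^m h with h(a) nonzero, and substituting a + T for X turns the first factor
    into T^m. *)
Lemma kval_series_residue : exists2 H : series F, scoef H 0 != 0 &
  series_map resO (kval n t) = series_T F ^+ mup (resO alpha) (kpol F n) * H.
Proof.
set a := resO alpha; set m := mup a _; have k0 := kpol_neq0 F.
have /dvdpP [h hE] : ('X - a%:P) ^+ m %| kpol F n by rewrite -mup_geq.
have ha : h.[a] != 0.
  rewrite -rootE -dvdp_XsubCl; have : ~~ (('X - a%:P) ^+ m.+1 %| kpol F n) by rewrite -mup_leq.
  apply: contra => /dvdpP [g gE]; apply/dvdpP; exists g.
  by rewrite hE gE exprS mulrA.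
exists (map_poly (in_alg (series F)) h).[series_var a].
  have -> : forall f : series F, scoef f 0 = scoef0 f by [].
  rewrite -horner_map -map_poly_comp map_poly_id => [|c _]; last first.
    by rewrite /= /scoef0 /= mulr1.
  by rewrite rmorphD /scoef0 /= mulr1 addr0.
have -> : series_map resO (kval n t) = kval n (series_var a).
  rewrite /a -(series_map_var resO alpha); exact: (rmorph_kval n (series_map resO)).
rewrite -horner_kpol.
rewrite -(map_kpol (in_alg (series F))) hE rmorphM rmorphXn /= rmorphB /= map_polyX map_polyC.
by rewrite hornerM horner_exp hornerXsubC /= mulrC /series_var addrC addKr.
Qed.

Lemma weierstrass_kval : exists q : series O, q \is a GRing.unit /\
  distinguished resO (mup (resO alpha) (kpol F n)) (q * kval n t).
Proof.
have [H H0 HE] := kval_series_residue.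
have coefE i : resO (scoef (kval n t) i) = scoef (series_T F ^+ mup (resO alpha) (kpol F n) * H) i.
  by rewrite -HE.
apply: (weierstrass_preparation hO) => [i im|].
  by rewrite coefE scoefTXM im.
by rewrite (cdvr_unitE hO) coefE scoefTXM ltnn subnn.
Qed.

End KSeries.

Lemma idomain_roots_prod_XsubC (R : idomainType) (p : {poly R}) (s : seq R) :
  uniq s -> (forall b, b \in s -> root p b) ->
  exists q, p = q * \prod_(b <- s) ('X - b%:P).
Proof.
elim: s p => [|c s IH] p /=; first by exists p; rewrite big_nil mulr1.
move=> /andP [cs us] sP; have /factor_theorem [p' pE] := sP c (mem_head _ _).
have [|q qE] := IH p' us.
  move=> b bs; have := sP b; rewrite in_cons bs orbT pE rootM => /(_ isT) /orP [//|].
  by rewrite root_XsubC => /eqP bc; move: cs; rewrite -bc bs.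
by exists q; rewrite big_cons pE qE -mulrA [_ * ('X - _)]mulrC.
Qed.

Lemma intr_eq0_pchar (F : fieldType) (p : nat) (z : int) : p \in [pchar F] ->
  (z%:~R == 0 :> F) = (p%:Z %| z)%Z.
Proof.
move=> hp; rewrite dvdzE absz_nat (dvdn_pcharf hp); case: z => k; first by rewrite absz_nat.
by rewrite NegzE rmorphN oppr_eq0 abszN absz_nat.
Qed.

Section Roots.
Variables (n : int) (O : idomainType) (F : finFieldType) (resO : {rmorphism O -> F}).
Hypothesis hO : is_cdvr0 resO.
Variables (alpha : O) (abar : F).
Hypotheses (kalpha : kval n alpha = 0) (alpha_lift : resO alpha = abar).
Local Notation t := (series_var alpha).
Local Notation m := (mup abar (kpol F n)).

(** Distinct roots in the domain O' split off as linear factors of k_n, all of which have the same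
    reduction. *)
Lemma lifts_le_mup (O' : idomainType) (F' : finFieldType)
    (resO' : {rmorphism O' -> F'}) (iota : {rmorphism O -> O'})
    (kappa : {rmorphism F -> F'}) (s : seq O') :
  is_cdvr0_extension resO resO' iota kappa -> uniq s ->
  (forall b, b \in s -> lifts_of_root n resO' kappa abar b) -> (size s <= m)%N.
Proof.
move=> _ us sP; rewrite -(mup_map kappa _ (kpol_neq0 n F)) map_kpol mup_geq ?kpol_neq0 //.
have [|q qE] := @idomain_roots_prod_XsubC _ (kpol O' n) s us; last first.
  rewrite -(map_kpol resO') qE rmorphM /= rmorph_prod dvdp_mull //.
  rewrite big_seq (eq_bigr (fun=> 'X - (kappa abar)%:P)) => [|b bs]; last first.
    by have [_ <-] := sP b bs; rewrite rmorphB /= map_polyX map_polyC.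
  by rewrite -big_seq big_const_seq count_predT iter_mulr_1.
  by move=> b /sP [kb _]; rewrite rootE horner_kpol -int_eval_k kb eqxx.
Qed.

(** A unit multiple of k_n(t) and the product over the roots lifting abar are both distinguished of
    degree m, and the second divides the first, so they are equal. *)
Lemma lifts_exist : exists (O' : idomainType) (F' : finFieldType)
    (resO' : {rmorphism O' -> F'}) (iota : {rmorphism O -> O'})
    (kappa : {rmorphism F -> F'}) (s : seq O') (q : series O),
  [/\ is_cdvr0_extension resO resO' iota kappa,
      uniq (iota alpha :: s) /\ size (iota alpha :: s) = m,
      forall b, b \in iota alpha :: s <-> lifts_of_root n resO' kappa abar b,
      q \is a GRing.unit
    & series_map iota (q * kval n t) =
      \prod_(b <- iota alpha :: s) (series_var (iota alpha) - b%:A)].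
Proof.
have [e eE] := lead_kpol O n.
have gm : (-1) ^+ e *: kpol O n \is monic.
  by rewrite monicE lead_coefZ eE -exprMn mulrNN mul1r expr1n.
have [O' [F' [resO' [iota [kappa [ext [bs bsE]]]]]]] := splitting_extension hO gm.
have [hO' iota_inj resE] := ext.
have {}bsE : kpol O' n = (-1) ^+ e *: \prod_(b <- bs) ('X - b%:P).
  rewrite -bsE map_polyZ map_kpol rmorphXn rmorphN1 scalerA -exprMn mulrNN mul1r.
  by rewrite expr1n scale1r.
have sgn0 : (-1) ^+ e != 0 :> O' by rewrite expf_neq0 // oppr_eq0 oner_neq0.
have kroot b : (kval n b == 0) = (b \in bs).
  by rewrite -horner_kpol bsE hornerZ mulf_eq0 (negPf sgn0) -rootE root_prod_XsubC.
have ubs : uniq bs.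
  apply: prod_XsubC_uniq => b; rewrite -kroot => /eqP /(kval_simple_root hO').
  by rewrite bsE derivZ hornerZ mulf_eq0 (negPf sgn0).
pose B := [seq b <- bs | resO' b == kappa abar].
have alphaB : iota alpha \in B.
  by rewrite mem_filter resE alpha_lift eqxx -kroot -rmorph_kval kalpha rmorph0 eqxx.
(* The multiplicity of abar counts the linear factors whose root reduces to it. *)
have sB : size B = m.
  rewrite -(mup_map kappa _ (kpol_neq0 n F)) map_kpol -(map_kpol resO') bsE map_polyZ.
  rewrite -mul_polyC mupMr; last first.
    by rewrite rootC rmorphXn rmorphN1 expf_neq0 // oppr_eq0 oner_neq0.
  rewrite rmorph_prod (eq_bigr (fun b => 'X - (resO' b)%:P)) => [|b _]; last first.
    by rewrite rmorphB /= map_polyX map_polyC.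
  rewrite -(big_map resO' xpredT (fun c => 'X - c%:P)) mu_prod_XsubC count_map.
  by rewrite size_filter.
pose t' := series_var (iota alpha).
have [q [qU qd]] := weierstrass_kval n hO alpha.
rewrite alpha_lift in qd.
pose h := \prod_(b <- B) (t' - b%:A).
have hd : distinguished resO' m h.
  have -> : h = \prod_(c <- [seq iota alpha - b | b <- B]) (series_T O' + c%:A).
    rewrite big_map; apply: eq_bigr => b _; rewrite /t' /series_var scalerBl; ring.
  rewrite -sB -(size_map (fun b => iota alpha - b) B); apply: distinguished_prod.
  move=> _ /mapP [b + ->]; rewrite mem_filter => /andP [/eqP bE _].
  by rewrite rmorphB resE alpha_lift bE subrr.
have gd : distinguished resO' m (series_map iota (q * kval n t)).
  have mapE i : scoef (series_map iota (q * kval n t)) i = iota (scoef (q * kval n t) i) by [].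
  have [g1 gbig gsmall] := qd; split=> [|i im|i im]; rewrite mapE.
  - by rewrite g1 rmorph1.
  - by rewrite gbig // rmorph0.
  - by rewrite resE gsmall // rmorph0.
have [v vE] : exists v, series_map iota (q * kval n t) = v * h.
  exists (series_map iota q * ((-1) ^+ e *: \prod_(b <- bs | resO' b != kappa abar) (t' - b%:A))).
  rewrite [LHS](rmorphM (series_map iota)) -mulrA; congr (_ * _).
  have kE : series_map iota (kval n t) = kval n t'.
    rewrite /t' -(series_map_var iota alpha); exact: (rmorph_kval n (series_map iota)).
  rewrite [LHS]kE -horner_kpol -(map_kpol (in_alg (series O'))) bsE map_polyZ hornerZ rmorph_prod.
  rewrite horner_prod /= mulr_algl -scalerAl; congr (_ *: _).
  rewrite (bigID (fun b => resO' b == kappa abar)) /= mulrC /h big_filter.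
  by congr (_ * _); apply: eq_bigr => b _;
    rewrite rmorphB /= map_polyX map_polyC hornerXsubC.
have gh := distinguished_assoc hO' gd hd vE.
exists O', F', resO', iota, kappa, (rem (iota alpha) B), q.
have permB := perm_to_rem alphaB; split=> //.
- by rewrite -(perm_uniq permB) -(perm_size permB) filter_uniq.
- move=> b; rewrite -(perm_mem permB) mem_filter -kroot /lifts_of_root /= int_eval_k.
  by split=> [/andP [/eqP ? /eqP ?]|[-> ->]]; rewrite ?eqxx.
- by rewrite gh /h (perm_big _ permB).
Qed.

End Roots.

Lemma L_function_formulas_kval (n : int) (p : nat) (F : finFieldType)
    (O : idomainType) (resO : {rmorphism O -> F}) (abar : F) (alpha : O)
    (rho : sl2rep (twist_group n) (series O)) :
  p \in [pchar F] -> (2 < p)%N -> is_cdvr0 resO -> kval n alpha = 0 -> resO alpha = abar ->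
  (forall d, is_L_function rho d <->
     principal_ideal (kval n (series_var alpha) ^+ 2) = principal_ideal d) ->
  L_function_formulas p resO abar alpha rho.
Proof.
move=> hp p2 hO kalpha alpha_lift LE; rewrite /L_function_formulas map_k_poly.
have kabar : kval n abar = 0 by rewrite -alpha_lift -rmorph_kval kalpha rmorph0.
have two0 : (2 : F) != 0.
  by rewrite -[2]/(2%:R) -(dvdn_pcharf hp) gtnNdvd.
split.
- by apply/LE; rewrite int_eval_k.
- rewrite -(intr_eq0_pchar _ hp) => n0.
  have dbar : (kpol F n)^`().[abar] != 0.
    have [u uE] := kval_deriv_root kabar; apply: contra_eq_neq uE => ->.
    by rewrite mulr0 eq_sym mulf_neq0.
  split; first by rewrite mup_simple // rootE horner_kpol kabar eqxx.
  (* At a root with nonzero residual derivative, k_n(t) is T times a unit. *)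
  apply/LE; rewrite series_var_subC; have [q ->] := kval_series kalpha.
  rewrite exprMn mulrC principal_ideal_unit //. rewrite unitrX //.
  rewrite series_unitE scoefD scoefTM0 addr0 scoefC mulr1 (cdvr_unitE hO).
  by rewrite -horner_map -deriv_map map_kpol alpha_lift.
move=> _; split; last first.
  by move=> O' F' resO' iota kappa s; exact: lifts_le_mup.
have [O' [F' [resO' [iota [kappa [s [q [ext us sP qU qE]]]]]]]] :=
  lifts_exist hO kalpha alpha_lift.
exists O', F', resO', iota, kappa, s; split=> //.
(* [q] is a unit, so this is another representative of the L-function, and it maps to the product
   over the lifts. *)
exists ((q * kval n (series_var alpha)) ^+ 2).
  by apply/LE; rewrite exprMn (principal_ideal_unit _ (unitrX 2 qU)).
rewrite [LHS](rmorphXn (series_map iota)) prodrXl; congr (_ ^+ 2); exact: qE.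
Qed.

Lemma principal_ideal_eq_up_to_unit (O : idomainType) (c d : series O) :
  c != 0 -> principal_ideal c = principal_ideal d -> eq_up_to_unit c d.
Proof.
move=> c0 e; have mem_id (f : series O) : principal_ideal f f by exists 1; rewrite mul1r.
have [s cd] : principal_ideal d c by rewrite -e; exact: mem_id.
have [s' dc] : principal_ideal c d by rewrite e; exact: mem_id.
exists s => //; apply/unitrP; exists s'.
suff ss : s' * s = 1 by rewrite [s * s']mulrC ss.
apply/eqP; rewrite -subr_eq0; apply/eqP; apply: (series_mul_eq0 _ c0).
by rewrite mulrBr mulr1 mulrA [c * s']mulrC -dc mulrC -cd subrr.
Qed.

Section Universal.
Variables (n : int) (F : finFieldType) (p : nat) (O : idomainType)
  (resO : {rmorphism O -> F}) (rhobar : sl2rep (twist_group n) F)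
  (abar : F) (alpha : O).
Hypotheses (hp : p \in [pchar F]) (p_gt2 : (2 < p)%N) (hO : is_cdvr0 resO).
Hypothesis rhobar_irr : absolutely_irreducible rhobar.
Hypotheses (tr_a : \tr (rhobar (twist_a n)) = abar)
  (tr_ab : \tr (rhobar (twist_a n * twist_b n)%g) = abar).
Hypotheses (kalpha : kval n alpha = 0) (alpha_lift : resO alpha = abar).
Local Notation t := (series_var alpha).
Local Notation resS := (resO \o @scoef0 O : {rmorphism series O -> F}).
Local Notation fx := (int_eval2 (dx_poly (f_poly n)) abar abar).
Local Notation fy := (int_eval2 (dy_poly (f_poly n)) abar abar).

Let tr_ab' : \tr (rhobar (twist_a n) *m rhobar (twist_b n)) = abar.
Proof. by rewrite -tr_ab rep_mxM. Qed.

Let kabar : kval n abar = 0.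
Proof. by rewrite -alpha_lift -rmorph_kval kalpha rmorph0. Qed.

Let two0 : (2 : F) != 0.
Proof. by rewrite -[2]/(2%:R) -(dvdn_pcharf hp) gtnNdvd. Qed.

Let lie0 := absolutely_irreducible_lie rhobar_irr.

Let zbar : 2 - zed abar abar != 0.
Proof.
have := lie0; rewrite det_lie ?rep_det //; last exact: rep_tr_ab.
by rewrite tr_a tr_ab'.
Qed.

Let localS : is_complete_local resS.
Proof. by have [w [w0 resw wP]] := cdvr_uniformizer hO; exact: series_complete_local w0 resw wP. Qed.

Let unitS r : (r \is a GRing.unit) = (resS r != 0).
Proof. by have [_ uE _] := localS. Qed.

Let scoef0_var : scoef0 t = alpha.
Proof. by rewrite /scoef0 /= mulr1 addr0. Qed.

Let res_var : resS t = abar.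
Proof. by rewrite -alpha_lift -[in RHS]scoef0_var. Qed.

Let fdiag (R : comNzRingType) (x : R) : kval n x = 0 -> fval n x x = 0.
Proof. by move=> kx; rewrite fval_diag_factor kx mul0r oppr0. Qed.

(** Hensel's lemma over the series ring prescribes y only modulo the maximal ideal; uniqueness over
    O then shows that the constant term is exactly alpha. *)
Lemma series_hensel (P : {poly series O}) :
  (map_poly (@scoef0 O) P).[alpha] = 0 ->
  resO (map_poly (@scoef0 O) P)^`().[alpha] != 0 ->
  exists! y, scoef0 y = alpha /\ P.[y] = 0.
Proof.
have C0 : scoef0 (alpha%:A : series O) = alpha by rewrite /scoef0 /= mulr1.
rewrite -{1 2}C0 deriv_map !horner_map => P0 dP.
have [||y Py resy] := @hensel _ _ _ localS P alpha%:A => //.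
  by rewrite /= P0 rmorph0.
have dPy : resS P^`().[y] != 0.
  by rewrite -horner_map resy horner_map.
exists y; split=> [|y' [y'0 Py']].
  split=> //; apply: (hensel_unique (cdvr_unitE hO) (p := map_poly (@scoef0 O) P)).
  - by rewrite [LHS]resy -[in RHS]C0.
  - by rewrite deriv_map horner_map.
  - by rewrite horner_map Py rmorph0.
  - by rewrite -{1}C0 horner_map.
apply: (hensel_unique unitS (p := P)) => //.
by rewrite resy; congr (resO _); exact: etrans C0 (esym y'0).
Qed.

Lemma yf_unique : fy != 0 -> exists! y, is_yf n alpha y.
Proof.
move=> fy0; have mapP : map_poly (@scoef0 O) (fpolY n t) = fpolY n alpha.
  by rewrite map_fpolY [X in fpolY n X]scoef0_var.
have [||y [[y0 fty] yuniq]] := series_hensel (P := fpolY n t); rewrite ?mapP.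
- by rewrite horner_fpolY fdiag.
- by rewrite deriv_fpolY rmorph_int_eval2 alpha_lift.
exists y; split; first by split=> //; rewrite int_eval2_f -horner_fpolY.
by move=> y' [y'0]; rewrite int_eval2_f -horner_fpolY => fty'; exact: yuniq.
Qed.

Lemma xf_unique : fx != 0 -> exists! x, is_xf n alpha x.
Proof.
move=> fx0; have mapP : map_poly (@scoef0 O) (fpolX n t) = fpolX n alpha.
  by rewrite map_fpolX [X in fpolX n X]scoef0_var.
have [||x [[x0 fxt] xuniq]] := series_hensel (P := fpolX n t); rewrite ?mapP.
- by rewrite horner_fpolX fdiag.
- by rewrite deriv_fpolX rmorph_int_eval2 alpha_lift.
exists x; split; first by split=> //; rewrite int_eval2_f -horner_fpolX.
by move=> x' [x'0]; rewrite int_eval2_f -horner_fpolX => fxt'; exact: xuniq.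
Qed.

(** T is evaluated at x - alpha, which lies in the maximal ideal. *)
Lemma evaluation_at (R : comUnitAlgType O) (res : {rmorphism R -> F}) (x : R) :
  is_complete_local_algebra resO res -> res x = abar ->
  exists psi : {lrmorphism series O -> R},
    [/\ psi t = x, forall f, res (psi f) = resS f
      & forall psi' : {lrmorphism series O -> R}, psi' t = x -> psi' =1 psi].
Proof.
move=> [localR resC] resx.
have varE (psi : {lrmorphism series O -> R}) : psi t = alpha%:A + psi (series_T O).
  by rewrite /series_var linearD linearZ /= rmorph1.
have [|psi [psiT resP uniq]] := @series_evaluation _ _ _ res (x - alpha%:A) localR.
  by rewrite rmorphB resC resx alpha_lift subrr.
exists psi; split=> [|f|psi' e]; first by rewrite varE psiT addrC subrK.
  by rewrite resP resC.
by apply: uniq; rewrite -e varE addrC addKr.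
Qed.

Lemma universal_in_x_exists : fy != 0 -> exists rho, universal_in_x resO alpha rhobar rho.
Proof.
move=> fy0; have [y [[y0 fty] _]] := yf_unique fy0.
have fty' : fval n t y = 0 by rewrite -int_eval2_f.
have resy : resS y = abar by rewrite /= y0.
have [||||rho [U trX trY]] := @universal_exists n O F resO hO rhobar lie0 t y.
- by rewrite tr_a; exact: res_var.
- by rewrite tr_ab'.
- by [].
- rewrite tr_a tr_ab' => R' res' x' y' localR resx' resy' fxy.
  have [psi [psit resP uniq]] := evaluation_at localR resx'.
  exists psi; split=> // [|psi' e _]; last exact: uniq.
  have [[_ uE _] _] := localR.
  (* The image of [y] under [psi] and y' are roots of the slice f_n(x', -) with equal residues,
     hence equal. *)
  apply: (hensel_unique uE (p := fpolY n x')); rewrite ?horner_fpolY //.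
  - by rewrite resP resy resy'.
  - by rewrite deriv_fpolY rmorph_int_eval2 resP resy resx'.
  - by rewrite -psit -rmorph_fval fty' rmorph0.
by exists rho; split=> //; rewrite trY.
Qed.

Lemma universal_in_y_exists : fx != 0 -> exists rho, universal_in_y resO alpha rhobar rho.
Proof.
move=> fx0; have [x [[x0 fxt] _]] := xf_unique fx0.
have fxt' : fval n x t = 0 by rewrite -int_eval2_f.
have resx : resS x = abar by rewrite /= x0.
have [||||rho [U trX trY]] := @universal_exists n O F resO hO rhobar lie0 x t.
- by rewrite tr_a.
- by rewrite tr_ab'; exact: res_var.
- by [].
- rewrite tr_a tr_ab' => R' res' x' y' localR resx' resy' fxy.
  have [psi [psit resP uniq]] := evaluation_at localR resy'.
  exists psi; split=> // [|psi' _ e]; last exact: uniq.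
  have [[_ uE _] _] := localR.
  apply: (hensel_unique uE (p := fpolX n y')); rewrite ?horner_fpolX //.
  - by rewrite resP resx resx'.
  - by rewrite deriv_fpolX rmorph_int_eval2 resP resx resy'.
  - by rewrite -psit -rmorph_fval fxt' rmorph0.
by exists rho; split=> //; rewrite trX.
Qed.

Lemma L_function_in_x rho d : fy != 0 -> universal_in_x resO alpha rhobar rho ->
  is_L_function rho d <-> principal_ideal (kval n t ^+ 2) = principal_ideal d.
Proof.
move=> fy0 [_ trX [Y0 fY]]; rewrite rep_mxM in Y0 fY; rewrite int_eval2_f in fY.
set Y := \tr _ in Y0 fY; have resY : resS Y = abar by rewrite /= Y0.
have [v vU vE] : exists2 v, v \is a GRing.unit & Y - t = v * kval n t.
  by apply: (diagonal_y unitS); rewrite ?res_var ?resY.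
have fXY : fval n (\tr (rho (twist_a n))) Y = 0 by rewrite trX.
have resX : resS (\tr (rho (twist_a n))) = abar by rewrite trX; exact: res_var.
rewrite -{1}trX in vE.
exact: (@L_functionE n (series O) F resS unitS rho abar fXY resX resY kabar two0 zbar v (kval n t) d vU vE
  (kval_series_sqr_neq0 hO kalpha)).
Qed.

Lemma L_function_in_y rho d : fx != 0 -> universal_in_y resO alpha rhobar rho ->
  is_L_function rho d <-> principal_ideal (kval n t ^+ 2) = principal_ideal d.
Proof.
move=> fx0 [_ trY [X0 fX]]; rewrite int_eval2_f in fX; rewrite rep_mxM in trY.
set X := \tr (rho _) in X0 fX; have resX : resS X = abar by rewrite /= X0.
have [v vU vE] : exists2 v, v \is a GRing.unit & X - t = v * kval n t.
  by apply: (diagonal_x unitS); rewrite ?res_var ?resX.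
set Y := \tr (_ *m _) in trY; have fXY : fval n X Y = 0 by rewrite trY.
have resY : resS Y = abar by rewrite trY; exact: res_var.
(* The variable is now y, so the difference y - x is t - x_f and the unit changes sign. *)
have {}vE : Y - X = - v * kval n t by rewrite mulNr -vE opprB trY.
rewrite -(unitrN v) in vU.
exact: (@L_functionE n (series O) F resS unitS rho abar fXY resX resY kabar two0 zbar (- v) (kval n t) d vU vE
  (kval_series_sqr_neq0 hO kalpha)).
Qed.

End Universal.

Theorem theorem3p25 (n : int) (F : finFieldType) (p : nat) (O : idomainType)
    (resO : {rmorphism O -> F}) (rhobar : sl2rep (twist_group n) F)
    (abar : F) (alpha : O)
    (hp : p \in [pchar F]) (p_gt2 : (2 < p)%N) (hO : is_cdvr0 resO)
    (rhobar_irr : absolutely_irreducible rhobar)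
    (rhobar_nonacyclic : ~ acyclic rhobar)
    (abar_root : int_eval (k_poly n) abar = 0)
    (tr_a : \tr (rhobar (twist_a n)) = abar)
    (tr_ab : \tr (rhobar (twist_a n * twist_b n)%g) = abar)
    (alpha_root : int_eval (k_poly n) alpha = 0)
    (alpha_lift : resO alpha = abar) :
  let fx := int_eval2 (dx_poly (f_poly n)) abar abar in
  let fy := int_eval2 (dy_poly (f_poly n)) abar abar in
  [/\ fy != 0 ->
        [/\ exists! y, is_yf n alpha y,
            exists rho, universal_in_x resO alpha rhobar rho
          & forall rho, universal_in_x resO alpha rhobar rho ->
              L_function_formulas p resO abar alpha rho],
      fx != 0 ->
        [/\ exists! x, is_xf n alpha x,
            exists rho, universal_in_y resO alpha rhobar rho
          & forall rho, universal_in_y resO alpha rhobar rho ->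
              L_function_formulas p resO abar alpha rho]
    & fx != 0 -> fy != 0 ->
        forall rhox rhoy,
          universal_in_x resO alpha rhobar rhox ->
          universal_in_y resO alpha rhobar rhoy ->
          forall dx dy, is_L_function rhox dx -> is_L_function rhoy dy ->
          eq_up_to_unit dx dy].
Proof.
move=> fx fy; have kalpha : kval n alpha = 0 by rewrite -int_eval_k.
have Lx rho d fy0 := @L_function_in_x n F p O resO rhobar abar alpha hp p_gt2 hO
  rhobar_irr tr_a tr_ab kalpha alpha_lift rho d fy0.
have Ly rho d fx0 := @L_function_in_y n F p O resO rhobar abar alpha hp p_gt2 hO
  rhobar_irr tr_a tr_ab kalpha alpha_lift rho d fx0.
split=> [fy0|fx0|fx0 fy0].
- split; first exact: (yf_unique hO kalpha alpha_lift fy0).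
    exact: (universal_in_x_exists hO rhobar_irr tr_a tr_ab kalpha alpha_lift fy0).
  move=> rho Urho; apply: L_function_formulas_kval => // d; exact: Lx.
- split; first exact: (xf_unique hO kalpha alpha_lift fx0).
    exact: (universal_in_y_exists hO rhobar_irr tr_a tr_ab kalpha alpha_lift fx0).
  move=> rho Urho; apply: L_function_formulas_kval => // d; exact: Ly.
(* Both L-functions generate the ideal of k_n(t)^2 in the one ring [series O], whose variable t
   stands for x or for y; the identification x = y is built in. *)
move=> rhox rhoy Ux Uy dx dy /(Lx _ _ fy0 Ux) ex /(Ly _ _ fx0 Uy) ey.
apply: principal_ideal_eq_up_to_unit; last by rewrite -ex.
apply: contraNneq (kval_series_sqr_neq0 hO kalpha) => dx0.
have : principal_ideal dx (kval n (series_var alpha) ^+ 2).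
  by rewrite -ex; exists 1; rewrite mul1r.
by move=> [s ->]; rewrite dx0 mulr0.
Qed.
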